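(* Let $1,w_1,\dots,w_J$ be linearly independent in $L_2([0,1]^2)$ and let the data follow the independent-dyad design: $(U_s,V_s)$ i.i.d. uniform on $[0,1]^2$ and $Y_s\mid U_s,V_s\sim\mathrm{Bernoulli}(w^\star(U_s,V_s))$, independently for $s=1,\dots,m$, where $w^\star$ is a graphon. For every graphon $w^\star$, every $m\ge1$ and every $\nu,\tau^2>0$, with $\kappa=\nu/(m\tau^2)$: (i) $$\mathbb E\|\hat w^+-w^\star\|^2\le\|w^\star-w^\circ\|^2+\frac{8c(w^\star)}{m}+\frac{8\kappa^2\|\beta^\circ\|^2}{\lambda}+d\exp\Big(-\frac m{7L}\Big),$$ and the posterior contracts at the same rate: for every $r>0$, $$\mathbb E\,\Pi_m\big(\{w:\|w-w^\circ\|^2>r\}\big)\le\frac1r\Big\{\frac{8c(w^\star)+2\nu d}{m}+\frac{8\kappa^2\|\beta^\circ\|^2}{\lambda}\Big\}+d\exp\Big(-\frac m{7L}\Big).$$ (ii) For every $m\ge3B^2/8$, $$\frac{3(d-1)}{512\,m}\le\inf_{\tilde w}\sup_{w^\star\in\mathcal W_{\mathcal H}}\mathbb E\|\tilde w-w^\star\|^2\le\sup_{w^\star\in\mathcal W_{\mathcal H}}\mathbb E\|\hat w^+-w^\star\|^2\le\frac{2d}m+\frac{8\nu^2}{m^2\tau^4\lambda^2}+d\exp\Big(-\frac m{7L}\Big),$$ the infimum being over all estimators measurable in $(U_s,V_s,Y_s)_{s\le m}$.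
   Context: A graphon is a measurable symmetric $w:[0,1]^2\to[0,1]$. $\|\cdot\|$ is the $L_2([0,1]^2)$ norm for functions and the Euclidean norm for vectors; $\|\cdot\|_\infty$ is the essential supremum. Agents are graphons $w_1,\dots,w_J$; $d=J+1$; $F=(1,w_1,\dots,w_J)^\top$; $\mathcal H=\{\beta^\top F:\beta\in\mathbb R^d\}$; $G=\int FF^\top$; $\lambda=\lambda_{\min}(G)>0$; $L=\|F^\top G^{-1}F\|_\infty$. For the truth $w^\star$: $\beta^\circ=G^{-1}\int Fw^\star$, $w^\circ=(\beta^\circ)^\top F$ is the orthogonal projection onto $\mathcal H$, $\sigma^2=w^\star(1-w^\star)+(w^\star-w^\circ)^2$, $c(w^\star)=\int\sigma^2F^\top G^{-1}F$. With $F_s=F(U_s,V_s)$: $\hat G=m^{-1}\sum_sF_sF_s^\top$, $\hat\beta=(\hat G+\kappa I_d)^{-1}m^{-1}\sum_sF_sY_s$, $\hat\Sigma=(\nu/m)(\hat G+\kappa I_d)^{-1}$; $\hat w=\hat\beta^\top F$ and $\hat w^+=\min\{\max(\hat w,0),1\}$. The (working) posterior $\Pi_m$ is the law, given the data, of $w=\beta^\top F$ with $\beta\sim N(\hat\beta,\hat\Sigma)$. $\mathcal W_{\mathcal H}=\{w\in\mathcal H:0\le w\le1\}$; $\mathcal H_0=\{h-\int h:h\in\mathcal H\}$, of dimension $d-1$; $B=\inf\sum_{k=1}^{d-1}\|\psi_k\|_\infty$ over orthonormal bases $(\psi_k)$ of $\mathcal H_0$ in $L_2([0,1]^2)$. 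*)

(* Defs.v *)
From HB Require Import structures.
From mathcomp Require Import all_boot all_order all_algebra.
From mathcomp Require Import all_classical all_reals all_analysis.
From mathcomp Require Import measurable_realfun ess_sup_inf.

Set Implicit Arguments.
Unset Strict Implicit.
Unset Printing Implicit Defensive.

Import Order.TTheory GRing.Theory Num.Theory.
Import numFieldNormedType.Exports.

Local Open Scope classical_set_scope.
Local Open Scope ring_scope.

(* Functions on [0,1]^2 are represented by functions on the plane. Norms,
   integrals, essential suprema and the design points are all taken with
   respect to the uniform probability on the unit square, so values off the
   square never matter. The alias measurableTypeR R of R is the carrier of the
   library's uniform and normal laws. *)
Notation plane R := (measurableTypeR R * measurableTypeR R)%type.

Definition usquare (R : realType) : probability (plane R) R :=
  (uniform_prob (@ltr01 R) \x uniform_prob (@ltr01 R))%E.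

Section product_law.
Context d (T : measurableType d) (n : nat).

Definition tuple_cons (x : T * n.-tuple T) : n.+1.-tuple T :=
  [the n.+1.-tuple T of x.1 :: x.2].

Lemma measurable_tuple_cons : measurable_fun [set: T * n.-tuple T] tuple_cons.
Proof. exact: measurable_cons. Qed.

HB.instance Definition _ := isMeasurableFun.Build _ _ _ _ tuple_cons
  measurable_tuple_cons.

End product_law.

(* The n-fold product probability: the law of n independent draws from Q. *)
Fixpoint iid_law d (T : measurableType d) (R : realType) (Q : probability T R)
    (n : nat) : probability (n.-tuple T) R :=
  match n return probability (n.-tuple T) R with
  | 0 => \d_([tuple] : 0.-tuple T)
  | n'.+1 => distribution (Q \x iid_law Q n')%E (@tuple_cons _ T n')
  end.

Section dyad_law.
Context (R : realType) (w : {mfun plane R >-> R}).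
Local Open Scope ereal_scope.

(* Joint law of ((U, V), Y). Where w p is outside [0, 1], bernoulli_prob (w p)
   is the Dirac mass at false; this is only ever the case on a null set. *)
Definition dyad_law (A : set (plane R * bool)) : \bar R :=
  \int[usquare R]_p bernoulli_prob (w p) (xsection A p).

Let mK : measurable_fun [set: plane R]
  (fun p => bernoulli_prob (w p) : pprobability bool R).
Proof.
apply: (measurableT_comp measurable_bernoulli_prob).
exact: measurable_funPT.
Qed.

Let bern : R.-pker plane R ~> bool := kprobability mK.

Let mxs (A : set (plane R * bool)) : measurable A ->
  measurable_fun [set: plane R]
    ((fun p => bernoulli_prob (w p) (xsection A p)) : plane R -> \bar R).
Proof.
by move=> mA; apply: (measurable_fun_xsection_finite_kernel bern); rewrite inE.
Qed.

Let dyad_law0 : dyad_law set0 = 0.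
Proof. by apply: integral0_eq => p _; rewrite xsection0 measure0. Qed.

Let dyad_law_ge0 A : 0 <= dyad_law A.
Proof. exact: integral_ge0. Qed.

Let dyad_law_sigma_additive : semi_sigma_additive dyad_law.
Proof.
move=> /= A mA tA mUA.
have -> : dyad_law (\bigcup_n A n) = \sum_(n <oo) dyad_law (A n).
  rewrite /dyad_law -integral_nneseries//; last by move=> n; exact: mxs (mA n).
  apply: eq_integral => p _; apply/esym/cvg_lim => //=; rewrite xsection_bigcup.
  apply: (measure_sigma_additive _ (trivIset_xsection tA)) => n.
  exact: measurable_xsection.
by apply: is_cvg_ereal_nneg_natsum_cond => n _ _; exact: dyad_law_ge0.
Qed.

HB.instance Definition _ := isMeasure.Build _ _ _ dyad_law
  dyad_law0 dyad_law_ge0 dyad_law_sigma_additive.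

Let dyad_law_setT : dyad_law [set: _] = 1.
Proof.
have xT p : xsection [set: plane R * bool] p = [set: bool].
  by apply/seteqP; split=> // y _; rewrite /xsection/= inE.
rewrite /dyad_law (eq_integral (cst 1)) => [|p _]; last first.
  by rewrite xT; exact: (probability_setT (bernoulli_prob (w p))).
by rewrite integral_cst// mul1e; exact: (probability_setT (usquare R)).
Qed.

HB.instance Definition _ := Measure_isProbability.Build _ _ _ dyad_law
  dyad_law_setT.

End dyad_law.

Section L2.
Context (R : realType).
Implicit Types f g : plane R -> R.

Definition normL2 f : \bar R := ('N[usquare R]_2%:E[EFin \o f])%E.

Definition normLoo f : R := fine ('N[usquare R]_+oo[EFin \o f])%E.

Definition graphon f : Prop := forall x y : R, 0 <= x <= 1 -> 0 <= y <= 1 ->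
  f (x, y) = f (y, x) /\ 0 <= f (x, y) <= 1.

End L2.

Definition lambda_min (R : realType) (n : nat) (A : 'M[R]_n) : R :=
  inf [set a : R | eigenvalue A a].

(* The law N(b, S), for positive semidefinite S: the law of b + A Z with
   A A^T = S and Z a vector of independent standard normals; it does not
   depend on the choice of A. *)
Definition mvnormal (R : realType) (n : nat) (b : 'cV[R]_n) (S : 'M[R]_n)
    (B : set 'cV[R]_n) : \bar R :=
  let A := xget 0 [set A : 'M[R]_n | A *m A^T = S] in
  iid_law (normal_prob 0 1 : probability (measurableTypeR R) R) n
    [set z | B (b + A *m \col_i tnth z i)].

Section model.
Context (R : realType) (J : nat) (w : 'I_J -> {mfun plane R >-> R}).
Local Notation mu := (usquare R).
Implicit Types (p : plane R) (b : 'cV[R]_J.+1).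

(* F = (1, w_1, ..., w_J)^T, so that d = J.+1. *)
Definition feat p : 'cV[R]_J.+1 :=
  \col_i (if unlift ord0 i is Some j then w j p else 1).

Definition lincomb b p : R := (b^T *m feat p) 0 0.

Definition lin_indep_L2 : Prop :=
  forall b, {ae mu, forall p, lincomb b p = 0} -> b = 0.

Definition gram : 'M[R]_J.+1 :=
  \matrix_(i, j) \int[mu]_p ((feat p *m (feat p)^T) i j).

Definition leverage p : R := ((feat p)^T *m invmx gram *m feat p) 0 0.

Definition Lconst : R := normLoo leverage.

Section truth.
Variable wstar : {mfun plane R >-> R}.

Definition beta_circ : 'cV[R]_J.+1 :=
  invmx gram *m \col_i \int[mu]_p (feat p i 0 * wstar p).

Definition w_circ : plane R -> R := lincomb beta_circ.

Definition sigma2 p : R :=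
  wstar p * (1 - wstar p) + (wstar p - w_circ p) ^+ 2.

Definition cconst : R := \int[mu]_p (sigma2 p * leverage p).

End truth.

Definition Hspace : set (plane R -> R) := range lincomb.

(* Membership in [0, 1] is an inequality between elements of L2, hence holds
   almost everywhere, in line with the essential suprema in Bconst. *)
Definition WH : set {mfun plane R >-> R} :=
  [set u | Hspace u /\ {ae mu, forall p, 0 <= u p <= 1}].

Definition H0 : set (plane R -> R) :=
  [set (fun p => h p - \int[mu]_q h q) | h in Hspace].

Definition onb_H0 (psi : 'I_J -> plane R -> R) : Prop :=
  [/\ forall k, H0 (psi k),
      forall k l, \int[mu]_p (psi k p * psi l p) = (k == l)%:R &
      forall h, H0 h -> exists a : 'I_J -> R,
        {ae mu, forall p, h p = \sum_(k < J) a k * psi k p}].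

Definition Bconst : R :=
  inf [set \sum_(k < J) normLoo (psi k) | psi in onb_H0].

Section sample.
Variable m : nat.
Local Notation data := (m.-tuple (plane R * bool)).
Implicit Types D : data.

Definition data_law (u : {mfun plane R >-> R}) : probability data R :=
  iid_law (dyad_law u) m.

Section estimator.
Variables (nu tau : R) (D : data).

Definition kappa : R := nu / (m%:R * tau ^+ 2).

Definition gram_hat : 'M[R]_J.+1 :=
  m%:R^-1 *: \sum_(s < m) (feat (tnth D s).1 *m (feat (tnth D s).1)^T).

Definition beta_hat : 'cV[R]_J.+1 :=
  invmx (gram_hat + kappa%:M) *m
  (m%:R^-1 *: \sum_(s < m) ((tnth D s).2%:R *: feat (tnth D s).1)).

Definition Sigma_hat : 'M[R]_J.+1 :=
  (nu / m%:R) *: invmx (gram_hat + kappa%:M).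

Definition w_hat : plane R -> R := lincomb beta_hat.

Definition w_hat_plus : plane R -> R :=
  fun p => Num.min (Num.max (w_hat p) 0) 1.

Definition posterior (W : set (plane R -> R)) : \bar R :=
  mvnormal beta_hat Sigma_hat [set b | W (lincomb b)].

End estimator.

Definition risk (est : data -> plane R -> R) (u : {mfun plane R >-> R})
    : \bar R :=
  (\int[data_law u]_D (normL2 (fun p => est D p - u p)%R) ^+ 2)%E.

Definition max_risk (est : data -> plane R -> R) : \bar R :=
  ereal_sup [set risk est u | u in WH].

(* Estimators range over jointly measurable functions of the data and of the
   point of the square; their integrated squared error may be infinite. *)
Definition minimax_risk : \bar R :=
  ereal_inf [set max_risk (fun D p => est (D, p)) |
    est in [set: {mfun (data * plane R)%type >-> R}]].

End sample.

End model.

(* Main.v *)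
Require Import Defs.
From HB Require Import structures.
From mathcomp Require Import all_boot all_order all_algebra.
From mathcomp Require Import all_classical all_reals all_analysis.
From mathcomp Require Import measurable_realfun ess_sup_inf.
From mathcomp Require Import ring lra.

Set Implicit Arguments.
Unset Strict Implicit.
Unset Printing Implicit Defensive.

Import Order.TTheory GRing.Theory Num.Theory.
Import numFieldNormedType.Exports.

Local Open Scope classical_set_scope.
Local Open Scope ring_scope.

(** The risk bound and the posterior bound rest on one event, on which the
    regularised empirical Gram matrix dominates half of the Gram matrix G of
    the agents.

    On this event ridge regression is a contraction up to a factor: the error
    of the coefficients is the inverse of the regularised matrix applied to a
    centred score minus a bias term, and duality bounds its G-norm by four
    times the dual norm of that vector ([dominated_sandwich], [ridge_error]).
    The score is a mean of independent centred vectors, so its squared dual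
    norm has expectation c / m ([iid_second_moment], [score_expectation]).
    Clipping to the unit interval can only help, and the projection of the
    truth splits off by orthogonality ([pythagoras], [clip_loss]). For the
    posterior, Chebyshev adds the trace of G times the covariance, at most
    2 nu d / m on the same event ([mvnormal_markov], [ridge_trace]).

    Off the event the loss is at most one, so its probability is the
    exponential term. After whitening it is a lower tail bound for a sum of m
    independent rank-one matrices x x^T with E x x^T = 1 and |x|^2 <= L. The
    usual potential is the trace of an exponential; here it is the trace of
    (1 + c S)^-N with N a large power of two, S being the sum of the rank-one
    matrices. Adding one of them to S multiplies
    the inverse, written A A^T, by an explicit matrix in the middle
    (Sherman and Morrison), and the trace inequality of Lieb and Thirring for
    exponents 2^k, which needs only Cauchy-Schwarz and induction
    ([lieb_thirring_pow2]), shows that the potential decreases on average by a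
    constant factor per draw ([rank_one_step], [matrix_chernoff]). With
    c L N = 7/10 the exponent per draw is below 7/20 - 50/101 < -1/7, in units
    of 1 / L ([chernoff_constants]).

    The lower bound is a hypercube argument. The vertices are
    1/2 + delta (sum of +-psi_k) with (psi_k) an orthonormal basis of the
    centred span whose total sup-norm nearly attains B; the condition on m
    keeps their values in [1/8, 7/8]. The loss at a vertex is at least the
    squared distance of the coefficients ([projection_coef]), and neighbours
    in direction k form a two-point problem whose chi-square divergence, 1
    included, is at most (1 + 6/(7m))^m <= 7 after m draws
    ([likelihood_ratio_flip], [two_point_bound]). Averaging over all edges
    gives (d - 1) delta^2 / 4 with delta^2 = 3 / (128 m) ([cube_risk_ge]). *)

(** * Quadratic forms and positive definite matrices *)

Section quadratic_forms.
Variable R : rcfType.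

Definition dotv n (u v : 'cV[R]_n) : R := (u^T *m v) 0 0.

Definition qform n (M : 'M[R]_n) (v : 'cV[R]_n) : R := (v^T *m M *m v) 0 0.

Definition posdef n (M : 'M[R]_n) : Prop :=
  M^T = M /\ forall v : 'cV_n, v != 0 -> 0 < qform M v.

Lemma dotvE n (u v : 'cV[R]_n) : dotv u v = \sum_i u i 0 * v i 0.
Proof. by rewrite /dotv mxE; apply: eq_bigr => i _; rewrite mxE. Qed.

Lemma dotvC n (u v : 'cV[R]_n) : dotv u v = dotv v u.
Proof. by rewrite !dotvE; apply: eq_bigr => i _; rewrite mulrC. Qed.

Lemma dotvv n (u : 'cV[R]_n) : dotv u u = \sum_i u i 0 ^+ 2.
Proof. by rewrite dotvE; apply: eq_bigr => i _; rewrite expr2. Qed.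

Lemma dotvv_ge0 n (u : 'cV[R]_n) : 0 <= dotv u u.
Proof. by rewrite dotvv; apply: sumr_ge0 => i _; exact: sqr_ge0. Qed.

Lemma dotvv_eq0 n (u : 'cV[R]_n) : (dotv u u == 0) = (u == 0).
Proof.
apply/idP/eqP => [|->]; last by rewrite /dotv mulmx0 mxE.
rewrite dotvv psumr_eq0 => [|i _]; last exact: sqr_ge0.
move=> /allP u0; apply/matrixP => i j; rewrite ord1 mxE; apply/eqP.
by have /implyP/(_ isT) := u0 i (mem_index_enum i); rewrite sqrf_eq0.
Qed.

Lemma dotvv_gt0 n (u : 'cV[R]_n) : u != 0 -> 0 < dotv u u.
Proof. by move=> u0; rewrite lt_def dotvv_ge0 dotvv_eq0 u0. Qed.

Lemma dotv_mulmx m n (A : 'M[R]_(m, n)) u v :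
  dotv u (A *m v) = dotv (A^T *m u) v.
Proof. by rewrite /dotv trmx_mul trmxK mulmxA. Qed.

Lemma dotvDl n (u v w : 'cV[R]_n) : dotv (u + v) w = dotv u w + dotv v w.
Proof. by rewrite /dotv linearD mulmxDl mxE. Qed.

Lemma dotvZl n a (u w : 'cV[R]_n) : dotv (a *: u) w = a * dotv u w.
Proof. by rewrite /dotv linearZ /= -scalemxAl mxE. Qed.

Lemma dotvDr n (u v w : 'cV[R]_n) : dotv w (u + v) = dotv w u + dotv w v.
Proof. by rewrite !(dotvC w) dotvDl. Qed.

Lemma dotvZr n a (u w : 'cV[R]_n) : dotv w (a *: u) = a * dotv w u.
Proof. by rewrite !(dotvC w) dotvZl. Qed.

Lemma qformE n (M : 'M[R]_n) v : qform M v = dotv v (M *m v).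
Proof. by rewrite /qform /dotv mulmxA. Qed.

Lemma qform_dotv n (v : 'cV[R]_n) : qform 1%:M v = dotv v v.
Proof. by rewrite qformE mul1mx. Qed.

Lemma qform0 n (M : 'M[R]_n) : qform M 0 = 0.
Proof. by rewrite /qform mulmx0 mxE. Qed.

Lemma qformD n (M N : 'M[R]_n) v : qform (M + N) v = qform M v + qform N v.
Proof. by rewrite /qform mulmxDr mulmxDl mxE. Qed.

Lemma qformZ n a (M : 'M[R]_n) v : qform (a *: M) v = a * qform M v.
Proof. by rewrite /qform -scalemxAr -scalemxAl mxE. Qed.

Lemma qform_sum n I (r : seq I) (P : pred I) (M : I -> 'M[R]_n) v :
  qform (\sum_(i <- r | P i) M i) v = \sum_(i <- r | P i) qform (M i) v.
Proof. by rewrite /qform mulmx_sumr mulmx_suml summxE. Qed.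

Lemma qform_scalar n a (v : 'cV[R]_n) : qform a%:M v = a * dotv v v.
Proof. by rewrite -scalemx1 qformZ qform_dotv. Qed.

Lemma qform_mul m n (A : 'M[R]_(m, n)) (M : 'M[R]_n) v :
  qform (A *m M *m A^T) v = qform M (A^T *m v).
Proof. by rewrite /qform trmx_mul trmxK !mulmxA. Qed.

Lemma qform_mulT m n (A : 'M[R]_(m, n)) v :
  qform (A *m A^T) v = dotv (A^T *m v) (A^T *m v).
Proof. by rewrite -qform_dotv -qform_mul mulmx1. Qed.

Lemma qform_outer n (x v : 'cV[R]_n) : qform (x *m x^T) v = dotv x v ^+ 2.
Proof. by rewrite qform_mulT dotvv big_ord1. Qed.

Lemma cauchy_schwarz n (u v : 'cV[R]_n) :
  dotv u v ^+ 2 <= dotv u u * dotv v v.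
Proof.
have [->|v0] := eqVneq v 0; first by rewrite /dotv !mulmx0 mxE expr2 !mulr0.
have h := dotvv_ge0 (dotv v v *: u + (- dotv u v) *: v).
have v_gt0 := dotvv_gt0 v0.
rewrite !(dotvDl, dotvDr, dotvZl, dotvZr) (dotvC v u) in h.
rewrite -(ler_pM2l v_gt0); lra.
Qed.

Lemma posdef_qform_ge0 n (M : 'M[R]_n) v : posdef M -> 0 <= qform M v.
Proof.
by case=> _ hM; have [->|/hM/ltW//] := eqVneq v 0; rewrite qform0.
Qed.

Lemma posdef_unit n (M : 'M[R]_n) : posdef M -> M \in unitmx.
Proof.
case=> symM hM; rewrite unitmxE unitfE; apply/negP => /det0P[v v0 vM].
have /hM : v^T != 0 by rewrite -(inj_eq trmx_inj) trmxK trmx0.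
by rewrite /qform trmxK vM mul0mx mxE ltxx.
Qed.

Lemma posdef_inv n (M : 'M[R]_n) : posdef M -> posdef (invmx M).
Proof.
move=> pM; have uM := posdef_unit pM; case: pM => symM hM.
split=> [|v v0]; first by rewrite trmx_inv symM.
have -> : qform (invmx M) v = qform M (invmx M *m v).
  by rewrite /qform trmx_mul trmx_inv symM !mulmxA mulmxKV.
apply: hM; apply: contra v0 => /eqP/(congr1 (mulmx M)).
by rewrite mulKVmx// mulmx0 => ->.
Qed.

Lemma posdef_ge n (M N : 'M[R]_n) : N^T = N -> posdef M ->
  (forall v, qform M v <= qform N v) -> posdef N.
Proof.
by move=> symN [_ hM] MN; split=> // v /hM; move=> /lt_le_trans; apply.
Qed.

Lemma posdef1 n : posdef (1%:M : 'M[R]_n).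
Proof. by split=> [|v v0]; rewrite ?trmx1// qform_dotv dotvv_gt0. Qed.

(** Eliminating the first variable of the quadratic form leaves its Schur
    complement, which is positive definite in one variable less. *)
Lemma cholesky n (M : 'M[R]_n) : posdef M ->
  exists2 A : 'M[R]_n, A \in unitmx & M = A *m A^T.
Proof.
elim: n M => [|n IHn] M pM.
  exists 1%:M; first exact: unitmx1.
  by apply/matrixP => -[].
case: (pM) => symM hM.
pose a := M 0 0; pose b : 'cV[R]_n := dlsubmx (M : 'M[R]_(1 + n)).
pose N : 'M[R]_n := drsubmx (M : 'M[R]_(1 + n)).
have ME : M = block_mx a%:M b^T b N :> 'M[R]_(1 + n).
  rewrite -[LHS](@submxK R 1 n 1 n) /a /b /N; congr block_mx.
    by rewrite [LHS]mx11_scalar !mxE; congr (M _ _)%:M; exact: val_inj.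
  by rewrite trmx_dlsub symM.
have a_gt0 : 0 < a.
  have e0 : (delta_mx 0 0 : 'cV[R]_n.+1) != 0.
    apply/eqP => /matrixP/(_ 0 0); rewrite !mxE eqxx => /eqP.
    by rewrite oner_eq0.
  have := hM _ e0; rewrite /qform trmx_delta -rowE.
  by rewrite -colE !mxE.
have symN : N^T = N by rewrite /N trmx_drsub symM.
have a0 : a != 0 by rewrite gt_eqF.
have pS : posdef (N - a^-1 *: (b *m b^T)).
  split=> [|v v0].
    by rewrite linearB linearZ /= trmx_mul trmxK symN.
  pose t := - a^-1 * dotv b v.
  pose x : 'cV[R]_(1 + n) := col_mx t%:M v.
  have x0 : x != 0.
    apply: contra v0 => /eqP/(congr1 (@dsubmx R 1 n 1)).
    by rewrite /x col_mxKd linear0 => ->.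
  have := hM _ x0; congr (_ < _).
  rewrite /qform ME /x (@tr_col_mx R 1 n 1) (@mul_row_block R 1 1 n 1 n) (@mul_row_col R 1 1 n 1).
  rewrite tr_scalar_mx !mul_scalar_mx !mul_mx_scalar.
  have b1 : v^T *m b = (dotv b v)%:M.
    by rewrite [LHS]mx11_scalar -/(dotv v b) dotvC.
  have b2 : b^T *m v = (dotv b v)%:M by rewrite [LHS]mx11_scalar.
  rewrite b1 mulmxDl -scalemxAl b2 mulmxBr mulmxBl.
  rewrite -scalemxAr -scalemxAl mulmxA b1 mul_scalar_mx.
  rewrite -scalemxAl b2.
  rewrite !mxE !eqxx !mulr1n /t.
  by field.
have [B uB SE] := IHn _ pS.
pose s := Num.sqrt a.
have s0 : s != 0 by rewrite gt_eqF// sqrtr_gt0.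
have ss : s * s = a by rewrite -expr2 sqr_sqrtr// ltW.
pose A : 'M[R]_(1 + n) := block_mx s%:M 0 (s^-1 *: b) B.
exists A.
  rewrite unitmxE (@det_lblock R 1 n) det_scalar unitrM -unitmxE uB andbT.
  by rewrite unitfE expf_neq0.
rewrite /A (@tr_block_mx R 1 n 1 n) (@mulmx_block R 1 n 1 n 1 n) ME.
rewrite trmx0 !mul0mx !mulmx0 !addr0 tr_scalar_mx linearZ /=.
rewrite -scalar_mxM ss mul_mx_scalar mul_scalar_mx !scalerA mulfV// !scale1r.
by rewrite -scalemxAl -scalemxAr scalerA -invfM ss -SE addrC subrK.
Qed.

Lemma qform_invmx_mulT n (A : 'M[R]_n) v : A \in unitmx ->
  qform (invmx (A *m A^T)) v = dotv (invmx A *m v) (invmx A *m v).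
Proof.
move=> uA; have uAT : A^T \in unitmx by rewrite unitmx_tr.
have uAA : A *m A^T \in unitmx by rewrite unitmx_mul uA.
have -> : invmx (A *m A^T) = (invmx A)^T *m (invmx A)^T^T.
  apply: (can_inj (mulKmx uAA)).
  by rewrite mulmxV// trmxK trmx_inv mulmxA (mulmxK uAT) mulmxV.
by rewrite qform_mulT trmxK.
Qed.

(** Cauchy-Schwarz between a norm and its dual; it takes the place of square
    roots of M in the comparisons below. *)
Lemma posdef_dual_cs n (M : 'M[R]_n) u v : posdef M ->
  dotv u v ^+ 2 <= qform M u * qform (invmx M) v.
Proof.
move=> /[dup] pM /cholesky[A uA ->].
have -> : dotv u v = dotv (A^T *m u) (invmx A *m v).
  by rewrite dotvC -dotv_mulmx mulKVmx// dotvC.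
by rewrite qform_mulT qform_invmx_mulT// cauchy_schwarz.
Qed.

Lemma qform_invE n (M : 'M[R]_n) v : posdef M ->
  qform (invmx M) v = qform M (invmx M *m v).
Proof.
move=> pM; have uM := posdef_unit pM; case: pM => symM _.
by rewrite /qform trmx_mul trmx_inv symM !mulmxA mulmxKV.
Qed.

Lemma dominated_inv n (M N : 'M[R]_n) a v : 0 < a -> posdef M -> posdef N ->
  (forall u, a * qform M u <= qform N u) ->
  a * qform (invmx N) v <= qform (invmx M) v.
Proof.
move=> a0 pM pN MN; have /[dup] b0 := posdef_qform_ge0 v (posdef_inv pN).
rewrite le_eqVlt => /predU1P[<-|bgt].
  by rewrite mulr0 posdef_qform_ge0//; exact: posdef_inv.
have h1 := posdef_dual_cs (invmx N *m v) v pM.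
rewrite dotvC -qformE in h1; have h2 := MN (invmx N *m v).
rewrite -qform_invE// in h2.
set p := qform (invmx N) v in h1 h2 b0 bgt *.
set q := qform (invmx M) v in h1 *.
have q0 : 0 <= q by apply: posdef_qform_ge0; exact: posdef_inv.
rewrite -(ler_pM2r bgt).
have : a * (p * p) <= p * q.
  apply: (le_trans (_ : _ <= a * qform M (invmx N *m v) * q)).
    by rewrite -mulrA ler_pM2l// -expr2.
  by rewrite ler_wpM2r.
by rewrite mulrA (mulrC p q).
Qed.

(** The bound behind ridge regression: a Hessian that dominates half the Gram
    matrix inflates a dual norm by a factor four at most. *)
Lemma dominated_sandwich n (M N : 'M[R]_n) a v : 0 < a -> posdef M -> posdef N ->
  (forall u, a * qform M u <= qform N u) ->
  a ^+ 2 * qform M (invmx N *m v) <= qform (invmx M) v.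
Proof.
move=> a0 pM pN MN; have h1 := posdef_dual_cs (invmx N *m v) v pM.
rewrite dotvC -qformE in h1; have := MN (invmx N *m v).
rewrite -qform_invE//.
set p := qform (invmx N) v in h1 *.
set q := qform (invmx M) v in h1 *; set r := qform M _ in h1 * => h2.
have r0 : 0 <= r by exact: posdef_qform_ge0.
have q0 : 0 <= q by apply: posdef_qform_ge0; exact: posdef_inv.
move: r0; rewrite le_eqVlt => /predU1P[<-|r0]; first by rewrite mulr0.
rewrite -(ler_pM2r r0).
have : (a * r) ^+ 2 <= p ^+ 2 by rewrite ler_pXn2r// nnegrE ?mulr_ge0//; nra.
nra.
Qed.

Lemma trace_qform n (A : 'M[R]_n) : \tr A = \sum_i qform A (delta_mx i 0).
Proof.
by apply: eq_bigr => i _; rewrite /qform trmx_delta -rowE -colE !mxE.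
Qed.

Lemma trace_mul_qform n (A N : 'M[R]_n) :
  \tr (A *m A^T *m N) = \sum_i qform N (A *m delta_mx i 0).
Proof.
rewrite -mulmxA mxtrace_mulC trace_qform; apply: eq_bigr => i _.
by rewrite /qform trmx_mul !mulmxA.
Qed.

Lemma dominated_trace n (M N : 'M[R]_n) a : 0 < a -> posdef M -> posdef N ->
  (forall u, a * qform M u <= qform N u) ->
  a * \tr (M *m invmx N) <= n%:R.
Proof.
move=> a0 /[dup] pM /cholesky[A uA ME] pN MN.
have <- : \tr (M *m invmx M) = n%:R by rewrite mulmxV ?posdef_unit// mxtrace1.
rewrite [in X in _ * X]ME [X in _ <= \tr (X *m _)]ME !trace_mul_qform mulr_sumr.
by apply: ler_sum => i _; exact: dominated_inv.
Qed.

End quadratic_forms.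

(** * A trace inequality and the rank-one step of the trace potential *)

Section trace_power.
Variable R : rcfType.

Lemma trace_sqr m n (A : 'M[R]_(m, n)) :
  \tr (A *m A^T) = \sum_i \sum_j A i j ^+ 2.
Proof.
apply: eq_bigr => i _; rewrite mxE; apply: eq_bigr => j _.
by rewrite mxE expr2.
Qed.

Lemma trace_sqr_ge0 m n (A : 'M[R]_(m, n)) : 0 <= \tr (A *m A^T).
Proof.
by rewrite trace_sqr; apply: sumr_ge0 => i _; apply: sumr_ge0 => j _; exact: sqr_ge0.
Qed.

Lemma trace_mul_le n (A B : 'M[R]_n) :
  \tr (A *m B) <= (\tr (A *m A^T) + \tr (B^T *m B)) / 2.
Proof.
have := trace_sqr_ge0 (A - B^T).
rewrite linearB /= trmxK mulmxBl !mulmxBr !linearB /= -trmx_mul mxtrace_tr.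
lra.
Qed.

Lemma expmxS n (A : 'M[R]_n) k : A ^+ k.+1 = A *m A ^+ k.
Proof. exact: exprS. Qed.

Lemma expmxSr n (A : 'M[R]_n) k : A ^+ k.+1 = A ^+ k *m A.
Proof. exact: exprSr. Qed.

Lemma expmxD n (A : 'M[R]_n) i j : A ^+ (i + j) = A ^+ i *m A ^+ j.
Proof. exact: exprD. Qed.

Lemma expmx_pow2S n (A : 'M[R]_n) k :
  A ^+ (2 ^ k.+1) = A ^+ (2 ^ k) *m A ^+ (2 ^ k).
Proof. by rewrite expnS mul2n -addnn expmxD. Qed.

Lemma trmx_exp n (A : 'M[R]_n) k : (A ^+ k)^T = A^T ^+ k.
Proof.
elim: k => [|k IHk]; first by rewrite !expr0 trmx1.
by rewrite expmxS trmx_mul IHk -expmxSr.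
Qed.

Lemma trace_exp_mulC n (A B : 'M[R]_n) k :
  \tr ((A *m B) ^+ k) = \tr ((B *m A) ^+ k).
Proof.
have mulexp j : (A *m B) ^+ j *m A = A *m (B *m A) ^+ j.
  elim: j => [|j IHj]; first by rewrite !expr0 mul1mx mulmx1.
  by rewrite !expmxS -!mulmxA IHj.
case: k => [|k]; first by rewrite !expr0.
by rewrite expmxSr mulmxA mulexp mxtrace_mulC mulmxA -expmxS.
Qed.

(** The two inequalities feed each other: doubling the exponent in the first
    one calls the second with the matrix product, doubling it in the second
    one calls the first with the two Gram matrices of the same matrix. *)
Lemma lieb_thirring_pow2 n k :
  (forall A B : 'M[R]_n, A^T = A -> B^T = B ->
     \tr ((A *m B) ^+ (2 ^ k)) <= \tr (A ^+ (2 ^ k) *m B ^+ (2 ^ k))) /\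
  (forall M : 'M[R]_n,
     \tr (M ^+ (2 ^ k.+1)) <= \tr ((M *m M^T) ^+ (2 ^ k))).
Proof.
elim: k => [|k [LT W]].
  split=> [A B _ _|M]; first by rewrite !expr1.
  rewrite expn0 expn1 expr1 expr2; apply: le_trans (trace_mul_le M M) _.
  by rewrite (mxtrace_mulC M^T); lra.
have sqE (A : 'M[R]_n) : A ^+ (2 ^ k.+1) = (A *m A) ^+ (2 ^ k).
  by rewrite expnS exprM expr2.
split=> [A B symA symB|M].
  apply: le_trans (W _) _; rewrite trmx_mul symA symB -!mulmxA trace_exp_mulC.
  rewrite -!mulmxA mulmxA [leRHS]mxtrace_mulC !sqE.
  by apply: LT; rewrite trmx_mul ?symA ?symB.
have -> : M ^+ (2 ^ k.+2) = (M *m M) ^+ (2 ^ k.+1) by rewrite expnS exprM expr2.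
apply: le_trans (W _) _.
rewrite trmx_mul -!mulmxA trace_exp_mulC -!mulmxA mulmxA trace_exp_mulC.
apply: le_trans (LT _ _ _ _) _; rewrite ?trmx_mul ?trmxK//.
apply: le_trans (trace_mul_le _ _) _.
rewrite !trmx_exp !trmx_mul !trmxK -!expmx_pow2S.
by rewrite trace_exp_mulC; lra.
Qed.

Lemma lieb_thirring n k (A B : 'M[R]_n) : A^T = A -> B^T = B ->
  \tr ((A *m B) ^+ (2 ^ k)) <= \tr (A ^+ (2 ^ k) *m B ^+ (2 ^ k)).
Proof. exact: (lieb_thirring_pow2 n k).1. Qed.

(** The decrease of the potential along a direction of leverage r; summing the
    geometric series it is (1 - (1 + c r)^-N) / r. *)
Definition rank_one_gain (c r : R) (N : nat) : R :=
  c * \sum_(i < N) (1 + c * r) ^- i.+1.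

Lemma rank_one_gainE c r N : 0 < c -> 0 <= r ->
  r * rank_one_gain c r N = 1 - (1 + c * r) ^- N.
Proof.
move=> c0 r0; have q0 : 1 + c * r != 0 by rewrite gt_eqF// ltr_wpDr ?mulr_ge0// ltW.
rewrite /rank_one_gain; elim: N => [|N IHN].
  by rewrite big_ord0 expr0 invr1 subrr !mulr0.
rewrite big_ord_recr /= !mulrDr {}IHN exprS invfM; field.
by rewrite expf_neq0.
Qed.

Lemma rank_one_gain_anti c r s N : 0 < c -> 0 <= r -> r <= s ->
  rank_one_gain c s N <= rank_one_gain c r N.
Proof.
move=> c0 r0 rs; rewrite ler_pM2l//; apply: ler_sum => i _.
have h1 : 0 < 1 + c * r by rewrite ltr_wpDr ?mulr_ge0// ltW.
have h2 : 1 + c * r <= 1 + c * s by rewrite lerD2l ler_pM2l.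
have h3 : 0 < 1 + c * s by exact: lt_le_trans h2.
rewrite lef_pV2 ?posrE ?exprn_gt0//.
by apply: lerXn2r => //; rewrite nnegrE ltW.
Qed.

Lemma rank_one_gain_ge0 c r N : 0 < c -> 0 <= r -> 0 <= rank_one_gain c r N.
Proof.
move=> c0 r0; rewrite mulr_ge0 ?(ltW c0)//; apply: sumr_ge0 => i _.
by rewrite invr_ge0 exprn_ge0// addr_ge0// mulr_ge0// ltW.
Qed.

Lemma outer_mul n (y : 'cV[R]_n) : y *m y^T *m (y *m y^T) = dotv y y *: (y *m y^T).
Proof.
rewrite mulmxA -(mulmxA y y^T y) [y^T *m y]mx11_scalar -/(dotv y y).
by rewrite mul_mx_scalar -scalemxAl.
Qed.

(** Powers of the middle factor: on the line of y it acts as multiplication by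
    1 / (1 + c |y|^2), elsewhere as the identity. *)
Lemma rank_one_power n c (y : 'cV[R]_n) N : 0 < c ->
  (1%:M - (c / (1 + c * dotv y y)) *: (y *m y^T)) ^+ N =
  1%:M - rank_one_gain c (dotv y y) N *: (y *m y^T).
Proof.
move=> c0; have q0 : 1 + c * dotv y y != 0.
  by rewrite gt_eqF// ltr_wpDr ?mulr_ge0 ?dotvv_ge0// ltW.
elim: N => [|N IHN].
  by rewrite expr0 /rank_one_gain big_ord0 mulr0 scale0r subr0.
rewrite expmxS {}IHN mulmxBl mul1mx mulmxBr mulmx1.
rewrite -scalemxAl -scalemxAr outer_mul !scalerA.
set q := (1 + c * dotv y y)^-1; set r := dotv y y in q0 q *.
have -> : rank_one_gain c r N.+1 = rank_one_gain c r N +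
    (c * q - c * q * rank_one_gain c r N * r).
  rewrite /rank_one_gain big_ord_recl /= expr1.
  under eq_bigr do rewrite exprS invfM.
  by rewrite -mulr_sumr /q; field.
by rewrite scalerDl scalerBl [in RHS]opprD addrA.
Qed.

Lemma posdef_rank_one n (T : 'M[R]_n) c (x : 'cV_n) : 0 <= c -> posdef T ->
  posdef (T + c *: (x *m x^T)).
Proof.
move=> c0 pT; apply: posdef_ge (pT) _ => [|v].
  by rewrite linearD linearZ /= trmx_mul trmxK pT.1.
by rewrite qformD qformZ qform_outer lerDl mulr_ge0 ?sqr_ge0.
Qed.

(** With the inverse written A A^T, the rank-one update of the inverse is
    A C A^T for an explicit C (Sherman and Morrison), and the trace
    inequality separates the powers of A^T A from those of C. *)
Lemma rank_one_step n k (T : 'M[R]_n) c (x : 'cV_n) L : 0 < c -> posdef T ->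
  qform (invmx T) x <= L ->
  \tr (invmx (T + c *: (x *m x^T)) ^+ (2 ^ k)) <=
  \tr (invmx T ^+ (2 ^ k)) -
    rank_one_gain c L (2 ^ k) * qform (invmx T ^+ (2 ^ k).+1) x.
Proof.
move=> c0 pT xL; have [A _ RE] := cholesky (posdef_inv pT).
set y := A^T *m x; have rE : dotv y y = qform (invmx T) x by rewrite RE qform_mulT.
have q0 : 1 + c * dotv y y != 0.
  by rewrite gt_eqF// ltr_wpDr ?mulr_ge0 ?dotvv_ge0// ltW.
have TA : T *m A *m A^T = 1%:M by rewrite -mulmxA -RE mulmxV// posdef_unit.
set C : 'M[R]_n := 1%:M - (c / (1 + c * dotv y y)) *: (y *m y^T).
have -> : invmx (T + c *: (x *m x^T)) = A *m C *m A^T.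
  have u' := posdef_unit (posdef_rank_one x (ltW c0) pT).
  apply: (can_inj (mulKmx u')); rewrite mulmxV// !mulmxA mulmxDl.
  have xA : c *: (x *m x^T) *m A = c *: (x *m y^T).
    by rewrite -scalemxAl -mulmxA /y trmx_mul trmxK.
  rewrite xA /C mulmxBr mulmx1 mulmxBl mulmxDl TA -scalemxAr.
  rewrite mulmxDl [T *m A *m (y *m y^T)]mulmxA {1}/y [T *m A *m _]mulmxA TA mul1mx.
  have -> : c *: (x *m y^T) *m (y *m y^T) = (c * dotv y y) *: (x *m y^T).
    rewrite -scalemxAl mulmxA -(mulmxA x) [y^T *m y]mx11_scalar -/(dotv y y).
    by rewrite mul_mx_scalar -scalemxAl scalerA.
  rewrite -/y (_ : x *m y^T + _ = (1 + c * dotv y y) *: (x *m y^T)).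
    by rewrite scalerA divfK// addrK.
  by rewrite scalerDl scale1r.
have -> : \tr ((A *m C *m A^T) ^+ (2 ^ k)) = \tr ((A^T *m A *m C) ^+ (2 ^ k)).
  by rewrite trace_exp_mulC mulmxA.
apply: le_trans (lieb_thirring _ _ _) _.
- by rewrite trmx_mul trmxK.
- by rewrite linearB linearZ /= trmx1 trmx_mul trmxK.
rewrite rank_one_power// mulmxBr mulmx1 linearB /= RE [in leRHS]trace_exp_mulC.
rewrite lerD2l lerN2 -scalemxAr linearZ /=.
have -> : \tr ((A^T *m A) ^+ (2 ^ k) *m (y *m y^T)) =
    qform ((A *m A^T) ^+ (2 ^ k).+1) x.
  have mulexp j : A *m (A^T *m A) ^+ j *m A^T = (A *m A^T) ^+ j.+1.
    elim: j => [|j IHj]; first by rewrite expr0 mulmx1 expr1.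
    by rewrite (expmxSr _ j.+1) -IHj expmxSr !mulmxA.
  rewrite mulmxA mxtrace_mulC -mulexp /qform /y trmx_mul trmxK !mulmxA.
  by rewrite [LHS]big_ord1.
rewrite -RE ler_wpM2r//; last by rewrite rank_one_gain_anti// ?dotvv_ge0// rE.
have [P PE] : exists P : 'M[R]_n, invmx T ^+ (2 ^ k).+1 = P *m P^T.
  have [symR _] := posdef_inv pT.
  case: k => [|k]; first by exists (invmx T); rewrite symR.
  exists (invmx T ^+ (2 ^ k) *m A).
  rewrite trmx_mul trmx_exp symR !mulmxA -(mulmxA _ A) -RE.
  by rewrite -!expmxSr -expmxD addSn addnn -mul2n -expnS.
by rewrite PE qform_mulT dotvv_ge0.
Qed.

Lemma norm_mulmx_le m n (A : 'M[R]_(m, n)) v :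
  dotv (A *m v) (A *m v) <= \tr (A *m A^T) * dotv v v.
Proof.
rewrite trace_sqr mulr_suml dotvv; apply: ler_sum => i _.
have -> : (A *m v) i 0 = dotv (row i A)^T v.
  by rewrite /dotv trmxK -row_mul [RHS]mxE.
apply: le_trans (cauchy_schwarz _ _) _; rewrite dotvv ler_wpM2r ?dotvv_ge0//.
by apply: ler_sum => j _; rewrite !mxE.
Qed.

(** Jensen for the spectral measure of v, with no spectral decomposition: as
    the exponent is a power of two, each doubling is an instance of
    Cauchy-Schwarz. *)
Lemma posdef_inv_pow2_ge n k (T : 'M[R]_n) a v : 0 < a -> posdef T ->
  qform T v <= a * dotv v v ->
  dotv v v <= a ^+ (2 ^ k) * qform (invmx T ^+ (2 ^ k)) v.
Proof.
move=> a0 pT Tv; have [->|v0] := eqVneq v 0.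
  by rewrite qform0 mulr0 /dotv mulmx0 mxE.
have vv := dotvv_gt0 v0; have [symR _] := posdef_inv pT.
elim: k => [|k IHk].
  rewrite !expr1 -(ler_pM2l vv) -expr2.
  apply: le_trans (posdef_dual_cs v v pT) _; rewrite mulrA (mulrC (dotv v v)).
  by rewrite ler_wpM2r// posdef_qform_ge0//; exact: posdef_inv.
set P := invmx T ^+ (2 ^ k) in IHk *.
have -> : invmx T ^+ (2 ^ k.+1) = P *m P^T.
  by rewrite /P trmx_exp symR -expmx_pow2S.
rewrite qform_mulT expnS mulnC exprM -(ler_pM2l vv).
have symP : P^T = P by rewrite /P trmx_exp symR.
have := cauchy_schwarz v (P^T *m v); rewrite symP -qformE => h.
have aN : 0 < a ^+ (2 ^ k) by rewrite exprn_gt0.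
set b := a ^+ _ in IHk aN *.
apply: le_trans (_ : _ <= b ^+ 2 * qform P v ^+ 2) _.
  by rewrite -exprMn -expr2 ler_pXn2r ?nnegrE ?(ltW vv)// (le_trans (ltW vv)).
by rewrite [leRHS]mulrCA ler_pM2l// exprn_gt0.
Qed.

(** A direction in which T is small forces the potential to be large. *)
Lemma trace_pow2_ge n k (T : 'M[R]_n) a v : 0 < a -> posdef T -> v != 0 ->
  qform T v <= a * dotv v v ->
  1 <= a ^+ (2 ^ k.+1) * \tr (invmx T ^+ (2 ^ k.+1)).
Proof.
move=> a0 pT v0 Tv; have vv := dotvv_gt0 v0; have [symR _] := posdef_inv pT.
rewrite -(ler_pM2r vv) mul1r -mulrA.
apply: le_trans (posdef_inv_pow2_ge k.+1 a0 pT Tv) _.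
rewrite ler_pM2l ?exprn_gt0//.
set P := invmx T ^+ (2 ^ k).
have -> : invmx T ^+ (2 ^ k.+1) = P *m P^T.
  by rewrite /P trmx_exp symR -expmx_pow2S.
rewrite qform_mulT mxtrace_mulC.
by apply: le_trans (norm_mulmx_le _ _) _; rewrite trmxK.
Qed.

Lemma trace_exp_succ_ge n k (T : 'M[R]_n) a : 0 < a -> posdef T ->
  (forall v, qform T v <= a * dotv v v) ->
  \tr (invmx T ^+ (2 ^ k.+1)) <= a * \tr (invmx T ^+ (2 ^ k.+1).+1).
Proof.
move=> a0 pT Ta; have [symR _] := posdef_inv pT.
set P := invmx T ^+ (2 ^ k).
have PE : invmx T ^+ (2 ^ k.+1) = P *m P^T.
  by rewrite /P trmx_exp symR -expmx_pow2S.
rewrite expmxSr PE trace_mul_qform -[P *m P^T]mulmx1 trace_mul_qform.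
rewrite mulr_sumr; apply: ler_sum => i _; rewrite qform_dotv.
by have := posdef_inv_pow2_ge 0 a0 pT (Ta (P *m delta_mx i 0)); rewrite !expr1.
Qed.

Lemma trace_pow2_ge0 n k (T : 'M[R]_n) : posdef T ->
  0 <= \tr (invmx T ^+ (2 ^ k)).
Proof.
move=> pT; have [symR _] := posdef_inv pT.
case: k => [|k]; last first.
  by rewrite expmx_pow2S -{2}symR -trmx_exp trace_sqr_ge0.
by have [A _ ->] := cholesky (posdef_inv pT); rewrite expr1 trace_sqr_ge0.
Qed.

End trace_power.

(** * Integration lemmas *)

Section integration.
Import HBNNSimple.
Local Open Scope ereal_scope.

(** Monotonicity read off the supremum over simple functions. It serves the
    posterior mass, which depends on the data through an arbitrary choice of a
    factor of the covariance. *)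
Lemma ge0_le_integralT d (T : measurableType d) (R : realType)
    (mu : {measure set T -> \bar R}) (f g : T -> \bar R) :
  (forall x, 0 <= f x) -> (forall x, f x <= g x) ->
  \int[mu]_x f x <= \int[mu]_x g x.
Proof.
move=> f0 fg.
have g0 x : 0 <= g x by exact: le_trans (fg x).
rewrite !ge0_integralTE//; apply: ereal_sup_le => _ [h hf <-].
by exists h => // x; exact: le_trans (fg x).
Qed.

Section mixture.
Context d d' (X : measurableType d) (Y : measurableType d') (R : realType).
Variables (mu : {measure set X -> \bar R}) (nu : {measure set Y -> \bar R}).
Variables (rho1 rho2 : X -> R) (phi1 phi2 : X -> Y).
Hypotheses (m1 : measurable_fun setT rho1) (m2 : measurable_fun setT rho2).
Hypotheses (r1 : forall x, (0 <= rho1 x)%R) (r2 : forall x, (0 <= rho2 x)%R).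
Hypotheses (mphi1 : measurable_fun setT phi1) (mphi2 : measurable_fun setT phi2).
Hypothesis nuE : forall A, measurable A ->
  nu A = \int[mu]_x ((rho1 x)%:E * (\1_A (phi1 x))%:E +
                     (rho2 x)%:E * (\1_A (phi2 x))%:E).

Let Phi (f : Y -> \bar R) :=
  \int[mu]_x ((rho1 x)%:E * f (phi1 x) + (rho2 x)%:E * f (phi2 x)).

Let mPhi f : measurable_fun setT f ->
  measurable_fun setT
    (fun x => (rho1 x)%:E * f (phi1 x) + (rho2 x)%:E * f (phi2 x)).
Proof.
move=> mf; apply: emeasurable_funD.
  by apply: emeasurable_funM; [exact/measurable_EFinP|exact: measurableT_comp].
by apply: emeasurable_funM; [exact/measurable_EFinP|exact: measurableT_comp].
Qed.

Let Phi_ge0 f : (forall y, 0 <= f y) ->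
  forall x, 0 <= (rho1 x)%:E * f (phi1 x) + (rho2 x)%:E * f (phi2 x).
Proof. by move=> f0 x; rewrite adde_ge0// mule_ge0// lee_fin. Qed.

Let Phi_nnsfun (h : {nnsfun Y >-> R}) :
  \int[nu]_y (h y)%:E = Phi (EFin \o h).
Proof.
under eq_integral do rewrite fimfunE -fsumEFin//.
rewrite ge0_integral_fsum//; last 2 first.
  - by move=> r; exact/measurable_EFinP/measurableT_comp.
  - by move=> n x _; rewrite EFinM nnfun_muleindic_ge0.
transitivity (\sum_(r \in range h) Phi (fun y => (r * \1_(h @^-1` [set r]) y)%:E)).
  apply: eq_fsbigr => r _; under eq_integral do rewrite EFinM.
  rewrite integralZl_indic_nnsfun//= integral_indic//= setIT.
  have [r0|r0] := leP 0%R r; last first.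
    rewrite preimage_nnfun0// measure0 mule0 /Phi integral0_eq// => x _.
    by rewrite !indicE !in_set0 mulr0 !mule0 adde0.
  have mA : measurable (h @^-1` [set r]) by exact: measurable_sfunP.
  rewrite nuE// -ge0_integralZl//.
  - apply: eq_integral => x _; rewrite ge0_muleDr ?mule_ge0 ?lee_fin//.
    by rewrite !EFinM !(muleCA r%:E).
  - apply: (@mPhi (fun y => (\1_(h @^-1` [set r]) y)%:E)).
    exact/measurable_EFinP/measurable_indic.
  - by move=> x _; apply: (Phi_ge0 (f := fun y => (\1_ _ y)%:E)) => y; rewrite lee_fin.
rewrite -ge0_integral_fsum//; last 2 first.
  - move=> r; apply: (@mPhi (fun y => (r * \1_(h @^-1` [set r]) y)%:E)).
    exact/measurable_EFinP/measurableT_comp.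
  - move=> r x _; apply: (Phi_ge0 (f := fun y => (r * \1_ _ y)%:E)) => y.
    by rewrite EFinM nnfun_muleindic_ge0.
apply: eq_integral => x _.
rewrite fsbig_split//=; congr (_ + _).
  rewrite -ge0_mule_fsumr ?fimfunE ?fsumEFin//= => r.
  by rewrite EFinM nnfun_muleindic_ge0.
rewrite -ge0_mule_fsumr ?fimfunE ?fsumEFin//= => r.
by rewrite EFinM nnfun_muleindic_ge0.
Qed.

(** The standard machine: a measure that is a mixture on measurable sets
    integrates every nonnegative measurable function as a mixture. *)
Lemma ge0_integral_mixture (f : Y -> \bar R) :
  measurable_fun setT f -> (forall y, 0 <= f y) ->
  \int[nu]_y f y =
  \int[mu]_x ((rho1 x)%:E * f (phi1 x) + (rho2 x)%:E * f (phi2 x)).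
Proof.
move=> mf f0; pose f_ := nnsfun_approx measurableT mf.
have f_f y : (f_ n y)%:E @[n --> \oo] --> f y by exact: cvg_nnsfun_approx.
have ndf y : {homo (fun n => (f_ n y)%:E) : a b / (a <= b)%N >-> a <= b}.
  by move=> a b ab; rewrite lee_fin; exact/lefP/nd_nnsfun_approx.
transitivity (limn (fun n => \int[nu]_y (f_ n y)%:E)).
  rewrite -monotone_convergence//.
  - by apply: eq_integral => y _; apply/esym/cvg_lim.
  - by move=> n; exact/measurable_EFinP.
  - by move=> n y _; rewrite lee_fin.
under eq_fun do rewrite Phi_nnsfun.
rewrite /Phi -monotone_convergence//.
- apply: eq_integral => x _; apply/cvg_lim => //; apply: cvgeD.
  + by rewrite ge0_adde_def// inE mule_ge0// lee_fin.
  + by apply: cvgeZl => //; exact: f_f.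
  + by apply: cvgeZl => //; exact: f_f.
- by move=> n; apply: (@mPhi (EFin \o f_ n)); exact/measurable_EFinP.
- by move=> n x _; apply: (Phi_ge0 (f := EFin \o f_ n)) => y /=; rewrite lee_fin.
- move=> x _ a b ab; by apply: leeD; apply: lee_wpmul2l; rewrite ?lee_fin//; exact: ndf.
Qed.

End mixture.

End integration.

(** * Independent samples *)

Lemma integral_prob_cst d (T : measurableType d) (R : realType)
  (Q : probability T R) (c : \bar R) : (\int[Q]_x c = c)%E.
Proof.
rewrite integral_cst// [X in (_ * X)%E](_ : _ = 1%E) ?mule1//.
exact: (probability_setT Q).
Qed.

Section iid.
Context d (T : measurableType d) (R : realType).
Local Open Scope ereal_scope.
Implicit Types Q : probability T R.

Lemma ge0_integral_iidS Q n (f : n.+1.-tuple T -> \bar R) :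
  measurable_fun setT f -> (forall D, 0 <= f D) ->
  \int[iid_law Q n.+1]_D f D =
  \int[iid_law Q n]_t \int[Q]_x f (tuple_cons (x, t)).
Proof.
move=> mf f0.
rewrite [LHS](_ : _ = \int[(Q \x iid_law Q n)]_y f (tuple_cons y)); last first.
  by rewrite /= ge0_integral_distribution.
rewrite fubini_tonelli2//.
by apply: measurableT_comp => //; exact: measurable_tuple_cons.
Qed.

Lemma integral_iid0 Q (f : 0.-tuple T -> \bar R) :
  measurable_fun setT f -> \int[iid_law Q 0]_D f D = f [tuple].
Proof. by move=> mf; rewrite /= integral_dirac// diracT mul1e. Qed.

Lemma measurable_cons_r n (t : n.-tuple T) :
  measurable_fun setT (fun x : T => tuple_cons (x, t)).
Proof.
apply: (measurableT_comp (@measurable_tuple_cons _ T n)).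
exact: pair2_measurable.
Qed.

Lemma measurable_integral_cons Q n (f : n.+1.-tuple T -> \bar R) :
  measurable_fun setT f -> (forall D, 0 <= f D) ->
  measurable_fun setT (fun t => \int[Q]_x f (tuple_cons (x, t))).
Proof.
move=> mf f0.
apply: (measurable_fun_fubini_tonelli_G (f \o @tuple_cons _ T n)) => //=.
by apply: measurableT_comp => //; exact: measurable_tuple_cons.
Qed.

Lemma tnth_cons0 n (x : T) (t : n.-tuple T) : tnth (tuple_cons (x, t)) ord0 = x.
Proof. exact: tnth0. Qed.

Lemma tnth_consS n (x : T) (t : n.-tuple T) i :
  tnth (tuple_cons (x, t)) (lift ord0 i) = tnth t i.
Proof. exact: tnthS. Qed.

Lemma measurable_prod_tnth n (rho : T -> R) : measurable_fun setT rho ->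
  measurable_fun setT (fun D : n.-tuple T => \prod_(s < n) rho (tnth D s))%R.
Proof.
move=> mrho; apply: measurable_prod => s _.
by apply: measurableT_comp => //; exact: measurable_tnth.
Qed.

Lemma ge0_integral_iid_density Q Q' (rho : T -> R) n
    (f : n.-tuple T -> \bar R) :
  measurable_fun setT rho -> (forall x, (0 <= rho x)%R) ->
  (forall g, measurable_fun setT g -> (forall x, 0 <= g x) ->
     \int[Q']_x g x = \int[Q]_x ((rho x)%:E * g x)) ->
  measurable_fun setT f -> (forall D, 0 <= f D) ->
  \int[iid_law Q' n]_D f D =
  \int[iid_law Q n]_D ((\prod_(s < n) rho (tnth D s))%:E * f D).
Proof.
move=> mrho rho0 QQ'; elim: n f => [|n IHn] f mf f0.
  rewrite !integral_iid0//; first by rewrite big_ord0 mul1e.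
  apply: emeasurable_funM => //; apply/measurable_EFinP.
  exact: measurable_prod_tnth.
have mg : measurable_fun setT (fun D : n.+1.-tuple T =>
    (\prod_(s < n.+1) rho (tnth D s))%:E * f D).
  apply: emeasurable_funM => //; apply/measurable_EFinP.
  exact: measurable_prod_tnth.
have prod0 j (D : j.-tuple T) : (0 <= \prod_(s < j) rho (tnth D s))%R.
  by apply: prodr_ge0 => s _.
rewrite ge0_integral_iidS// [RHS]ge0_integral_iidS//; last first.
  by move=> D; rewrite mule_ge0// lee_fin.
rewrite IHn; last 2 first.
  - exact: measurable_integral_cons.
  - by move=> t; apply: integral_ge0.
apply: eq_integral => t _.
have mft : measurable_fun setT (fun x => f (tuple_cons (x, t))).
  by apply: measurableT_comp => //; exact: measurable_cons_r.
rewrite QQ'// -ge0_integralZl//; last 3 first.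
  - by apply: emeasurable_funM => //; exact/measurable_EFinP.
  - by move=> x _; rewrite mule_ge0// lee_fin.
  - by rewrite lee_fin.
apply: eq_integral => x _; rewrite big_ord_recl tnth_cons0.
under [in RHS]eq_bigr do rewrite tnth_consS.
by rewrite EFinM muleCA muleA.
Qed.

Lemma ge0_integral_iid_prod Q n (g : T -> R) (a : R) :
  measurable_fun setT g -> (forall x, (0 <= g x)%R) ->
  \int[Q]_x (g x)%:E = a%:E ->
  \int[iid_law Q n]_D (\prod_(s < n) g (tnth D s))%:E = (a ^+ n)%:E.
Proof.
move=> mg g0 ga; elim: n => [|n IHn].
  rewrite integral_iid0 ?big_ord0//.
  by apply/measurable_EFinP; exact: measurable_prod_tnth.
have prod0 j (D : j.-tuple T) : (0 <= \prod_(s < j) g (tnth D s))%R.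
  by apply: prodr_ge0 => s _.
have mprod j : measurable_fun setT
    (fun D : j.-tuple T => (\prod_(s < j) g (tnth D s))%:E).
  by apply/measurable_EFinP; exact: measurable_prod_tnth.
have a0 : (0 <= a)%R.
  by rewrite -lee_fin -ga; apply: integral_ge0 => x _; rewrite lee_fin.
rewrite ge0_integral_iidS//; last by move=> D; rewrite lee_fin.
under eq_integral => t _.
  under eq_integral => x _.
    rewrite big_ord_recl tnth_cons0 EFinM.
    under eq_bigr do rewrite tnth_consS.
    over.
  rewrite ge0_integralZr//; last 3 first.
  - exact/measurable_EFinP.
  - by move=> x _; rewrite lee_fin.
  - by rewrite lee_fin.
  rewrite ga.
  over.
rewrite ge0_integralZl//.
- by rewrite IHn -EFinM -exprS.
- exact: mprod.
- by move=> t _; rewrite lee_fin.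
Qed.

(** Centred summands are orthogonal. Integrating one coordinate at a time, the
    others are a constant, and the cross term vanishes. *)
Lemma iid_second_moment Q n (g : 'I_n -> T -> R) (v : 'I_n -> R) (b : R) :
  (forall s, Q.-integrable setT (EFin \o g s)) ->
  (forall s, \int[Q]_x (g s x)%:E = 0) ->
  (forall s, \int[Q]_x ((g s x) ^+ 2)%:E <= (v s)%:E) ->
  \int[iid_law Q n]_D ((b + \sum_(s < n) g s (tnth D s)) ^+ 2)%:E <=
  (b ^+ 2 + \sum_(s < n) v s)%:E.
Proof.
elim: n g v b => [|n IHn] g v b ig g0 gv.
  rewrite integral_iid0 ?big_ord0 ?addr0//.
  apply/measurable_EFinP; apply: measurable_funX; apply: measurable_funD => //.
  by apply: measurable_sum => -[].
have mg s : measurable_fun setT (g s).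
  by apply/measurable_EFinP; exact: measurable_int (ig s).
have msum j (h : 'I_j -> T -> R) c : (forall s, measurable_fun setT (h s)) ->
    measurable_fun setT (fun D : j.-tuple T =>
      ((c + \sum_(s < j) h s (tnth D s)) ^+ 2)%:E).
  move=> mh; apply/measurable_EFinP; apply: measurable_funX.
  apply: measurable_funD => //; apply: measurable_sum => s.
  by apply: measurableT_comp => //; exact: measurable_tnth.
rewrite ge0_integral_iidS//; last 2 first.
  - exact: msum.
  - by move=> D; rewrite lee_fin sqr_ge0.
have inner c : \int[Q]_x ((c + g ord0 x) ^+ 2)%:E <= (c ^+ 2 + v ord0)%:E.
  have i2 : Q.-integrable setT (fun x => ((g ord0 x) ^+ 2)%:E).
    apply/integrableP; split.
      by apply/measurable_EFinP; exact: measurable_funX.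
    under eq_integral do rewrite gee0_abs ?lee_fin ?sqr_ge0//.
    by rewrite (le_lt_trans (gv _))// ltry.
  have i1 : Q.-integrable setT (fun x => (c * 2)%:E * (g ord0 x)%:E).
    by apply: integrableZl => //; exact: ig.
  have i0 : Q.-integrable setT (fun x => (c ^+ 2)%:E).
    exact: finite_measure_integrable_cst.
  have sqE x : ((c + g ord0 x) ^+ 2)%:E =
      (c ^+ 2)%:E + (c * 2)%:E * (g ord0 x)%:E + ((g ord0 x) ^+ 2)%:E.
    rewrite -EFinM -!EFinD; congr EFin; ring.
  under eq_integral do rewrite sqE.
  rewrite integralD//=; last exact: integrableD.
  rewrite integralD//= integral_prob_cst.
  rewrite integralZl//; last exact: ig.
  by rewrite g0 mule0 adde0 EFinD leeD2l.
have v0 : (0 <= v ord0)%R.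
  rewrite -lee_fin; apply: le_trans (gv ord0).
  by apply: integral_ge0 => x _; rewrite lee_fin sqr_ge0.
pose c (t : n.-tuple T) := (b + \sum_(s < n) g (lift ord0 s) (tnth t s))%R.
apply: (@le_trans _ _ (\int[iid_law Q n]_t ((c t ^+ 2)%:E + (v ord0)%:E))).
  apply: ge0_le_integralT => [t|t].
    by apply: integral_ge0 => x _; rewrite lee_fin sqr_ge0.
  rewrite -EFinD; apply: le_trans (inner _); rewrite le_eqVlt; apply/orP; left.
  apply/eqP; apply: eq_integral => x _; congr (_ ^+ 2)%:E.
  rewrite big_ord_recl tnth_cons0 /c -addrA; congr (_ + _)%R; rewrite addrC.
  by congr (_ + _)%R; apply: eq_bigr => s _; rewrite tnth_consS.
rewrite ge0_integralD//; last 2 first.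
  - by move=> t _; rewrite lee_fin sqr_ge0.
  - exact: (msum _ (fun s => g (lift ord0 s))).
rewrite integral_prob_cst.
apply: le_trans (leeD2r _ (IHn (fun s => g (lift ord0 s)) (fun s => v (lift ord0 s)) b _ _ _)) _ => //.
by rewrite big_ord_recl -EFinD lee_fin addrAC addrA.
Qed.

End iid.

(** * Measurable matrices and integrals of linear combinations *)

Section measurable_matrices.
Context d (T : measurableType d) (R : realType).

Definition measurable_mx m n (f : T -> 'M[R]_(m, n)) : Prop :=
  forall i j, measurable_fun setT (fun x => f x i j).

Lemma measurable_invr (f : T -> R) : measurable_fun setT f ->
  measurable_fun setT (fun x => (f x)^-1).
Proof.
move=> mf.
have -> : (fun x => (f x)^-1) = (fun x => f x * (f x ^+ 2) `^ (-1)).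
  (* the square provides the nonnegative base that real powers ask for *)
  apply/funext => x; rewrite powR_inv1 ?sqr_ge0//.
  have [->|fx0] := eqVneq (f x) 0; first by rewrite invr0 mul0r.
  by rewrite expr2 invfM mulrA mulfV// mul1r.
apply: measurable_funM => //.
by apply: (measurableT_comp (measurable_powR _)); exact: measurable_funX.
Qed.

Lemma measurable_mx_cst m n (A : 'M[R]_(m, n)) : measurable_mx (cst A).
Proof. by move=> i j; exact: measurable_cst. Qed.

Lemma measurable_mxD m n (f g : T -> 'M[R]_(m, n)) :
  measurable_mx f -> measurable_mx g -> measurable_mx (fun x => f x + g x).
Proof.
move=> mf mg i j; under eq_fun do rewrite mxE.
exact: measurable_funD.
Qed.

Lemma measurable_mxZ m n (c : T -> R) (f : T -> 'M[R]_(m, n)) :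
  measurable_fun setT c -> measurable_mx f -> measurable_mx (fun x => c x *: f x).
Proof.
move=> mc mf i j; under eq_fun do rewrite mxE.
exact: measurable_funM.
Qed.

Lemma measurable_mx_sum m n k (f : 'I_k -> T -> 'M[R]_(m, n)) :
  (forall s, measurable_mx (f s)) -> measurable_mx (fun x => \sum_s f s x).
Proof.
move=> mf i j; under eq_fun do rewrite summxE.
by apply: measurable_sum => s; exact: mf.
Qed.

Lemma measurable_mxM m n p (f : T -> 'M[R]_(m, n)) (g : T -> 'M[R]_(n, p)) :
  measurable_mx f -> measurable_mx g -> measurable_mx (fun x => f x *m g x).
Proof.
move=> mf mg i j; under eq_fun do rewrite mxE.
by apply: measurable_sum => k; exact: measurable_funM.
Qed.

Lemma measurable_mxT m n (f : T -> 'M[R]_(m, n)) :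
  measurable_mx f -> measurable_mx (fun x => (f x)^T).
Proof. by move=> mf i j; under eq_fun do rewrite mxE; exact: mf. Qed.

Lemma measurable_mxX n (f : T -> 'M[R]_n) k :
  measurable_mx f -> measurable_mx (fun x => f x ^+ k).
Proof.
move=> mf; elim: k => [|k IHk]; first exact: measurable_mx_cst.
by under eq_fun do rewrite expmxS; exact: measurable_mxM.
Qed.

Lemma measurable_trace n (f : T -> 'M[R]_n) :
  measurable_mx f -> measurable_fun setT (fun x => \tr (f x)).
Proof. by move=> mf; apply: measurable_sum => i; exact: mf. Qed.

Lemma measurable_det n (f : T -> 'M[R]_n) :
  measurable_mx f -> measurable_fun setT (fun x => \det (f x)).
Proof.
move=> mf; apply: measurable_sum => s; apply: measurable_funM => //.
by apply: measurable_prod => i _; exact: mf.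
Qed.

Lemma measurable_invmx n (f : T -> 'M[R]_n) :
  (forall x, f x \in unitmx) -> measurable_mx f ->
  measurable_mx (fun x => invmx (f x)).
Proof.
move=> uf mf i j.
have -> : (fun x => invmx (f x) i j) =
    (fun x => (\det (f x))^-1 * cofactor (f x) j i).
  by apply/funext => x; rewrite /invmx uf !mxE.
apply: measurable_funM; first exact/measurable_invr/measurable_det.
apply: measurable_funM => //; apply: measurable_det => k l.
by under eq_fun do rewrite !mxE; exact: mf.
Qed.

End measurable_matrices.

Lemma measurable_mx_comp d d' (T : measurableType d) (S : measurableType d')
    (R : realType) m n (f : T -> 'M[R]_(m, n)) (g : S -> T) :
  measurable_mx f -> measurable_fun setT g -> measurable_mx (fun y => f (g y)).
Proof. by move=> mf mg i j; exact: (measurableT_comp (mf i j) mg). Qed.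

Section linear_combinations.
Context d (T : measurableType d) (R : realType).
Variable mu : {measure set T -> \bar R}.

Lemma integral_lin (I : finType) (a : I -> R) (f : I -> T -> R) (v : I -> R) :
  (forall i, mu.-integrable setT (EFin \o f i)) ->
  (forall i, (\int[mu]_x (f i x)%:E = (v i)%:E)%E) ->
  mu.-integrable setT (EFin \o (fun x => \sum_i a i * f i x)) /\
  (\int[mu]_x (\sum_i a i * f i x)%:E = (\sum_i a i * v i)%:E)%E.
Proof.
move=> fi fv.
have ai i : mu.-integrable setT (fun x => (a i)%:E * (f i x)%:E)%E.
  by apply: integrableZl => //; exact: fi.
have sE x : (\sum_i a i * f i x)%:E = (\sum_i (a i)%:E * (f i x)%:E)%E.
  by rewrite -sumEFin; apply: eq_bigr => i _; rewrite EFinM.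
split.
  have -> : EFin \o (fun x => \sum_i a i * f i x) =
      (fun x => \sum_i (a i)%:E * (f i x)%:E)%E by apply/funext => x; exact: sE.
  exact: integrable_sum.
under eq_integral do rewrite sE.
rewrite integral_sum//= -sumEFin; apply: eq_bigr => i _.
by rewrite integralZl ?fv ?EFinM//; exact: fi.
Qed.

End linear_combinations.


(** * Lower tail of an empirical Gram matrix *)

Section chernoff.
Variable R : realType.

Lemma bernoulli_ineq (x : R) n : 0 <= x -> 1 + n%:R * x <= (1 + x) ^+ n.
Proof.
move=> x0; elim: n => [|n IHn]; first by rewrite mul0r addr0 expr0.
rewrite exprS; apply: le_trans (_ : (1 + x) * (1 + n%:R * x) <= _).
  have h : 0 <= n%:R * x * x by rewrite !mulr_ge0.
  rewrite -natr1 (_ : (1 + x) * (1 + n%:R * x) =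
    1 + (n%:R + 1) * x + n%:R * x * x); first by rewrite lerDl.
  ring.
by rewrite ler_wpM2l// addr_ge0.
Qed.

(** Along the multiples of 64 the value can only increase, by Bernoulli, so one
    check at 64 is enough. The fractions in the proof bound the successive
    squares of 1 + 7/640 from below. *)
Lemma compound_ge2 j : (0 < j)%N ->
  (2 : R) <= (1 + 7 / 10 / (64 * j)%:R) ^+ (64 * j).
Proof.
move=> j0; have jR : (0 : R) < j%:R by rewrite ltr0n.
rewrite mulnC exprM.
set y := (X in X ^+ 64); have y1 : 1 + 7 / 640 <= y.
  rewrite (_ : 7 / 640 = j%:R * (7 / 10 / (j * 64)%:R)); last first.
    by rewrite natrM; field; rewrite gt_eqF.
  by apply: bernoulli_ineq; rewrite !divr_ge0.
have sq (a b c : R) : 0 <= a -> c <= a * a -> a <= b -> c <= b ^+ 2.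
  by move=> a0 ca ab; apply: le_trans ca _; rewrite expr2; apply: ler_pM.
have -> : y ^+ 64 = (((((y ^+ 2) ^+ 2) ^+ 2) ^+ 2) ^+ 2) ^+ 2 by rewrite -!exprM.
apply: (sq (508 / 359)); [lra|lra|].
apply: (sq (251 / 211)); [lra|lra|].
apply: (sq (433 / 397)); [lra|lra|].
apply: (sq (400 / 383)); [lra|lra|].
apply: (sq (93 / 91)); [lra|lra|].
by apply: (sq (1 + 7 / 640)); [lra|lra|exact: y1].
Qed.

(** The constants of the tail bound. With c L N = 7/10 the exponent per draw is
    7/20 for the deviation, against the gain 1 - 1/2 of the potential; the
    exponent N is so large that the other factor (1 + c m L) hardly counts. *)
Lemma chernoff_constants (L : R) m : 1 <= L -> (0 < m)%N ->
  exists k, let N := (2 ^ k.+1)%N in let c := 7 / 10 / (N%:R * L) in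
  let q := 1 - rank_one_gain c L N / (1 + c * m%:R * L) in
  [/\ 0 < c, 0 <= q &
      (1 + c * m%:R / 2) ^+ N * q ^+ m <= expR (- (m%:R / (7 * L)))].
Proof.
move=> L1 m0; exists (m + 6)%N => N c q.
have L0 : 0 < L by exact: lt_le_trans L1.
have NE : N = (64 * 2 ^ m.+1)%N by rewrite /N -addSn expnD mulnC.
have NR0 : (0 : R) < N%:R by rewrite ltr0n NE muln_gt0 expn_gt0.
have c0 : 0 < c by rewrite !divr_gt0// mulr_gt0.
have mR0 : (0 : R) < m%:R by rewrite ltr0n.
have cm0 : 0 <= c * m%:R by exact: mulr_ge0 (ltW c0) (ltW mR0).
have cm20 : 0 <= c * m%:R / 2 by rewrite divr_ge0.
have cL : c * L = 7 / 10 / N%:R by rewrite /c; field; rewrite !gt_eqF.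
have Nm : 128 * m%:R <= N%:R :> R.
  rewrite -natrM ler_nat NE expnS mulnA leq_mul2l/=.
  by rewrite ltnW// ltn_expl.
have den_gt0 : 0 < 1 + c * m%:R * L by rewrite addr_gt0// mulr_gt0// mulr_gt0.
have den_le : 1 + c * m%:R * L <= 101 / 100.
  rewrite mulrAC cL (_ : _ * m%:R = 7 / 10 * m%:R / N%:R); last by field; rewrite gt_eqF.
  rewrite -lerBrDl ler_pdivrMr//; lra.
set g := rank_one_gain c L N.
have gE : L * g = 1 - (1 + c * L) ^- N by exact: rank_one_gainE (ltW L0).
have pow2 : 2 <= (1 + c * L) ^+ N.
  by rewrite cL NE; apply: compound_ge2; rewrite expn_gt0.
have pinv : 0 < (1 + c * L) ^- N <= 1 / 2.
  rewrite invr_gt0 (lt_le_trans _ pow2)//= div1r lef_pV2 ?posrE//.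
  exact: lt_le_trans pow2.
have g1 : g <= L^-1.
  by rewrite -(ler_pM2l L0) gE mulfV ?gt_eqF//; move/andP: pinv => [+ _]; lra.
have g2 : (2 * L)^-1 <= g.
  rewrite -(ler_pM2l L0) gE invfM mulrCA mulfV ?gt_eqF//.
  by move/andP: pinv => [_ +]; lra.
have g'1 : (101 / 50 * L)^-1 <= g / (1 + c * m%:R * L).
  rewrite ler_pdivlMr//; apply: le_trans g2.
  apply: le_trans (_ : (101 / 50 * L)^-1 * (101 / 100) <= _).
    by rewrite ler_pM2l// invr_gt0 mulr_gt0.
  by rewrite le_eqVlt; apply/orP; left; apply/eqP; field; rewrite gt_eqF.
have q0 : 0 <= q.
  rewrite subr_ge0 ler_pdivrMr// mul1r.
  apply: le_trans g1 _; apply: le_trans (_ : 1 <= _); first by rewrite invf_le1.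
  by rewrite lerDl mulr_ge0// ltW.
split=> //.
apply: le_trans (_ : expR (N%:R * (c * m%:R / 2)) *
                     expR (m%:R * - (101 / 50 * L)^-1) <= _).
  apply: ler_pM.
  - by rewrite exprn_ge0// addr_ge0.
  - exact: exprn_ge0.
  - rewrite expRM_natl; apply: lerXn2r; rewrite ?nnegrE ?expR_ge0 ?expR_ge1Dx//.
    by rewrite addr_ge0.
  - rewrite expRM_natl; apply: lerXn2r; rewrite ?nnegrE ?expR_ge0//.
    by apply: le_trans (expR_ge1Dx _); rewrite lerD2l lerN2.
rewrite -expRD ler_expR.
have -> : N%:R * (c * m%:R / 2) = 7 / 20 * (m%:R / L).
  by rewrite /c; field; rewrite !gt_eqF.
have -> : m%:R * - (101 / 50 * L)^-1 = - (50 / 101 * (m%:R / L)).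
  by field; rewrite gt_eqF.
have -> : m%:R / (7 * L) = 1 / 7 * (m%:R / L) by field; rewrite gt_eqF.
have : 0 < m%:R / L by rewrite divr_gt0.
lra.
Qed.

End chernoff.

Section chernoff_bound.
Context d (T : measurableType d) (R : realType) (Q : probability T R).
Variables (n : nat) (x : T -> 'cV[R]_n) (L : R).
Hypotheses (mx : measurable_mx x) (L1 : 1 <= L).
Hypothesis xL : forall p, dotv (x p) (x p) <= L.
Hypothesis xx : forall i j,
  (\int[Q]_p (x p i 0 * x p j 0)%:E = (i == j)%:R%:E)%E.

Let L0 : 0 < L. Proof. exact: lt_le_trans L1. Qed.

Let integrable_xx i j : Q.-integrable setT (EFin \o (fun p => x p i 0 * x p j 0)).
Proof.
have xi p k : `|x p k 0| <= L.
  rewrite -[leRHS]ger0_norm ?(ltW L0)// -ler_sqr ?nnegrE// !real_normK ?num_real//.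
  apply: le_trans (_ : L <= _); last by rewrite expr2 ler_peMl// ltW.
  apply: le_trans (xL p); rewrite dotvv (bigD1 k)//= lerDl.
  by apply: sumr_ge0 => l _; exact: sqr_ge0.
apply: measurable_bounded_integrable => //.
- by rewrite -ge0_fin_numE// fin_num_measure.
- by apply: measurable_funM; exact: mx.
exists (L * L); split; first by rewrite num_real.
move=> M LM p _; apply: le_trans (ltW LM); rewrite /= normrM.
by apply: ler_pM.
Qed.

Let integral_qform (P : 'M[R]_n) :
  Q.-integrable setT (EFin \o (fun p => qform P (x p))) /\
  (\int[Q]_p (qform P (x p))%:E = (\tr P)%:E)%E.
Proof.
have [+ +] := @integral_lin _ _ _ Q _ (fun ij : 'I_n * 'I_n => P ij.1 ij.2)
  (fun ij p => x p ij.1 0 * x p ij.2 0) (fun ij => (ij.1 == ij.2)%:R)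
  (fun ij => integrable_xx ij.1 ij.2) (fun ij => xx ij.1 ij.2).
have qE p : qform P (x p) =
    \sum_(ij : 'I_n * 'I_n) P ij.1 ij.2 * (x p ij.1 0 * x p ij.2 0).
  rewrite qformE dotvE.
  rewrite -(pair_big xpredT xpredT
    (fun i j => P i j * (x p i 0 * x p j 0)))/=.
  apply: eq_bigr => i _; rewrite mxE mulr_sumr; apply: eq_bigr => j _.
  by rewrite mulrCA.
have -> : \sum_(ij : 'I_n * 'I_n) P ij.1 ij.2 * (ij.1 == ij.2)%:R = \tr P.
  rewrite -(pair_big xpredT xpredT (fun i j => P i j * (i == j)%:R))/=.
  apply: eq_bigr => i _; rewrite (bigD1 i)//= eqxx mulr1 big1 ?addr0// => j.
  by rewrite eq_sym => /negbTE ->; rewrite mulr0.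
move=> iq eq; split; last by under eq_integral do rewrite qE.
by have -> : (fun p => qform P (x p)) =
    (fun p => \sum_(ij : 'I_n * 'I_n) P ij.1 ij.2 * (x p ij.1 0 * x p ij.2 0))
  by apply/funext => p; exact: qE.
Qed.

Let Tm (c : R) j (D : j.-tuple T) : 'M[R]_n :=
  1%:M + c *: \sum_(s < j) (x (tnth D s) *m (x (tnth D s))^T).

Let qform_Tm c j (D : j.-tuple T) v : qform (Tm c D) v =
  dotv v v + c * \sum_(s < j) dotv (x (tnth D s)) v ^+ 2.
Proof.
rewrite /Tm qformD qformZ qform_sum qform_dotv; congr (_ + _ * _).
by apply: eq_bigr => s _; rewrite qform_outer.
Qed.

Let posdef_Tm c j (D : j.-tuple T) : 0 < c -> posdef (Tm c D).
Proof.
move=> c0; apply: posdef_ge (posdef1 _ _) _ => [|v].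
  rewrite linearD linearZ /= trmx1 linear_sum /=; congr (_ + _ *: _).
  by apply: eq_bigr => s _; rewrite trmx_mul trmxK.
rewrite qform_Tm qform_dotv lerDl mulr_ge0 ?(ltW c0)//.
by apply: sumr_ge0 => s _; exact: sqr_ge0.
Qed.

Let Tm_le c m j (D : j.-tuple T) v : 0 < c -> (j <= m)%N ->
  qform (Tm c D) v <= (1 + c * m%:R * L) * dotv v v.
Proof.
move=> c0 jm; rewrite qform_Tm mulrDl mul1r lerD2l -!mulrA ler_pM2l//.
apply: le_trans (_ : \sum_(s < j) L * dotv v v <= _).
  apply: ler_sum => s _; apply: le_trans (cauchy_schwarz _ _) _.
  by rewrite ler_wpM2r ?dotvv_ge0.
rewrite sumr_const card_ord -[X in X <= _]mulr_natl ler_wpM2r ?ler_nat//.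
by rewrite mulr_ge0 ?dotvv_ge0// ltW.
Qed.

Let Tm_cons c j p (t : j.-tuple T) :
  Tm c (tuple_cons (p, t)) = Tm c t + c *: (x p *m (x p)^T).
Proof.
rewrite /Tm big_ord_recl tnth_cons0 scalerDr [X in _ + X]addrC addrA.
congr (_ + _ *: _ + _).
by apply: eq_bigr => s _; rewrite tnth_consS.
Qed.

Let measurable_Tm c j : measurable_mx (@Tm c j).
Proof.
apply: measurable_mxD; first exact: measurable_mx_cst.
apply: measurable_mxZ => //; apply: measurable_mx_sum => s.
have mxs : measurable_mx (fun D : j.-tuple T => x (tnth D s)).
  by apply: measurable_mx_comp => //; exact: measurable_tnth.
by apply: measurable_mxM => //; exact: measurable_mxT.
Qed.

Let measurable_potential c N j : 0 < c ->
  measurable_fun setT (fun D : j.-tuple T => \tr (invmx (Tm c D) ^+ N)).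
Proof.
move=> c0; apply: measurable_trace; apply: measurable_mxX.
apply: measurable_invmx; last exact: measurable_Tm.
by move=> D; exact/posdef_unit/posdef_Tm.
Qed.

(** Along each draw the potential decreases on average by the factor q: the
    gain is linear in the power of the inverse, whose expectation along the
    draw is a trace because the draws are isotropic. *)
Let potential_le k c m j : 0 < c -> (j <= m)%N ->
  let N := (2 ^ k.+1)%N in
  let q := 1 - rank_one_gain c L N / (1 + c * m%:R * L) in 0 <= q ->
  (\int[iid_law Q j]_D (\tr (invmx (Tm c D) ^+ N))%:E <= (n%:R * q ^+ j)%:E)%E.
Proof.
move=> c0 + N q q0; elim: j => [_|j IHj jm].
  have mf0 : measurable_fun setT
      (fun D : 0.-tuple T => (\tr (invmx (Tm c D) ^+ N))%:E).
    by apply/measurable_EFinP; exact: measurable_potential.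
  rewrite integral_iid0// /Tm big_ord0 scaler0 addr0 invmx1 expr1n mxtrace1.
  by rewrite expr0 mulr1.
have mf i : measurable_fun setT
    (fun D : i.-tuple T => (\tr (invmx (Tm c D) ^+ N))%:E).
  by apply/measurable_EFinP; exact: measurable_potential.
have f0 i (D : i.-tuple T) : 0 <= \tr (invmx (Tm c D) ^+ N).
  exact/trace_pow2_ge0/posdef_Tm.
have a0 : 0 < 1 + c * m%:R * L.
  by rewrite addr_gt0// mulr_gt0// mulr_gt0// ltr0n (leq_trans _ jm).
rewrite ge0_integral_iidS//; last by move=> D; rewrite lee_fin.
apply: (@le_trans _ _ (\int[iid_law Q j]_t (q%:E * (\tr (invmx (Tm c t) ^+ N))%:E))%E).
  apply: ge0_le_integralT => t.
    by apply: integral_ge0 => p _; rewrite lee_fin.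
  have [iq eq] := integral_qform (invmx (Tm c t) ^+ N.+1).
  set f := \tr (invmx (Tm c t) ^+ N); set g := rank_one_gain c L N.
  apply: (@le_trans _ _
    (\int[Q]_p (f%:E - g%:E * (qform (invmx (Tm c t) ^+ N.+1) (x p))%:E))%E).
    apply: ge0_le_integralT => p; rewrite ?lee_fin// Tm_cons.
    apply: rank_one_step => //; first exact: posdef_Tm.
    apply: le_trans (xL p); rewrite -qform_dotv.
    rewrite -[leLHS]mul1r -(invmx1 _ n); apply: dominated_inv => //.
    - exact: posdef1.
    - exact: posdef_Tm.
    move=> u; rewrite mul1r qform_Tm qform_dotv lerDl mulr_ge0 ?(ltW c0)//.
    by apply: sumr_ge0 => s _; exact: sqr_ge0.
  rewrite integralB//=; last 2 first.
  - exact: finite_measure_integrable_cst.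
  - by apply: integrableZl => //; exact: iq.
  rewrite integral_prob_cst integralZl//= eq -EFinM -EFinB lee_fin.
  rewrite /q -/g mulrBl mul1r lerD2l lerN2 -[leLHS]mulrA ler_wpM2l//.
    exact: rank_one_gain_ge0 (ltW L0).
  rewrite mulrC ler_pdivrMr// mulrC.
  apply: trace_exp_succ_ge => //; first exact: posdef_Tm.
  by move=> v; apply: Tm_le => //; exact: ltnW.
rewrite ge0_integralZl//; last by move=> t _; rewrite lee_fin.
  rewrite exprS mulrCA EFinM lee_pmul//; last exact: IHj (ltnW jm).
  by apply: integral_ge0 => t _; rewrite lee_fin.
exact: mf.
Qed.

(** If some direction violates the conclusion then the potential is at least
    (1 + c m / 2)^-N, which by Markov is a rare event. *)
Lemma matrix_chernoff m : (0 < m)%N -> exists Bad : set (m.-tuple T),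
  [/\ measurable Bad,
      (iid_law Q m Bad <= (n%:R * expR (- (m%:R / (7 * L))))%:E)%E &
      forall D, ~ Bad D -> forall v,
        m%:R / 2 * dotv v v <= \sum_(s < m) dotv (x (tnth D s)) v ^+ 2].
Proof.
move=> m0; have [k /=] := chernoff_constants L1 m0.
set N := (2 ^ k.+1)%N; set c := _ / (_ * L).
set q := 1 - rank_one_gain c L N / _; case=> c0 q0 numeric.
have a0 : 0 < 1 + c * m%:R / 2 by rewrite addr_gt0// divr_gt0// mulr_gt0 ?ltr0n.
set a := 1 + c * m%:R / 2 in numeric a0 *.
pose f (D : m.-tuple T) := a ^+ N * \tr (invmx (Tm c D) ^+ N).
have mf : measurable_fun setT f.
  by apply: measurable_funM => //; exact: measurable_potential.
have f0 D : 0 <= f D.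
  by rewrite mulr_ge0 ?exprn_ge0 ?(ltW a0)//; exact/trace_pow2_ge0/posdef_Tm.
have mBad : measurable (f @^-1` `[1, +oo[).
  by rewrite -[X in measurable X]setTI; apply: mf.
exists (f @^-1` `[1, +oo[); split=> //.
- have -> : iid_law Q m (f @^-1` `[1, +oo[) =
      (\int[iid_law Q m]_D (\1_(f @^-1` `[1%R, +oo[) D)%:E)%E.
    by rewrite integral_indic// setIT.
  apply: (@le_trans _ _ (\int[iid_law Q m]_D (f D)%:E)%E).
    apply: ge0_le_integralT => D; rewrite lee_fin// indicE.
    have [/set_mem|_] := boolP (D \in f @^-1` `[1, +oo[); last exact: f0.
    by rewrite /= in_itv/= andbT.
  rewrite /f; under eq_integral do rewrite EFinM.
  rewrite ge0_integralZl//.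
  + apply: (@le_trans _ _ ((a ^+ N)%:E * (n%:R * q ^+ m)%:E)%E).
      apply: lee_wpmul2l; first by rewrite lee_fin exprn_ge0// ltW.
      exact: potential_le (leqnn m) q0.
    by rewrite -EFinM lee_fin mulrCA ler_wpM2l.
  + by apply/measurable_EFinP; exact: measurable_potential.
  + by move=> D _; rewrite lee_fin; exact/trace_pow2_ge0/posdef_Tm.
  + by rewrite lee_fin exprn_ge0// ltW.
- move=> D nBad v; have [->|v0] := eqVneq v 0.
    rewrite {1}/dotv mulmx0 mxE mulr0; apply: sumr_ge0 => s _; exact: sqr_ge0.
  rewrite leNgt; apply/negP => lt; apply: nBad.
  rewrite /= in_itv/= andbT /f; apply: (@trace_pow2_ge R n k (Tm c D) a v) => //.
    exact: posdef_Tm.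
  rewrite qform_Tm mulrDl mul1r lerD2l.
  rewrite (_ : _ * dotv v v = c * (m%:R / 2 * dotv v v)); last by rewrite !mulrA.
  by rewrite ler_pM2l// ltW.
Qed.

End chernoff_bound.

(** * Essentially bounded functions *)

Lemma ae_imply d (T : measurableType d) (R : realType)
    (mu : {measure set T -> \bar R}) (P Q : T -> Prop) :
  (forall x, P x -> Q x) ->
  {ae mu, forall x, P x} -> {ae mu, forall x, Q x}.
Proof. by move=> PQ; apply: filterS. Qed.

Lemma ae_imply2 d (T : measurableType d) (R : realType)
    (mu : {measure set T -> \bar R}) (P Q S : T -> Prop) :
  (forall x, P x -> Q x -> S x) ->
  {ae mu, forall x, P x} -> {ae mu, forall x, Q x} -> {ae mu, forall x, S x}.
Proof. by move=> PQS; apply: filterS2. Qed.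

Section ess_bounded.
Context d (T : measurableType d) (R : realType).
Variable mu : probability T R.
Implicit Types f g : T -> R.

Definition ess_bounded f : Prop :=
  measurable_fun setT f /\ exists M : R, {ae mu, forall x, `|f x| <= M}.

Lemma ess_bounded_cst (c : R) : ess_bounded (cst c).
Proof. by split=> //; exists `|c|; apply/nearW => x /=. Qed.

Lemma ess_boundedD f g : ess_bounded f -> ess_bounded g ->
  ess_bounded (fun x => f x + g x).
Proof.
move=> [mf [M fM]] [mg [N gN]]; split; first exact: measurable_funD.
exists (M + N); near=> x.
by rewrite (le_trans (ler_normD _ _))// lerD//; near: x.
Unshelve. all: by end_near. Qed.

Lemma ess_boundedM f g : ess_bounded f -> ess_bounded g ->
  ess_bounded (fun x => f x * g x).
Proof.
move=> [mf [M fM]] [mg [N gN]]; split; first exact: measurable_funM.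
exists (M * N); near=> x.
by rewrite normrM ler_pM//; near: x.
Unshelve. all: by end_near. Qed.

Lemma ess_boundedN f : ess_bounded f -> ess_bounded (fun x => - f x).
Proof.
move=> hf; have := ess_boundedM (ess_bounded_cst (-1)) hf.
by congr ess_bounded; apply/funext => x; rewrite /= mulN1r.
Qed.

Lemma ess_boundedB f g : ess_bounded f -> ess_bounded g ->
  ess_bounded (fun x => f x - g x).
Proof. by move=> hf hg; apply: ess_boundedD => //; exact: ess_boundedN. Qed.

Lemma ess_boundedX f n : ess_bounded f -> ess_bounded (fun x => f x ^+ n).
Proof.
move=> hf; elim: n => [|n IHn]; first exact: ess_bounded_cst.
by under eq_fun do rewrite exprS; exact: ess_boundedM.
Qed.

Lemma ess_bounded_sum n (f : 'I_n -> T -> R) :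
  (forall i, ess_bounded (f i)) -> ess_bounded (fun x => \sum_i f i x).
Proof.
elim: n f => [|n IHn] f hf.
  by under eq_fun do rewrite big_ord0; exact: ess_bounded_cst.
under eq_fun do rewrite big_ord_recl.
by apply: ess_boundedD => //; apply: IHn.
Qed.

Lemma ess_bounded_max0 f : ess_bounded f -> ess_bounded (fun x => Num.max (f x) 0).
Proof.
move=> [mf [M fM]]; split; first exact: measurable_maxr.
exists M; apply: filterS fM => x; apply: le_trans.
by have [f0|f0] := leP (f x) 0; rewrite ?normr0.
Qed.

Lemma ess_bounded_integrable f : ess_bounded f -> mu.-integrable setT (EFin \o f).
Proof.
move=> [mf [M fM]]; apply/integrableP; split; first exact/measurable_EFinP.
apply: (@le_lt_trans _ _ (\int[mu]_x `|M|%:E)%E); last first.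
  by rewrite integral_prob_cst ltry.
apply: ae_ge0_le_integral => //.
- by apply: measurableT_comp => //; exact/measurable_EFinP.
- apply: filterS fM => x + _; rewrite /= lee_fin => /le_trans; apply.
  exact: ler_norm.
Qed.

Lemma ess_bounded_fin_num f : ess_bounded f ->
  (\int[mu]_x (f x)%:E = (\int[mu]_x f x)%:E)%E.
Proof.
move=> hf; rewrite /Rintegral fineK//; apply: integrable_fin_num => //.
exact: ess_bounded_integrable.
Qed.

Lemma integrable_ess_boundedM f g : mu.-integrable setT (EFin \o f) ->
  ess_bounded g -> mu.-integrable setT (EFin \o (fun x => f x * g x)).
Proof.
move=> /[dup] fi /integrableP[/measurable_EFinP mf fy] [mg [M gM]].
apply/integrableP; split; first exact/measurable_EFinP/measurable_funM.
apply: (@le_lt_trans _ _ (\int[mu]_x (`|M|%:E * `|(EFin \o f) x|))%E); last first.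
  rewrite ge0_integralZl//; last by apply: measurableT_comp => //; exact/measurable_EFinP.
  by rewrite lte_mul_pinfty.
apply: ae_ge0_le_integral => //.
- by apply: measurableT_comp => //; exact/measurable_EFinP/measurable_funM.
- apply: emeasurable_funM => //; apply: measurableT_comp => //.
  exact/measurable_EFinP.
- apply: filterS gM => x gM _; rewrite /= normrM lee_fin mulrC ler_wpM2r//.
  exact: le_trans gM (ler_norm _).
Qed.

Lemma ess_bounded_normLoo f : ess_bounded f ->
  let N := fine ('N[mu]_+oo[EFin \o f])%E in
  0 <= N /\ {ae mu, forall x, `|f x| <= N}.
Proof.
move=> [mf [M fM]].
have mu1 : (0 < mu [set: T])%E.
  by rewrite [X in (_ < X)%E](_ : _ = 1%E) ?lte01//; exact: (probability_setT mu).
have NE : ('N[mu]_+oo[EFin \o f] = ess_sup mu (abse \o (EFin \o f)))%E.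
  by rewrite unlock mu1.
have N0 : (0 <= 'N[mu]_+oo[EFin \o f])%E by exact: Lnorm_ge0.
have Nfin : ('N[mu]_+oo[EFin \o f] \is a fin_num)%E.
  rewrite ge0_fin_numE// NE; apply: le_lt_trans (_ : _ <= M%:E)%E (ltry _).
  by apply/ess_supP; apply: filterS fM => x; rewrite /= lee_fin.
split; first by rewrite fine_ge0.
have := ess_sup_ge mu (abse \o (EFin \o f)).
by apply: filterS => x; rewrite /= -NE -[X in (_ <= X)%E]fineK// lee_fin.
Qed.

End ess_bounded.

(** * The uniform law on the square and the law of a dyad *)

Section square.
Variable R : realType.
Local Notation mu := (usquare R).

Lemma usquare_ae :
  {ae mu, forall p, (0 <= (p.1 : R) <= 1) /\ (0 <= (p.2 : R) <= 1)}.
Proof.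
pose I : set (measurableTypeR R) := `[0%R, 1%R]%classic.
have mI : measurable I by exact: measurable_itv.
have mII : measurable (I `*` I) by exact: measurableX.
have I1 : uniform_prob (@ltr01 R) I = 1%E.
  by rewrite /uniform_prob integral_uniform_pdf1.
have II1 : mu (I `*` I) = 1%E.
  transitivity (uniform_prob (@ltr01 R) I * uniform_prob (@ltr01 R) I)%E.
    exact: product_measure1E.
  by rewrite I1 mule1.
exists (~` (I `*` I)); split.
- exact: measurableC.
- by rewrite probability_setC// II1 subee.
move=> p /= hp [/= h1 h2]; apply: hp.
by move: h1 h2; rewrite /I /= !in_itv.
Qed.

Lemma graphon_ae (f : plane R -> R) : graphon f ->
  {ae mu, forall p, 0 <= f p <= 1}.
Proof.
move=> gf; have := usquare_ae; apply: ae_imply => -[x y] [hx hy].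
exact: (gf x y hx hy).2.
Qed.

Lemma sqr_normL2 (f : plane R -> R) :
  (normL2 f ^+ 2 = \int[mu]_p (f p ^+ 2)%:E)%E.
Proof.
have sqE (x : \bar R) : (0 <= x)%E -> (x ^+ 2 = x `^ 2)%E.
  case: x => [r r0|_|//]; last by rewrite poweRyr ?pnatr_eq0// expe2 mulyy.
  by rewrite poweR_EFin powR_mulrn -?lee_fin// EFin_expe.
rewrite sqE ?Lnorm_ge0// /normL2 poweR_Lnorm//.
apply: eq_integral => p _ /=.
by rewrite powR_mulrn// real_normK ?num_real.
Qed.

Section dyad.
Variables (u : {mfun plane R >-> R}) (rho : plane R -> R).
Hypotheses (mrho : measurable_fun setT rho) (rho01 : forall p, 0 <= rho p <= 1).
Hypothesis urho : {ae mu, forall p, u p = rho p}.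

Let rho_ge0 p : 0 <= rho p. Proof. by case/andP: (rho01 p). Qed.
Let rhoC_ge0 p : 0 <= 1 - rho p.
Proof. by rewrite subr_ge0; case/andP: (rho01 p). Qed.

(** The law of a dyad depends on the truth up to null sets only, so that it may
    be computed from a version with values in the unit interval everywhere. *)
Lemma ge0_integral_dyad (f : plane R * bool -> \bar R) :
  measurable_fun setT f -> (forall z, 0 <= f z)%E ->
  (\int[dyad_law u]_z f z =
   \int[mu]_p ((rho p)%:E * f (p, true) + (1 - rho p)%:E * f (p, false)))%E.
Proof.
move=> mf f0; apply: (@ge0_integral_mixture _ _ _ _ _ mu (dyad_law u) rho
  (fun p => 1 - rho p) (pair^~ true) (pair^~ false)) => //.
  exact: measurable_funB.
move=> A mA; rewrite /= /dyad_law; apply: ae_eq_integral => //.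
- apply: (measurable_fun_xsection_finite_kernel
    (kprobability (measurableT_comp measurable_bernoulli_prob
      (@measurable_funPT _ _ _ _ u)))).
  by rewrite inE.
- apply/measurable_EFinP; apply: measurable_funD.
    apply: measurable_funM => //.
    by apply: measurableT_comp => //; exact: measurable_indic.
  apply: measurable_funM; first exact: measurable_funB.
  by apply: measurableT_comp => //; exact: measurable_indic.
- move: urho; apply: ae_imply => p up _; rewrite up bernoulli_probE//.
  have xE b : (b \in xsection A p) = ((p, b) \in A).
    by rewrite /xsection; apply/idP/idP; rewrite inE.
  by rewrite !diracE !indicE !xE.
Qed.

Lemma ess_bounded_rho : ess_bounded mu rho.
Proof.
split=> //; exists 1; apply/nearW => p /=; rewrite ger0_norm//.
by case/andP: (rho01 p).
Qed.

Let ess_bounded_mix (f g : plane R -> R) :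
  ess_bounded mu f -> ess_bounded mu g ->
  ess_bounded mu (fun p => rho p * f p + (1 - rho p) * g p).
Proof.
have hr := ess_bounded_rho.
move=> hf hg; apply: ess_boundedD; apply: ess_boundedM => //.
exact: (ess_boundedB (ess_bounded_cst mu 1) hr).
Qed.

Let integral_dyad_ge0 (h : plane R * bool -> R) :
  measurable_fun setT h -> (forall z, 0 <= h z) ->
  ess_bounded mu (fun p => h (p, true)) ->
  ess_bounded mu (fun p => h (p, false)) ->
  (dyad_law u).-integrable setT (EFin \o h) /\
  (\int[dyad_law u]_z (h z)%:E =
   \int[mu]_p (rho p * h (p, true) + (1 - rho p) * h (p, false))%:E)%E.
Proof.
move=> mh h0 h1 h2.
have eq : (\int[dyad_law u]_z (h z)%:E =
    \int[mu]_p (rho p * h (p, true) + (1 - rho p) * h (p, false))%:E)%E.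
  rewrite ge0_integral_dyad//; last exact/measurable_EFinP.
split=> //; apply/integrableP; split; first exact/measurable_EFinP.
under eq_integral do rewrite gee0_abs ?lee_fin//=.
by rewrite eq (ess_bounded_fin_num (ess_bounded_mix h1 h2)) ltry.
Qed.

Lemma integral_dyad (g : plane R * bool -> R) :
  measurable_fun setT g ->
  ess_bounded mu (fun p => g (p, true)) ->
  ess_bounded mu (fun p => g (p, false)) ->
  (dyad_law u).-integrable setT (EFin \o g) /\
  (\int[dyad_law u]_z (g z)%:E =
   \int[mu]_p (rho p * g (p, true) + (1 - rho p) * g (p, false))%:E)%E.
Proof.
move=> mg g1 g2.
pose gp z := Num.max (g z) 0; pose gn z := Num.max (- g z) 0.
have gE z : g z = gp z - gn z.
  by rewrite /gp /gn; have [h|h] := leP (g z) 0; have [h'|h'] := leP (- g z) 0; lra.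
have p1 := ess_bounded_max0 g1; have p2 := ess_bounded_max0 g2.
have n1 := ess_bounded_max0 (ess_boundedN g1).
have n2 := ess_bounded_max0 (ess_boundedN g2).
have gp0 z : 0 <= gp z by rewrite le_max lexx orbT.
have gn0 z : 0 <= gn z by rewrite le_max lexx orbT.
have mgp : measurable_fun setT gp by exact: measurable_maxr.
have mgn : measurable_fun setT gn.
  by apply: measurable_maxr => //; exact: measurableT_comp.
have [ip ep] := integral_dyad_ge0 mgp gp0 p1 p2.
have [im em] := integral_dyad_ge0 mgn gn0 n1 n2.
split.
  have -> : EFin \o g = (fun z => (EFin \o gp) z - (EFin \o gn) z)%E.
    by apply/funext => z /=; rewrite gE EFinB.
  exact: integrableB.
under eq_integral do rewrite gE EFinB.
rewrite integralB//= ep em -integralB//=; last 2 first.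
- exact/ess_bounded_integrable/ess_bounded_mix.
- exact/ess_bounded_integrable/ess_bounded_mix.
apply: eq_integral => p _; rewrite -EFinB; congr EFin.
by rewrite !gE /gp /gn /=; ring.
Qed.

End dyad.

End square.

(** * The Gram matrix of the agents *)

Section gram_matrix.
Variables (R : realType) (J : nat) (w : 'I_J -> {mfun plane R >-> R}).
Hypotheses (w_graphon : forall j, graphon (w j)) (w_indep : lin_indep_L2 w).
Local Notation mu := (usquare R).
Local Notation F := (feat w).
Local Notation G := (gram w).

Lemma mfun_ess_bounded (u : {mfun plane R >-> R}) :
  {ae mu, forall p, 0 <= u p <= 1} -> ess_bounded mu u.
Proof.
move=> u01; split; first exact: measurable_funPT.
by exists 1; move: u01; apply: ae_imply => p /andP[u0 u1]; rewrite ger0_norm.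
Qed.

Lemma ess_bounded_feat i : ess_bounded mu (fun p => F p i 0).
Proof.
under eq_fun do rewrite mxE.
case: (unlift ord0 i) => [j|]; last exact: ess_bounded_cst.
by apply: mfun_ess_bounded; exact: graphon_ae.
Qed.

Lemma measurable_feat : measurable_mx F.
Proof. by move=> i j; rewrite ord1; have [] := ess_bounded_feat i. Qed.

Lemma lincombE b p : lincomb w b p = dotv b (F p).
Proof. by []. Qed.

Lemma ess_bounded_lincomb b : ess_bounded mu (lincomb w b).
Proof.
rewrite (_ : lincomb w b = (fun p => \sum_i b i 0 * F p i 0)); last first.
  by apply/funext => p; rewrite lincombE dotvE.
apply: ess_bounded_sum => i; apply: ess_boundedM; first exact: ess_bounded_cst.
exact: ess_bounded_feat.
Qed.

Lemma integral_lincombM b (h : plane R -> R) : ess_bounded mu h ->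
  (\int[mu]_p (lincomb w b p * h p)%:E =
   (dotv b (\col_i \int[mu]_p (F p i 0 * h p)))%:E)%E.
Proof.
move=> hh.
have hi i : ess_bounded mu (fun p => F p i 0 * h p).
  by apply: ess_boundedM => //; exact: ess_bounded_feat.
have [_ e] := integral_lin (fun i => b i 0)
  (fun i => ess_bounded_integrable (hi i)) (fun i => ess_bounded_fin_num (hi i)).
rewrite dotvE; under [in RHS]eq_bigr do rewrite mxE.
rewrite -e; apply: eq_integral => p _.
rewrite lincombE dotvE mulr_suml; congr EFin.
by apply: eq_bigr => i _; rewrite mulrA.
Qed.

Lemma gramE i j : G i j = \int[mu]_p (F p i 0 * F p j 0).
Proof.
rewrite mxE; apply: eq_Rintegral => p _.
by rewrite mxE big_ord1 [in RHS]mulrC mulrC [_^T _ _]mxE.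
Qed.

Lemma gram_mul b i : \int[mu]_p (F p i 0 * lincomb w b p) = (G *m b) i 0.
Proof.
apply: EFin_inj; rewrite -ess_bounded_fin_num; last first.
  by apply: ess_boundedM; [exact: ess_bounded_feat|exact: ess_bounded_lincomb].
under eq_integral do rewrite mulrC.
rewrite integral_lincombM ?dotvE; last exact: ess_bounded_feat.
congr EFin; rewrite [RHS]mxE; apply: eq_bigr => j _.
by rewrite mxE gramE mulrC; congr (_ * _); apply: eq_Rintegral => p _; rewrite mulrC.
Qed.

Lemma gram_bilin b c :
  (\int[mu]_p (lincomb w b p * lincomb w c p)%:E = (dotv b (G *m c))%:E)%E.
Proof.
rewrite integral_lincombM; last exact: ess_bounded_lincomb.
congr (dotv _ _)%:E; apply/matrixP => i j.
by rewrite ord1 mxE gram_mul.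
Qed.

Lemma gram_qform b :
  (\int[mu]_p (lincomb w b p ^+ 2)%:E = (qform G b)%:E)%E.
Proof.
by rewrite qformE -gram_bilin; apply: eq_integral => p _; rewrite expr2.
Qed.

Lemma posdef_gram : posdef G.
Proof.
split.
  apply/matrixP => i j; rewrite mxE !gramE.
  by apply: eq_Rintegral => p _; rewrite mulrC.
move=> b b0; have h0 : (0 <= (qform G b)%:E)%E.
  by rewrite -gram_qform; apply: integral_ge0 => p _; rewrite lee_fin sqr_ge0.
rewrite lt_def -lee_fin h0 andbT; apply: contra b0 => /eqP qb.
apply/eqP/w_indep.
have mF : measurable_fun setT (fun p => (lincomb w b p ^+ 2)%:E).
  by apply/measurable_EFinP/measurable_funX; have [] := ess_bounded_lincomb b.
have : (\int[mu]_p `|(lincomb w b p ^+ 2)%:E| = 0)%E.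
  under eq_integral do rewrite gee0_abs ?lee_fin ?sqr_ge0//.
  by rewrite gram_qform qb.
move=> /(ae_eq_integral_abs mu measurableT mF).1.
apply: ae_imply => p /(_ I)/= [] /eqP.
by rewrite sqrf_eq0 => /eqP.
Qed.

Section whitening.
Variable B : 'M[R]_J.+1.
Hypotheses (uB : B \in unitmx) (GE : G = B *m B^T).

(** In these coordinates the features are orthonormal, and the leverage is the
    squared Euclidean norm. *)
Definition white p : 'cV[R]_J.+1 := invmx B *m F p.

Lemma whiteE i p : white p i 0 = lincomb w (row i (invmx B))^T p.
Proof. by rewrite /lincomb trmxK -row_mul [RHS]mxE. Qed.

Lemma ess_bounded_white i : ess_bounded mu (fun p => white p i 0).
Proof. by under eq_fun do rewrite whiteE; exact: ess_bounded_lincomb. Qed.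

Lemma white_orthonormal i j :
  (\int[mu]_p (white p i 0 * white p j 0)%:E = (i == j)%:R%:E)%E.
Proof.
under eq_integral do rewrite !whiteE.
rewrite gram_bilin; congr EFin.
rewrite /dotv trmxK tr_row -row_mul colE mxE !mulmxA -colE mxE GE.
rewrite !mulmxA mulVmx// mul1mx -trmx_mul mulVmx// trmx1 mxE.
by [].
Qed.

Lemma leverage_white p : leverage w p = dotv (white p) (white p).
Proof. by rewrite -qform_invmx_mulT// -GE. Qed.

End whitening.

Lemma leverage_ge0 p : 0 <= leverage w p.
Proof. exact: (posdef_qform_ge0 _ (posdef_inv posdef_gram)). Qed.

Lemma ess_bounded_leverage : ess_bounded mu (leverage w).
Proof.
have [B uB GE] := cholesky posdef_gram.
rewrite (_ : leverage w = (fun p => \sum_i white B p i 0 ^+ 2)); last first.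
  by apply/funext => p; rewrite (leverage_white uB GE) dotvv.
apply: ess_bounded_sum => i; apply: ess_boundedX; exact: ess_bounded_white.
Qed.

Lemma leverage_le_Lconst : {ae mu, forall p, leverage w p <= Lconst w}.
Proof.
have [_] := ess_bounded_normLoo ess_bounded_leverage.
by apply: ae_imply => p; rewrite ger0_norm// leverage_ge0.
Qed.

End gram_matrix.

(** * The smallest eigenvalue *)

Section lambda_min.
Variables (R : realType) (n : nat).
Implicit Types M N : 'M[R]_n.+1.

Lemma posdef_coercive M : posdef M ->
  exists2 e, 0 < e & forall v, e * dotv v v <= qform M v.
Proof.
move=> /cholesky[A uA ->]; pose K := \tr ((invmx A)^T *m (invmx A)^T^T).
have K0 : 0 <= K := trace_sqr_ge0 _.
exists (K + 1)^-1 => [|v]; first by rewrite invr_gt0 ltr_wpDl.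
rewrite ler_pdivrMl ?ltr_wpDl// qform_mulT.
have vE : v = (invmx A)^T *m (A^T *m v).
  by rewrite mulmxA -trmx_mul mulmxV// trmx1 mul1mx.
rewrite {1 2}vE; apply: le_trans (norm_mulmx_le _ _) _.
by rewrite ler_wpM2r ?dotvv_ge0// lerDl.
Qed.

Lemma psd_null N v : N^T = N -> (forall u, 0 <= qform N u) ->
  qform N v = 0 -> N *m v = 0.
Proof.
move=> symN psd Nv0; apply/eqP; rewrite -dotvv_eq0; apply/eqP.
set u := N *m v; set s := dotv u u; set r := qform N u.
have s0 : 0 <= s := dotvv_ge0 u; have r0 : 0 <= r := psd u.
(* the quadratic t |-> qform N (v + t u) is nonnegative and vanishes at 0 *)
have poly t : 0 <= 2 * t * s + t ^+ 2 * r.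
  have := psd (v + t *: u); congr (_ <= _).
  rewrite qformE mulmxDr -scalemxAr !(dotvDl, dotvDr, dotvZl, dotvZr).
  rewrite -qformE Nv0 (dotv_mulmx N v u) symN -/u -/s -[dotv u (N *m u)]qformE -/r.
  by ring.
apply/eqP; rewrite eq_le s0 andbT leNgt; apply/negP => s_gt0.
have r1 : 0 < r + 1 by rewrite ltr_wpDl.
have := poly (- (s / (r + 1))).
have -> : 2 * - (s / (r + 1)) * s + (- (s / (r + 1))) ^+ 2 * r =
    - (s ^+ 2 * (r + 2) / (r + 1) ^+ 2) by field; rewrite gt_eqF.
rewrite oppr_ge0 leNgt divr_gt0 ?exprn_gt0// mulr_gt0 ?exprn_gt0//.
by rewrite ltr_wpDl.
Qed.

(** The best constant in the coercivity bound is an eigenvalue: otherwise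
    subtracting it would leave a positive definite matrix, which is again
    coercive. *)
Lemma lambda_minP M : posdef M -> 0 < lambda_min M /\
  forall v, lambda_min M * dotv v v <= qform M v.
Proof.
move=> /[dup] pM [symM _]; have [e e0 Me] := posdef_coercive pM.
pose S := [set t : R | forall v, t * dotv v v <= qform M v].
have Se : S e by [].
pose e1 : 'cV[R]_n.+1 := delta_mx 0 0.
have e11 : dotv e1 e1 = 1.
  by rewrite /dotv trmx_delta mul_delta_mx mxE eqxx.
have Sub : has_ubound S.
  by exists (qform M e1) => t /(_ e1); rewrite e11 mulr1.
have Ssup : has_sup S by split=> //; exists e.
set rho := sup S.
have Srho : S rho.
  move=> v; have [->|v0] := eqVneq v 0.
    by rewrite qform0 /dotv mulmx0 mxE mulr0.
  rewrite -ler_pdivlMr ?dotvv_gt0//; apply: ge_sup; first by exists e.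
  by move=> t /(_ v); rewrite ler_pdivlMr ?dotvv_gt0.
have rho_eig : eigenvalue M rho.
  have [uN|] := boolP (M - rho%:M \in unitmx).
    have symN : (M - rho%:M)^T = M - rho%:M.
      by rewrite linearB /= symM tr_scalar_mx.
    have qN v : qform (M - rho%:M) v = qform M v - rho * dotv v v.
      by rewrite -scaleN1r qformD qformZ qform_scalar mulN1r.
    have psd v : 0 <= qform (M - rho%:M) v by rewrite qN subr_ge0.
    have pN : posdef (M - rho%:M).
      split=> // v v0; rewrite lt_def psd andbT; apply: contra v0 => /eqP.
      by move=> /(psd_null symN psd)/(congr1 (mulmx (invmx (M - rho%:M))));
        rewrite mulKmx// mulmx0 => ->.
    have [e' e'0 Ne'] := posdef_coercive pN.
    have : S (rho + e').
      by move=> v; have := Ne' v; rewrite qN mulrDl; lra.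
    by move=> /(sup_ubound Sub); rewrite -/rho gerDl leNgt e'0.
  rewrite unitmxE unitfE negbK => /det0P[v v0 vN].
  apply/eigenvalueP; exists v => //; apply/eqP.
  by rewrite -subr_eq0 -mul_mx_scalar -mulmxBr vN.
have eig_ge a : eigenvalue M a -> rho <= a.
  move=> /eigenvalueP[v vM v0].
  have v'0 : v^T != 0 by rewrite -(inj_eq (@trmx_inj _ _ _)) trmxK trmx0.
  have := Srho v^T; rewrite /qform trmxK vM -scalemxAl mxE.
  have -> : (v *m v^T) 0 0 = dotv v^T v^T by rewrite /dotv trmxK.
  by rewrite ler_pM2r ?dotvv_gt0.
have -> : lambda_min M = rho.
  apply/eqP; rewrite eq_le; apply/andP; split.
    by apply: ge_inf => //; exists rho => a; exact: eig_ge.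
  by apply: lb_le_inf; [exists rho|move=> a; exact: eig_ge].
by split=> //; apply: lt_le_trans e0 _; exact: sup_ubound.
Qed.

End lambda_min.

(** * Projection of the truth and the first two moments of the noise *)

Section truth.
Variables (R : realType) (J : nat) (w : 'I_J -> {mfun plane R >-> R}).
Hypotheses (w_graphon : forall j, graphon (w j)) (w_indep : lin_indep_L2 w).
Variable u : {mfun plane R >-> R}.
Hypothesis u01 : {ae usquare R, forall p, 0 <= u p <= 1}.
Local Notation mu := (usquare R).
Local Notation F := (feat w).
Local Notation G := (gram w).
Local Notation beta := (beta_circ w u).
Local Notation wo := (w_circ w u).

Let pG : posdef G := posdef_gram w_graphon w_indep.
Let bl b : ess_bounded mu (lincomb w b) := ess_bounded_lincomb w_graphon b.
Let bu : ess_bounded mu u := mfun_ess_bounded u01.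
Let bwo : ess_bounded mu wo := bl beta.

Lemma gram_beta_circ : G *m beta = \col_i \int[mu]_p (F p i 0 * u p).
Proof. by rewrite /beta_circ mulKVmx// posdef_unit. Qed.

Lemma residual_orthogonal b :
  (\int[mu]_p (lincomb w b p * (u p - wo p))%:E = 0)%E.
Proof.
rewrite integral_lincombM//; last exact: ess_boundedB.
rewrite (_ : \col_i _ = 0); first by rewrite /dotv mulmx0 mxE.
apply/matrixP => i j; rewrite ord1 !mxE.
have bF := ess_bounded_feat w_graphon i.
have -> : \int[mu]_p (F p i 0 * (u p - wo p)) =
    \int[mu]_p (F p i 0 * u p) - \int[mu]_p (F p i 0 * wo p).
  rewrite -RintegralB//; first by apply: eq_Rintegral => p _; rewrite mulrBr.
    by apply: ess_bounded_integrable; exact: ess_boundedM.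
  by apply: ess_bounded_integrable; exact: ess_boundedM.
by rewrite (gram_mul w_graphon) gram_beta_circ mxE subrr.
Qed.

Lemma pythagoras b :
  (\int[mu]_p ((lincomb w b p - u p) ^+ 2)%:E =
   \int[mu]_p ((u p - wo p) ^+ 2)%:E + (qform G (b - beta))%:E)%E.
Proof.
have bres : ess_bounded mu (fun p => u p - wo p) by exact: ess_boundedB.
have bdl := bl (b - beta).
have sqE p : ((lincomb w b p - u p) ^+ 2)%:E =
    (((u p - wo p) ^+ 2)%:E + (lincomb w (b - beta) p ^+ 2)%:E +
     (-2)%:E * (lincomb w (b - beta) p * (u p - wo p))%:E)%E.
  have -> : lincomb w (b - beta) p = lincomb w b p - wo p.
    by rewrite /w_circ !lincombE dotvDl -scaleN1r dotvZl mulN1r.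
  by rewrite -EFinM -!EFinD; congr EFin; ring.
under eq_integral do rewrite sqE.
have i1 : mu.-integrable setT (fun p => ((u p - wo p) ^+ 2)%:E).
  by apply: ess_bounded_integrable; exact: ess_boundedX.
have i2 : mu.-integrable setT (fun p => (lincomb w (b - beta) p ^+ 2)%:E).
  by apply: ess_bounded_integrable; exact: ess_boundedX.
have i3 : mu.-integrable setT
    (fun p => (lincomb w (b - beta) p * (u p - wo p))%:E).
  by apply: ess_bounded_integrable; exact: ess_boundedM.
rewrite integralD//=; last 2 first.
- exact: integrableD.
- exact: integrableZl.
rewrite integralD//= integralZl// residual_orthogonal mule0 adde0.
by rewrite (gram_qform w_graphon).
Qed.

(** A version of the truth with values in the unit interval everywhere. *)
Definition clip (p : plane R) : R := Num.min (Num.max (u p) 0) 1.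

Lemma clip01 p : 0 <= clip p <= 1.
Proof.
by rewrite /clip le_min le_max ge_min !lexx !orbT ler01.
Qed.

Lemma measurable_clip : measurable_fun setT clip.
Proof. by apply: measurable_minr => //; exact: measurable_maxr. Qed.

Lemma clip_ae : {ae mu, forall p, u p = clip p}.
Proof.
move: u01; apply: ae_imply => p /andP[u0 u1].
by rewrite /clip (max_idPl u0) (min_idPl u1).
Qed.

Section noise.
Variable B : 'M[R]_J.+1.
Hypotheses (uB : B \in unitmx) (GE : G = B *m B^T).

Definition noise i (z : plane R * bool) : R :=
  white w B z.1 i 0 * (z.2%:R - wo z.1).

Let bwh i : ess_bounded mu (fun p => white w B p i 0) :=
  ess_bounded_white w_graphon B i.

Let bnoise i b : ess_bounded mu (fun p => noise i (p, b)).
Proof.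
apply: ess_boundedM => //; apply: ess_boundedB => //.
exact: ess_bounded_cst.
Qed.

Let mnoise i : measurable_fun setT (noise i).
Proof.
apply: measurable_funM.
  by apply: (measurableT_comp (bwh i).1); exact: measurable_fst.
apply: measurable_funB.
  have -> : (fun z : plane R * bool => (z.2%:R : R)) =
      (fun z => if z.2 then 1 else 0) by apply/funext => -[p []].
  apply: measurable_fun_if => //; exact: measurable_snd.
by apply: (measurableT_comp bwo.1); exact: measurable_fst.
Qed.

Lemma noise_integrable i : (dyad_law u).-integrable setT (EFin \o noise i).
Proof. exact: (integral_dyad measurable_clip clip01 clip_ae (mnoise i) _ _).1. Qed.

Lemma noise_mean i : (\int[dyad_law u]_z (noise i z)%:E = 0)%E.
Proof.
rewrite (integral_dyad measurable_clip clip01 clip_ae (mnoise i) _ _).2//.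
rewrite -(residual_orthogonal (row i (invmx B))^T).
have bres : ess_bounded mu (fun p => u p - wo p) by exact: ess_boundedB.
apply: ae_eq_integral => //.
- apply/measurable_EFinP; apply: measurable_funD; apply: measurable_funM.
  + exact: measurable_clip.
  + exact: (bnoise i true).1.
  + by apply: measurable_funB => //; exact: measurable_clip.
  + exact: (bnoise i false).1.
- by apply/measurable_EFinP; apply: measurable_funM; [exact: (bl _).1|exact: bres.1].
- move: clip_ae; apply: ae_imply => p up _; rewrite -up /noise /= whiteE.
  by congr EFin; ring.
Qed.

(** Given the position, a Bernoulli response has squared distance sigma2 to the
    projection on average: its variance plus the squared residual. *)
Lemma noise_variance i :
  (\int[dyad_law u]_z (noise i z ^+ 2)%:E =
   (\int[mu]_p (sigma2 w u p * white w B p i 0 ^+ 2))%:E)%E.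
Proof.
have bs : ess_bounded mu (sigma2 w u).
  apply: ess_boundedD.
    apply: ess_boundedM => //; apply: ess_boundedB => //; exact: ess_bounded_cst.
  by apply: ess_boundedX; exact: ess_boundedB.
have bs2 : ess_bounded mu (fun p => sigma2 w u p * white w B p i 0 ^+ 2).
  by apply: ess_boundedM => //; exact: ess_boundedX.
rewrite (integral_dyad measurable_clip clip01 clip_ae
  (measurable_funX 2 (mnoise i)) _ _).2; last 2 first.
- exact: ess_boundedX (bnoise i true).
- exact: ess_boundedX (bnoise i false).
rewrite -ess_bounded_fin_num//; apply: ae_eq_integral => //.
- apply/measurable_EFinP; apply: measurable_funD; apply: measurable_funM.
  + exact: measurable_clip.
  + exact: measurable_funX (bnoise i true).1.
  + by apply: measurable_funB => //; exact: measurable_clip.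
  + exact: measurable_funX (bnoise i false).1.
- by apply/measurable_EFinP; exact: bs2.1.
- move: clip_ae; apply: ae_imply => p up _; rewrite -up /noise /= /sigma2.
  by congr EFin; ring.
Qed.

Lemma cconst_white :
  cconst w u = \sum_i \int[mu]_p (sigma2 w u p * white w B p i 0 ^+ 2).
Proof.
have bs : ess_bounded mu (sigma2 w u).
  apply: ess_boundedD.
    apply: ess_boundedM => //; apply: ess_boundedB => //; exact: ess_bounded_cst.
  by apply: ess_boundedX; exact: ess_boundedB.
have bs2 i : ess_bounded mu (fun p => sigma2 w u p * white w B p i 0 ^+ 2).
  by apply: ess_boundedM => //; exact: ess_boundedX.
have [_ e] := integral_lin (fun=> 1) (fun i => ess_bounded_integrable (bs2 i))
  (fun i => ess_bounded_fin_num (bs2 i)).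
apply: EFin_inj; rewrite /cconst -ess_bounded_fin_num; last first.
  by apply: ess_boundedM => //; exact: ess_bounded_leverage.
transitivity (\sum_i 1 * \int[mu]_p (sigma2 w u p * white w B p i 0 ^+ 2))%:E.
  rewrite -e; apply: eq_integral => p _; congr EFin.
  rewrite (leverage_white uB GE) dotvv mulr_sumr.
  by apply: eq_bigr => i _; rewrite mul1r.
by congr EFin; apply: eq_bigr => i _; rewrite mul1r.
Qed.

Lemma dyad_noise_second_moment m i :
  (\int[data_law m u]_D ((\sum_(s < m) noise i (tnth D s)) ^+ 2)%:E <=
   (m%:R * \int[mu]_p (sigma2 w u p * white w B p i 0 ^+ 2))%:E)%E.
Proof.
set v := \int[mu]_p _.
have hv (s : 'I_m) : (\int[dyad_law u]_z (noise i z ^+ 2)%:E <= v%:E)%E.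
  by rewrite noise_variance.
have := @iid_second_moment _ _ R (dyad_law u) m (fun=> noise i) (fun=> v) 0
  (fun=> noise_integrable i) (fun=> noise_mean i) hv.
rewrite (_ : 0 ^+ 2 + \sum_(s < m) v = m%:R * v); last first.
  by rewrite expr2 mul0r add0r sumr_const card_ord mulr_natl.
by under eq_integral do rewrite add0r.
Qed.

End noise.
End truth.

(** * Ridge regression on the event of a well-conditioned Gram matrix *)

Section ridge.
Variables (R : realType) (J : nat) (w : 'I_J -> {mfun plane R >-> R}).
Hypotheses (w_graphon : forall j, graphon (w j)) (w_indep : lin_indep_L2 w).
Variable u : {mfun plane R >-> R}.
Hypothesis u01 : {ae usquare R, forall p, 0 <= u p <= 1}.
Variables (m : nat) (nu tau : R).
Hypotheses (m_ge1 : (1 <= m)%N) (nu_gt0 : 0 < nu) (tau_gt0 : 0 < tau).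
Local Notation mu := (usquare R).
Local Notation F := (feat w).
Local Notation G := (gram w).
Local Notation L := (Lconst w).
Local Notation beta := (beta_circ w u).
Local Notation wo := (w_circ w u).
Local Notation kap := (kappa m nu tau).
Local Notation data := (m.-tuple (plane R * bool)).
Implicit Type D : data.

Let pG : posdef G := posdef_gram w_graphon w_indep.
Let m0 : 0 < m%:R :> R. Proof. by rewrite ltr0n. Qed.
Let kap0 : 0 < kap. Proof. by rewrite divr_gt0// mulr_gt0// exprn_gt0. Qed.

Definition ridge D : 'M[R]_J.+1 := gram_hat w D + kap%:M.

Lemma qform_gram_hat D v :
  qform (gram_hat w D) v = m%:R^-1 * \sum_(s < m) dotv (F (tnth D s).1) v ^+ 2.
Proof.
rewrite /gram_hat qformZ qform_sum; congr (_ * _).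
by apply: eq_bigr => s _; rewrite qform_outer.
Qed.

Lemma posdef_ridge D : posdef (ridge D).
Proof.
split.
  rewrite linearD linearZ /= tr_scalar_mx linear_sum /=; congr (_ *: _ + _).
  by apply: eq_bigr => s _; rewrite trmx_mul trmxK.
move=> v v0; rewrite /ridge qformD qform_scalar ltr_wpDl//.
  rewrite qform_gram_hat mulr_ge0 ?invr_ge0 ?(ltW m0)//.
  by apply: sumr_ge0 => s _; exact: sqr_ge0.
by rewrite mulr_gt0// dotvv_gt0.
Qed.

(** The noise of the normal equations at the projection of the truth. *)
Definition score D : 'cV[R]_J.+1 := m%:R^-1 *: \sum_(s < m)
  (((tnth D s).2%:R - wo (tnth D s).1) *: F (tnth D s).1).

Lemma beta_hat_error D :
  beta_hat w nu tau D - beta = invmx (ridge D) *m (score D - kap *: beta).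
Proof.
have uM := posdef_unit (posdef_ridge D).
apply: (can_inj (mulKmx uM)); rewrite mulmxBr /beta_hat -/(ridge D) !mulKVmx//.
rewrite /ridge mulmxDl mul_scalar_mx opprD addrA; congr (_ - _).
rewrite /gram_hat /score -scalemxAl -scalerBr; congr (_ *: _).
rewrite mulmx_suml -sumrB; apply: eq_bigr => s _.
rewrite scalerBl; congr (_ - _).
rewrite -mulmxA [_^T *m beta]mx11_scalar mul_mx_scalar /w_circ lincombE.
by rewrite dotvC.
Qed.

Lemma qform_parallelogram (N : 'M[R]_J.+1) a b : posdef N ->
  qform N (a - b) <= 2 * qform N a + 2 * qform N b.
Proof.
move=> pN; have := posdef_qform_ge0 (a + b) pN.
have -> : qform N (a - b) =
    2 * qform N a + 2 * qform N b - qform N (a + b).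
  rewrite (_ : a - b = a + (-1) *: b); last by rewrite scaleN1r.
  rewrite !qformE !mulmxDr -!scalemxAr.
  by rewrite !(dotvDl, dotvDr, dotvZl, dotvZr); ring.
lra.
Qed.

Definition well_conditioned D :=
  forall v, 1 / 2 * qform G v <= qform (ridge D) v.

Let bias := 8 * kap ^+ 2 * (\sum_i beta i 0 ^+ 2) / lambda_min G.

(** The factor 8 is the product of 4, from domination by half the Gram matrix,
    and 2, from separating the score from the bias. *)
Lemma ridge_error D : well_conditioned D ->
  qform G (beta_hat w nu tau D - beta) <=
  8 * qform (invmx G) (score D) + bias.
Proof.
move=> good; have [lam0 lamG] := lambda_minP pG.
have := @dominated_sandwich _ _ G (ridge D) (1 / 2) (score D - kap *: beta)
  ltac:(lra) pG (posdef_ridge D) good.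
rewrite -beta_hat_error.
have := @qform_parallelogram (invmx G) (score D) (kap *: beta) (posdef_inv pG).
have -> : qform (invmx G) (kap *: beta) = kap ^+ 2 * qform (invmx G) beta.
  by rewrite !qformE -scalemxAr dotvZl dotvZr mulrA -expr2.
have : kap ^+ 2 * qform (invmx G) beta <=
    kap ^+ 2 * (\sum_i beta i 0 ^+ 2) / lambda_min G.
  rewrite -mulrA ler_pM2l ?exprn_gt0// ler_pdivlMr// mulrC.
  rewrite -dotvv -qform_dotv -[X in _ <= qform X _]invmx1.
  apply: dominated_inv => // [|v]; first exact: posdef1.
  by rewrite qform_dotv.
rewrite /bias -!(mulrA 8).
set b := kap ^+ 2 * _ / _; set c := kap ^+ 2 * _.
set a := qform G _; set s := qform _ (score D); set t := qform _ (_ - _).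
lra.
Qed.

Lemma ridge_trace_ge0 D : 0 <= \tr (G *m Sigma_hat w nu tau D).
Proof.
rewrite /Sigma_hat -/(ridge D) -scalemxAr linearZ /=.
rewrite mulr_ge0 ?divr_ge0 ?(ltW nu_gt0)//.
have [A uA GE] := cholesky pG; rewrite [X in \tr (X *m _)]GE trace_mul_qform.
apply: sumr_ge0 => i _; apply: posdef_qform_ge0.
exact/posdef_inv/posdef_ridge.
Qed.

Lemma ridge_trace D : well_conditioned D ->
  \tr (G *m Sigma_hat w nu tau D) <= 2 * nu * J.+1%:R / m%:R.
Proof.
move=> good; rewrite /Sigma_hat -/(ridge D) -scalemxAr linearZ /=.
have nm0 : 0 < nu / m%:R by rewrite divr_gt0.
have := @dominated_trace _ _ G (ridge D) (1 / 2) ltac:(lra) pG (posdef_ridge D) good.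
rewrite (_ : 2 * nu * J.+1%:R / m%:R = nu / m%:R * (2 * J.+1%:R)); last first.
  by field; rewrite gt_eqF.
by rewrite ler_pM2l//; lra.
Qed.

Section whitened.
Variable B : 'M[R]_J.+1.
Hypotheses (uB : B \in unitmx) (GE : G = B *m B^T).

Lemma score_white D : qform (invmx G) (score D) =
  m%:R^-1 ^+ 2 * \sum_i (\sum_(s < m) noise w u B i (tnth D s)) ^+ 2.
Proof.
rewrite GE qform_invmx_mulT// dotvv mulr_sumr; apply: eq_bigr => i _.
rewrite -exprMn; congr (_ ^+ 2); rewrite /score -scalemxAr mxE; congr (_ * _).
rewrite mulmx_sumr summxE; apply: eq_bigr => s _.
by rewrite -scalemxAr mxE mulrC.
Qed.

Lemma integral_leverage : (\int[mu]_p (leverage w p)%:E = J.+1%:R%:E)%E.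
Proof.
have bw i : ess_bounded mu (fun p => white w B p i 0 * white w B p i 0).
  by apply: ess_boundedM; exact: ess_bounded_white.
have [_ e] := integral_lin (fun=> 1) (fun i => ess_bounded_integrable (bw i))
  (fun i => white_orthonormal w_graphon uB GE i i).
transitivity ((\sum_(i < J.+1) 1 * (i == i)%:R)%:E : \bar R).
  rewrite -e; apply: eq_integral => p _; congr EFin.
  rewrite (leverage_white uB GE) dotvE.
  by apply: eq_bigr => i _; rewrite mul1r.
congr EFin; under eq_bigr do rewrite eqxx mul1r.
by rewrite sumr_const card_ord.
Qed.

Lemma Lconst_ge1 : 1 <= L.
Proof.
apply: (@le_trans _ _ J.+1%:R); first by rewrite ler1n.
rewrite -lee_fin -[leRHS](integral_prob_cst mu) -integral_leverage.
apply: ae_ge0_le_integral => //.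
- by move=> p _; rewrite lee_fin; exact: leverage_ge0.
- by apply/measurable_EFinP; exact: (ess_bounded_leverage w_graphon w_indep).1.
- move=> p _; rewrite lee_fin.
  exact: (ess_bounded_normLoo (ess_bounded_leverage w_graphon w_indep)).1.
- have := leverage_le_Lconst w_graphon w_indep.
  by apply: ae_imply => p lp _; rewrite lee_fin.
Qed.

(** Features of excessive leverage are dropped; this changes them on a null
    set only, and makes the empirical Gram matrix smaller. *)
Lemma well_conditioned_event : exists Bad : set data,
  [/\ measurable Bad,
      (data_law m u Bad <= (J.+1%:R * expR (- (m%:R / (7 * L))))%:E)%E &
      forall D, ~ Bad D -> well_conditioned D].
Proof.
have bl := ess_bounded_leverage w_graphon w_indep.
pose C := [set p : plane R | leverage w p <= L].
have mC : measurable C.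
  have -> : C = setT `&` (leverage w @^-1` `]-oo, L]).
    by rewrite setTI; apply/seteqP; split => p; rewrite /C /= in_itv.
  exact: bl.1.
have m1C : measurable_fun setT (\1_C : plane R -> R) by exact: measurable_indic.
pose x (z : plane R * bool) : 'cV[R]_J.+1 := \1_C z.1 *: white w B z.1.
have bw i : ess_bounded mu (fun p => white w B p i 0).
  exact: ess_bounded_white.
have xE z i : x z i 0 = \1_C z.1 * white w B z.1 i 0 by rewrite mxE.
have b1 : ess_bounded mu (\1_C : plane R -> R).
  split=> //; exists 1; apply/nearW => p /=; rewrite indicE.
  by case: (_ \in _); rewrite ?normr1 ?normr0.
have bx i : ess_bounded mu (fun p => \1_C p * white w B p i 0).
  exact: ess_boundedM.
have mx : measurable_mx x.
  move=> i j; rewrite ord1; under eq_fun do rewrite xE.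
  exact: (measurableT_comp (bx i).1 (@measurable_fst _ _ _ _)).
have xL z : dotv (x z) (x z) <= L.
  rewrite /x dotvZl dotvZr -(leverage_white uB GE) indicE.
  have [/set_mem|_] := boolP (z.1 \in C); first by rewrite !mul1r.
  by rewrite !mul0r (le_trans _ Lconst_ge1).
have xx i j : (\int[dyad_law u]_z (x z i 0 * x z j 0)%:E = (i == j)%:R%:E)%E.
  have bxx : ess_bounded mu
      (fun p => \1_C p * white w B p i 0 * (\1_C p * white w B p j 0)).
    exact: ess_boundedM.
  under eq_integral do rewrite !xE.
  rewrite (integral_dyad (measurable_clip u) (clip01 u) (clip_ae u01)
    (measurableT_comp bxx.1 (@measurable_fst _ _ _ _)) _ _).2//=.
  rewrite -(white_orthonormal w_graphon uB GE i j).
  apply: ae_eq_integral => //.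
  - apply/measurable_EFinP; apply: measurable_funD; apply: measurable_funM.
    + exact: measurable_clip.
    + exact: bxx.1.
    + by apply: measurable_funB => //; exact: measurable_clip.
    + exact: bxx.1.
  - by apply/measurable_EFinP/measurable_funM; [exact: (bw i).1|exact: (bw j).1].
  - have := leverage_le_Lconst w_graphon w_indep.
    apply: ae_imply => p lp _; rewrite /= indicE mem_set// !mul1r.
    by congr EFin; ring.
have [Bad [mBad PBad good]] :=
  matrix_chernoff mx Lconst_ge1 xL xx m_ge1.
exists Bad; split=> // D /good h v.
rewrite /ridge qformD qform_scalar; apply: (@le_trans _ _ (qform (gram_hat w D) v)).
  rewrite qform_gram_hat ler_pdivlMl//.
  have := h (B^T *m v); rewrite -qform_mulT -GE => hv.
  apply: le_trans (_ : _ <= \sum_(s < m) dotv (x (tnth D s)) (B^T *m v) ^+ 2) _.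
    by apply: le_trans hv; rewrite div1r mulrA.
  apply: ler_sum => s _; rewrite dotv_mulmx trmxK.
  rewrite /x -scalemxAr /white mulKVmx// dotvZl exprMn indicE.
  by case: (_ \in _); rewrite ?expr1n ?mul1r// expr0n mul0r sqr_ge0.
by rewrite lerDl mulr_ge0 ?dotvv_ge0// ltW.
Qed.

End whitened.

End ridge.

(** * Risk of the clipped ridge estimator *)

Section risk_bound.
Variables (R : realType) (J : nat) (w : 'I_J -> {mfun plane R >-> R}).
Hypotheses (w_graphon : forall j, graphon (w j)) (w_indep : lin_indep_L2 w).
Variable u : {mfun plane R >-> R}.
Hypothesis u01 : {ae usquare R, forall p, 0 <= u p <= 1}.
Variables (m : nat) (nu tau : R).
Hypotheses (m_ge1 : (1 <= m)%N) (nu_gt0 : 0 < nu) (tau_gt0 : 0 < tau).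
Local Notation mu := (usquare R).
Local Notation F := (feat w).
Local Notation G := (gram w).
Local Notation L := (Lconst w).
Local Notation beta := (beta_circ w u).
Local Notation wo := (w_circ w u).
Local Notation kap := (kappa m nu tau).
Local Notation data := (m.-tuple (plane R * bool)).
Local Notation bias := (8 * kap ^+ 2 * (\sum_i beta i 0 ^+ 2) / lambda_min G).
Local Notation tail := (J.+1%:R * expR (- (m%:R / (7 * L)))).
Implicit Type D : data.

Let pG : posdef G := posdef_gram w_graphon w_indep.
Let m0 : 0 < m%:R :> R. Proof. by rewrite ltr0n. Qed.

Let measurable_noise_sum B i :
  measurable_fun setT
    (fun D : data => (\sum_(s < m) noise w u B i (tnth D s)) ^+ 2).
Proof.
apply: measurable_funX; apply: measurable_sum => s.
apply: measurableT_comp; last exact: measurable_tnth.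
by apply/measurable_EFinP/measurable_int; exact: (noise_integrable w_graphon u01).
Qed.

Lemma measurable_score :
  measurable_fun setT (fun D : data => qform (invmx G) (score w u D)).
Proof.
have [B uB GE] := cholesky pG.
under eq_fun do rewrite (score_white u uB GE).
by apply: measurable_funM => //; apply: measurable_sum.
Qed.

Lemma score_expectation :
  (\int[data_law m u]_D (qform (invmx G) (score w u D))%:E <=
   (cconst w u / m%:R)%:E)%E.
Proof.
have [B uB GE] := cholesky pG.
under eq_integral do rewrite (score_white u uB GE) EFinM -sumEFin.
rewrite ge0_integralZl//; last 2 first.
- by apply: emeasurable_sum => i; exact/measurable_EFinP.
- by move=> D _; apply: sume_ge0 => i _; rewrite lee_fin sqr_ge0.
rewrite ge0_integral_sum//; last 2 first.
- by move=> i; exact/measurable_EFinP.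
- by move=> i D _; rewrite lee_fin sqr_ge0.
have -> : (cconst w u / m%:R)%:E = ((m%:R^-1 ^+ 2)%:E * \sum_i
    (m%:R * \int[mu]_p (sigma2 w u p * white w B p i 0 ^+ 2))%:E)%E.
  rewrite sumEFin -EFinM -mulr_sumr -(cconst_white w_graphon w_indep u01 uB GE).
  by congr EFin; field; rewrite gt_eqF.
apply: lee_wpmul2l; first by rewrite lee_fin sqr_ge0.
by apply: lee_sum => i _; exact: dyad_noise_second_moment.
Qed.

(** Common to the risk and to the posterior mass: a loss bounded by one costs
    the probability of the bad event, and on the good one its bound is affine
    in the squared norm of the score. *)
Lemma good_event_bound (f : data -> \bar R) (a b : R) :
  0 <= a -> 0 <= b -> (forall D, 0 <= f D)%E -> (forall D, f D <= 1)%E ->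
  (forall D, well_conditioned w nu tau D ->
     (f D <= (a + b * qform (invmx G) (score w u D))%:E)%E) ->
  (\int[data_law m u]_D f D <= (a + b * (cconst w u / m%:R) + tail)%:E)%E.
Proof.
move=> a0 b0 f0 f1 fgood; have [B uB GE] := cholesky pG.
have [Bad [mBad PBad good]] := well_conditioned_event w_graphon w_indep u01
  m_ge1 nu_gt0 tau_gt0 uB GE.
have s0 D : 0 <= qform (invmx G) (score w u D).
  by apply: posdef_qform_ge0; exact: posdef_inv.
apply: (@le_trans _ _ (\int[data_law m u]_D
  (a%:E + b%:E * (qform (invmx G) (score w u D))%:E + (\1_Bad D)%:E))%E).
  apply: ge0_le_integralT => // D; rewrite indicE.
  have [_|/negP DBad] := boolP (D \in Bad).
    apply: (le_trans (f1 D)); rewrite -EFinM -!EFinD lee_fin lerDr.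
    by rewrite addr_ge0// mulr_ge0.
  rewrite adde0 -EFinM -EFinD; apply/fgood/good => DB; apply: DBad.
  exact: mem_set.
have mS := measurable_score.
rewrite ge0_integralD//; last 3 first.
- by move=> D _; rewrite -EFinM -EFinD lee_fin addr_ge0// mulr_ge0.
- apply: emeasurable_funD => //; apply: emeasurable_funM => //.
  exact/measurable_EFinP.
- exact/measurable_EFinP/measurable_indic.
rewrite ge0_integralD//; last 2 first.
- by move=> D _; rewrite -EFinM lee_fin mulr_ge0.
- by apply: emeasurable_funM => //; exact/measurable_EFinP.
rewrite integral_prob_cst integral_indic// setIT ge0_integralZl//; last 2 first.
- exact/measurable_EFinP.
- by move=> D _; rewrite lee_fin.
rewrite !EFinD; apply: leeD => //; apply: leeD => //.
by rewrite EFinM; apply: lee_wpmul2l => //; exact: score_expectation.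
Qed.

Let bl b : ess_bounded mu (lincomb w b) := ess_bounded_lincomb w_graphon b.
Let bu : ess_bounded mu u := mfun_ess_bounded u01.

Lemma clip_loss (b : 'cV[R]_J.+1) :
  let f := fun p => Num.min (Num.max (lincomb w b p) 0) 1 - u p in
  (normL2 f ^+ 2 <= 1)%E /\
  (normL2 f ^+ 2 <= normL2 (fun p => (u p - wo p)%R) ^+ 2 +
     (qform G (b - beta))%:E)%E.
Proof.
move=> f; have mf : measurable_fun setT f.
  apply: measurable_funB => //; apply: measurable_minr => //.
  by apply: measurable_maxr => //; exact: (bl b).1.
have mf2 : measurable_fun setT (fun p => (f p ^+ 2)%:E).
  by apply/measurable_EFinP; exact: measurable_funX.
rewrite !sqr_normL2; split.
  rewrite -[leRHS](integral_prob_cst mu); apply: ae_ge0_le_integral => //.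
  - by move=> p _; rewrite lee_fin sqr_ge0.
  - move: u01; apply: ae_imply => p /andP[u0 u1] _; rewrite lee_fin /f /=.
    set y := Num.min _ 1; have /andP[y0 y1] : 0 <= y <= 1.
      by rewrite /y le_min le_max ge_min !lexx !orbT ler01.
    nra.
rewrite -(pythagoras w_graphon w_indep u01 b).
apply: ae_ge0_le_integral => //.
- by move=> p _; rewrite lee_fin sqr_ge0.
- by move=> p _; rewrite lee_fin sqr_ge0.
- apply/measurable_EFinP; apply: measurable_funX; apply: measurable_funB => //.
  exact: (bl b).1.
- move: u01; apply: ae_imply => p /andP[u0 u1] _; rewrite lee_fin /f /=.
  set x := lincomb w b p.
  have [x0|x0] := leP 0 x.
    have [x1|x1] := leP x 1 => //; nra.
  rewrite (min_idPl ler01); nra.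
Qed.

Lemma risk_upper_bound :
  (risk (fun D : data => w_hat_plus w nu tau D) u <=
   normL2 (fun p => u p - wo p)%R ^+ 2 +
   (8 * cconst w u / m%:R + bias + tail)%:E)%E.
Proof.
have [lam0 _] := lambda_minP pG.
have bias0 : 0 <= bias.
  apply: divr_ge0 (ltW lam0); apply: mulr_ge0.
    by rewrite mulr_ge0 ?sqr_ge0.
  by apply: sumr_ge0 => i _; exact: sqr_ge0.
set A := (normL2 _ ^+ 2)%E.
have [a a0 AE] : exists2 a, 0 <= a & A = a%:E.
  have bres : ess_bounded mu (fun p => (u p - wo p) ^+ 2).
    by apply: ess_boundedX; apply: ess_boundedB => //; exact: bl.
  exists (\int[mu]_p ((u p - wo p) ^+ 2)).
    by apply: Rintegral_ge0 => p _; exact: sqr_ge0.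
  by rewrite /A sqr_normL2 ess_bounded_fin_num.
rewrite AE -EFinD.
have -> : a + (8 * cconst w u / m%:R + bias + tail) =
    a + bias + 8 * (cconst w u / m%:R) + tail by rewrite -mulrA; ring.
apply: good_event_bound => //.
- exact: addr_ge0.
- by move=> D; rewrite expe_ge0// Lnorm_ge0.
- by move=> D; exact: (clip_loss (beta_hat w nu tau D)).1.
- move=> D good; apply: le_trans (clip_loss (beta_hat w nu tau D)).2 _.
  rewrite -/A AE -EFinD lee_fin -addrA lerD2l addrC.
  exact: ridge_error.
Qed.

End risk_bound.

(** * Moments of the standard normal law *)

Section normal_moments.
Variable R : realType.
Local Notation N := (normal_prob (0 : R) 1 : probability (measurableTypeR R) R).
Local Notation leb := (@lebesgue_measure R).

Lemma ge0_integral_normal (f : measurableTypeR R -> \bar R) :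
  measurable_fun setT f -> (forall x, 0 <= f x)%E ->
  (\int[N]_x f x = \int[leb]_x ((normal_pdf 0 1 x)%:E * f x))%E.
Proof.
move=> mf f0.
rewrite (@ge0_integral_mixture _ _ _ _ R leb N (normal_pdf 0 1) (cst 0) id id)//.
- by apply: eq_integral => x _; rewrite mul0e adde0.
- exact: measurable_normal_pdf.
- by move=> x; exact: normal_pdf_ge0.
- move=> A mA; transitivity (\int[leb]_(x in A) (normal_pdf 0 1 x)%:E)%E => //.
  rewrite [LHS]integral_mkcond.
  apply: eq_integral => x _; rewrite mul0e adde0 patchE indicE.
  by case: ifPn; rewrite ?mule1 ?mule0.
Qed.

(** The law N(a, s^2) has total mass one; written as an exponential moment of
    the standard normal law. *)
Lemma normal_tilt (a s : R) (f : R -> R) : 0 < s ->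
  measurable_fun setT f ->
  (forall x, normal_fun 0 1 x * f x = normal_fun a s x) ->
  (forall x, 0 <= f x) ->
  (\int[N]_x (f x)%:E = s%:E)%E.
Proof.
move=> s0 mf fE f0; rewrite ge0_integral_normal//; last exact/measurable_EFinP.
have -> : (s%:E = s%:E * \int[leb]_x (normal_pdf a s x)%:E)%E.
  by rewrite integral_normal_pdf mule1.
rewrite -ge0_integralZl//; last 3 first.
- by apply/measurable_EFinP; exact: measurable_normal_pdf.
- by move=> x _; rewrite lee_fin normal_pdf_ge0.
- by rewrite lee_fin ltW.
apply: eq_integral => x _; rewrite -!EFinM; congr EFin.
rewrite /normal_pdf oner_eq0 (gt_eqF s0) -mulrA fE mulrA.
congr (_ * _); rewrite /normal_peak expr1n mul1r.
rewrite -mulrnAr sqrtrM ?sqr_ge0// sqrtr_sqr gtr0_norm// invfM.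
by rewrite mulrA mulfV ?gt_eqF// mul1r.
Qed.

Lemma normal_second_moment : (\int[N]_x (x ^+ 2)%:E <= 1)%E.
Proof.
apply/lee_addgt0Pr => e e0; pose s : R := 1 + e / 2.
have s1 : 1 < s by rewrite ltrDl divr_gt0.
have s0 : 0 < s by exact: lt_trans s1.
pose t : R := (1 - s ^- 2) / 2.
have t0 : 0 < t by rewrite divr_gt0// subr_gt0 invf_lt1 ?exprn_gt0// exprn_egt1.
have mx2 : measurable_fun setT (fun x : measurableTypeR R => x ^+ 2).
  exact: measurable_funX.
have := @normal_tilt 0 s (fun x => expR (t * x ^+ 2)) s0.
have -> : (\int[N]_x (x ^+ 2)%:E =
    t^-1%:E * (\int[N]_x (t * x ^+ 2)%:E))%E.
  under [in RHS]eq_integral do rewrite EFinM.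
  rewrite ge0_integralZl//; last 3 first.
  - exact/measurable_EFinP.
  - by move=> x _; rewrite lee_fin sqr_ge0.
  - by rewrite lee_fin ltW.
  by rewrite muleA -EFinM mulVf ?gt_eqF// mul1e.
move=> tilt; have {}tilt : (\int[N]_x (expR (t * x ^+ 2))%:E = s%:E)%E.
  apply: tilt => [|x|x]; last exact: expR_ge0.
  - apply: measurableT_comp => //; exact: measurable_funM.
  - rewrite /normal_fun -expRD !subr0 expr1n; congr expR; rewrite /t; field.
    by rewrite gt_eqF.
have le : (1 + \int[N]_x (t * x ^+ 2)%:E <= s%:E)%E.
  rewrite -tilt -[X in (X + _)%E](integral_prob_cst N) -ge0_integralD//; last 2 first.
  - by move=> x _; rewrite lee_fin mulr_ge0 ?sqr_ge0 ?(ltW t0).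
  - by apply/measurable_EFinP; exact: measurable_funM.
  apply: ge0_le_integralT => x; rewrite -EFinD lee_fin.
    by rewrite addr_ge0// mulr_ge0 ?sqr_ge0 ?(ltW t0).
  exact: expR_ge1Dx.
have le' : (\int[N]_x (t * x ^+ 2)%:E <= (s - 1)%:E)%E.
  by rewrite EFinB leeBrDl.
apply: (@le_trans _ _ (t^-1%:E * (s - 1)%:E)%E).
  by apply: lee_wpmul2l => //; rewrite lee_fin invr_ge0 ltW.
rewrite -EFinM -EFinD lee_fin ler_pdivrMl// /t.
rewrite -(ler_pM2r (_ : 0 < 2 * s ^+ 2)); last by rewrite mulr_gt0// exprn_gt0.
have -> : (1 - s ^- 2) / 2 * (1 + e) * (2 * s ^+ 2) = (s ^+ 2 - 1) * (1 + e).
  by field; rewrite gt_eqF.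
rewrite /s; nra.
Qed.

Lemma normal_id_integrable : N.-integrable setT (EFin \o (id : measurableTypeR R -> R)).
Proof.
apply/integrableP; split; first exact/measurable_EFinP.
apply: (@le_lt_trans _ _ (\int[N]_x (1 + (x ^+ 2)%:E))%E).
  apply: ge0_le_integralT => x; first exact: abse_ge0.
  rewrite /= -EFinD lee_fin.
  by rewrite ler_norml; apply/andP; split; nra.
rewrite ge0_integralD//; last 2 first.
- by move=> x _; rewrite lee_fin sqr_ge0.
- by apply/measurable_EFinP; exact: measurable_funX.
rewrite integral_prob_cst.
by apply: (@le_lt_trans _ _ (1 + 1)%E); rewrite ?ltry// leeD2l// normal_second_moment.
Qed.

Lemma normal_mean : (\int[N]_x x%:E = 0)%E.
Proof.
have fin : (\int[N]_x x%:E \is a fin_num)%E.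
  by apply: integrable_fin_num => //; exact: normal_id_integrable.
rewrite -[LHS]fineK//; congr EFin; set M := fine _.
have key (a : R) : a * M <= a ^+ 2 / 2.
  have tilt : (\int[N]_x (expR (a * x - a ^+ 2 / 2))%:E = 1)%E.
    apply: (@normal_tilt a 1) => // [|x].
      by apply: measurableT_comp => //; exact: measurable_funB.
    by rewrite /normal_fun -expRD !expr1n; congr expR; field.
  have ia : N.-integrable setT (fun x => a%:E * x%:E)%E.
    by apply: integrableZl => //; exact: normal_id_integrable.
  have ic : N.-integrable setT (fun x => (1 - a ^+ 2 / 2)%:E).
    exact: finite_measure_integrable_cst.
  have ie : N.-integrable setT (fun x => (expR (a * x - a ^+ 2 / 2))%:E).
    apply/integrableP; split.
      apply/measurable_EFinP; apply: measurableT_comp => //.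
      exact: measurable_funB.
    under eq_integral do rewrite gee0_abs ?lee_fin ?expR_ge0//.
    by rewrite tilt ltry.
  have : (\int[N]_x ((1 - a ^+ 2 / 2)%:E + a%:E * x%:E) <= 1)%E.
    rewrite -tilt; apply: le_integral => //; first exact: integrableD.
    move=> x _; rewrite -EFinM -EFinD lee_fin.
    by apply: le_trans (expR_ge1Dx _); rewrite addrAC addrA.
  rewrite integralD// integral_prob_cst integralZl//; last exact: normal_id_integrable.
  by rewrite -[X in (_ * X)%E]fineK// -/M -EFinM -EFinD lee_fin; lra.
have := key M; have := key (- M); nra.
Qed.

End normal_moments.

(** * Concentration of the posterior *)

Section gaussian_tail.
Variables (R : realType) (n : nat).
Local Notation N := (normal_prob (0 : R) 1 : probability (measurableTypeR R) R).

(** Chebyshev for the Gaussian law. The covariance factor chosen in the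
    definition of the law either has the prescribed square or vanishes; the
    spread is at most the trace in both cases. *)
Lemma mvnormal_markov (b be : 'cV[R]_n) (S M : 'M[R]_n) (r : R) :
  posdef M -> 0 <= \tr (M *m S) -> 0 < r ->
  (mvnormal b S [set x | (r < qform M (x - be))%R] <= 1)%E /\
  (mvnormal b S [set x | (r < qform M (x - be))%R] <=
     (r^-1 * (qform M (b - be) + \tr (M *m S)))%:E)%E.
Proof.
move=> pM trS r0; rewrite /mvnormal; set A := xget _ _.
have trA : \tr (M *m (A *m A^T)) <= \tr (M *m S).
  rewrite /A; case: xgetP => [A0 _ /= -> //|_].
  by rewrite mul0mx mulmx0 mxtrace0.
have [B uB ME] := cholesky pM.
pose f (z : n.-tuple (measurableTypeR R)) :=
  qform M (b + A *m \col_i tnth z i - be).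
pose c i := (B^T *m (b - be)) i 0; pose a i s := (B^T *m A) i s.
have fE z : f z = \sum_i (c i + \sum_(s < n) a i s * tnth z s) ^+ 2.
  rewrite /f ME qform_mulT dotvv; apply: eq_bigr => i _; congr (_ ^+ 2).
  rewrite addrAC mulmxDr mxE /c mulmxA; congr (_ + _).
  by rewrite mxE; apply: eq_bigr => s _; rewrite [X in _ * X]mxE.
have mterm i : measurable_fun setT (fun z : n.-tuple (measurableTypeR R) =>
    (c i + \sum_(s < n) a i s * tnth z s) ^+ 2).
  apply: measurable_funX; apply: measurable_funD => //.
  apply: measurable_sum => s; apply: measurable_funM => //.
  exact: measurable_tnth.
have mf : measurable_fun setT f.
  have -> : f = fun z => \sum_i (c i + \sum_(s < n) a i s * tnth z s) ^+ 2.
    by apply/funext => z; exact: fE.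
  exact: measurable_sum.
set E := [set z | _].
have mE : measurable E.
  have -> : E = setT `&` (f @^-1` `]r, +oo[).
    by rewrite setTI; apply/seteqP; split => z; rewrite /E /f /= in_itv/= andbT.
  exact: mf.
have f0 z : 0 <= f z by exact: posdef_qform_ge0.
split; first exact: probability_le1.
rewrite -[X in iid_law N n X]setIT -integral_indic//.
apply: (@le_trans _ _ (\int[iid_law N n]_z (r^-1%:E * (f z)%:E))%E).
  apply: ge0_le_integralT => z; rewrite -?EFinM lee_fin// indicE.
  have [/set_mem Ez|_] := boolP (z \in E); last first.
    by rewrite mulr_ge0// invr_ge0 ltW.
  by rewrite ler_pdivlMl// mulr1 ltW.
rewrite ge0_integralZl//; last 3 first.
- exact/measurable_EFinP.
- by move=> z _; rewrite lee_fin.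
- by rewrite lee_fin invr_ge0 ltW.
rewrite EFinM; apply: lee_wpmul2l; first by rewrite lee_fin invr_ge0 ltW.
under eq_integral do rewrite fE -sumEFin.
rewrite ge0_integral_sum//; last 2 first.
- by move=> i; exact/measurable_EFinP.
- by move=> i z _; rewrite lee_fin sqr_ge0.
apply: (@le_trans _ _ (\sum_i (c i ^+ 2 + \sum_(s < n) a i s ^+ 2)%:E)%E).
  apply: lee_sum => i _; apply: (@iid_second_moment _ _ R N n
    (fun s z => a i s * z) (fun s => a i s ^+ 2) (c i)) => s.
  - apply: (@eq_integrable _ _ _ N setT measurableT
      (fun z => (a i s)%:E * z%:E)%E) => //.
    by apply: integrableZl => //; exact: normal_id_integrable.
  - under eq_integral do rewrite EFinM.
    by rewrite integralZl//; [rewrite normal_mean mule0|exact: normal_id_integrable].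
  - under eq_integral do rewrite exprMn EFinM.
    rewrite ge0_integralZl//; last 3 first.
    + by apply/measurable_EFinP; exact: measurable_funX.
    + by move=> z _; rewrite lee_fin sqr_ge0.
    + by rewrite lee_fin sqr_ge0.
    rewrite -[leRHS]mule1; apply: lee_wpmul2l; first by rewrite lee_fin sqr_ge0.
    exact: normal_second_moment.
rewrite sumEFin lee_fin big_split /=; apply: lerD.
  by rewrite ME qform_mulT dotvv.
apply: le_trans trA; rewrite le_eqVlt; apply/orP; left; apply/eqP.
by rewrite /a -trace_sqr trmx_mul trmxK ME -!mulmxA [RHS]mxtrace_mulC -!mulmxA.
Qed.

End gaussian_tail.

Section posterior_bound.
Variables (R : realType) (J : nat) (w : 'I_J -> {mfun plane R >-> R}).
Hypotheses (w_graphon : forall j, graphon (w j)) (w_indep : lin_indep_L2 w).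
Variable u : {mfun plane R >-> R}.
Hypothesis u01 : {ae usquare R, forall p, 0 <= u p <= 1}.
Variables (m : nat) (nu tau : R).
Hypotheses (m_ge1 : (1 <= m)%N) (nu_gt0 : 0 < nu) (tau_gt0 : 0 < tau).
Local Notation G := (gram w).
Local Notation beta := (beta_circ w u).
Local Notation wo := (w_circ w u).
Local Notation kap := (kappa m nu tau).
Local Notation data := (m.-tuple (plane R * bool)).
Local Notation bias := (8 * kap ^+ 2 * (\sum_i beta i 0 ^+ 2) / lambda_min G).
Local Notation tail := (J.+1%:R * expR (- (m%:R / (7 * Lconst w)))).

Let pG : posdef G := posdef_gram w_graphon w_indep.

Lemma normL2_lincomb b :
  (normL2 (fun p => lincomb w b p - wo p)%R ^+ 2 = (qform G (b - beta))%:E)%E.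
Proof.
rewrite sqr_normL2 -(gram_qform w_graphon); apply: eq_integral => p _.
by rewrite /w_circ !lincombE dotvDl -[in RHS]scaleN1r dotvZl mulN1r.
Qed.

Lemma posterior_upper_bound (r : R) : 0 < r ->
  (\int[data_law m u]_D
     posterior w nu tau D
       [set v : plane R -> R | r%:E < normL2 (fun p => v p - wo p)%R ^+ 2]
   <= (r^-1 * ((8 * cconst w u + 2 * nu * J.+1%:R) / m%:R + bias) + tail)%:E)%E.
Proof.
move=> r0; have [lam0 _] := lambda_minP pG.
have m0 : 0 < m%:R :> R by rewrite ltr0n.
have bias0 : 0 <= bias.
  apply: divr_ge0 (ltW lam0); apply: mulr_ge0.
    by rewrite mulr_ge0 ?sqr_ge0.
  by apply: sumr_ge0 => i _; exact: sqr_ge0.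
have trS0 (D : data) : 0 <= \tr (G *m Sigma_hat w nu tau D).
  exact: (ridge_trace_ge0 w_graphon w_indep m_ge1 nu_gt0 tau_gt0 D).
have postE (D : data) : posterior w nu tau D
    [set v : plane R -> R | (r%:E < normL2 (fun p => v p - wo p)%R ^+ 2)%E] =
  mvnormal (beta_hat w nu tau D) (Sigma_hat w nu tau D)
    [set b | r < qform G (b - beta)].
  rewrite /posterior; congr mvnormal; apply/seteqP.
  by split => b; rewrite /mkset normL2_lincomb lte_fin.
have -> : r^-1 * ((8 * cconst w u + 2 * nu * J.+1%:R) / m%:R + bias) =
    r^-1 * (bias + 2 * nu * J.+1%:R / m%:R) + r^-1 * 8 * (cconst w u / m%:R).
  by ring.
have ri0 : 0 <= r^-1 by rewrite invr_ge0 ltW.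
apply: (good_event_bound w_graphon w_indep u01 m_ge1 nu_gt0 tau_gt0).
- rewrite mulr_ge0// addr_ge0//.
  by rewrite divr_ge0// mulr_ge0// mulr_ge0// ltW.
- by rewrite mulr_ge0.
- by move=> D; rewrite /posterior /mvnormal measure_ge0.
- move=> D; rewrite postE.
  exact: (mvnormal_markov _ _ pG (trS0 D) r0).1.
- move=> D good; rewrite postE.
  apply: le_trans (mvnormal_markov _ _ pG (trS0 D) r0).2 _.
  rewrite lee_fin -[r^-1 * 8 * _]mulrA -mulrDr ler_wpM2l//.
  have := ridge_error w_graphon w_indep u m_ge1 nu_gt0 tau_gt0 good.
  have := ridge_trace w_graphon w_indep m_ge1 nu_gt0 tau_gt0 good.
  lra.
Qed.

End posterior_bound.

(** * Bounded orthonormal bases of the centred span *)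

Section centred_basis.
Variables (R : realType) (J : nat) (w : 'I_J -> {mfun plane R >-> R}).
Hypotheses (w_graphon : forall j, graphon (w j)) (w_indep : lin_indep_L2 w).
Local Notation mu := (usquare R).
Local Notation G := (gram w).
Local Notation F := (feat w).

Let pG : posdef G := posdef_gram w_graphon w_indep.

Let mean j : R := \int[mu]_p w j p.

(** Coordinates of the centred agents in the features. *)
Definition centre_mx : 'M[R]_(J.+1, J) :=
  \matrix_(i, k) (if unlift ord0 i is Some j then (j == k)%:R else - mean k).

Lemma feat0 p : F p ord0 0 = 1.
Proof. by rewrite mxE unlift_none. Qed.

Lemma featS j p : F p (lift ord0 j) 0 = w j p.
Proof. by rewrite mxE liftK. Qed.

Lemma centre_mx0 k : centre_mx ord0 k = - mean k.
Proof. by rewrite mxE unlift_none. Qed.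

Lemma centre_mxS j k : centre_mx (lift ord0 j) k = (j == k)%:R.
Proof. by rewrite mxE liftK. Qed.

Lemma lincomb_centre a p :
  lincomb w (centre_mx *m a) p = \sum_j a j 0 * (w j p - mean j).
Proof.
rewrite lincombE dotvE big_ord_recl feat0 mulr1.
have -> : (centre_mx *m a) ord0 0 = - \sum_j a j 0 * mean j.
  rewrite mxE -sumrN; apply: eq_bigr => k _.
  by rewrite centre_mx0 mulNr mulrC.
rewrite addrC -sumrB; apply: eq_bigr => j _; rewrite featS mulrBr; congr (_ * _ - _).
rewrite mxE (bigD1 j)//= centre_mxS eqxx mul1r big1 ?addr0// => k kj.
by rewrite centre_mxS eq_sym (negbTE kj) mul0r.
Qed.

Let bw j : ess_bounded mu (w j).
Proof. by apply: mfun_ess_bounded; exact: graphon_ae. Qed.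

Lemma integral_lincomb b :
  \int[mu]_p lincomb w b p = b ord0 0 + \sum_j b (lift ord0 j) 0 * mean j.
Proof.
apply: EFin_inj; rewrite -ess_bounded_fin_num; last exact: ess_bounded_lincomb.
have := integral_lincombM w_graphon b (ess_bounded_cst mu 1).
under eq_integral do rewrite mulr1.
move=> ->; congr EFin; rewrite dotvE big_ord_recl; congr (_ + _).
  rewrite mxE; under eq_Rintegral do rewrite feat0 mulr1.
  rewrite Rintegral_cst// [X in fine X](_ : _ = 1%E) ?mulr1//.
  exact: (probability_setT mu).
apply: eq_bigr => j _; rewrite mxE; congr (_ * _).
by under eq_Rintegral do rewrite featS mulr1.
Qed.

Lemma integral_lincomb_centre a : \int[mu]_p lincomb w (centre_mx *m a) p = 0.
Proof.
rewrite integral_lincomb.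
have -> : (centre_mx *m a) ord0 0 = - \sum_j a j 0 * mean j.
  rewrite mxE -sumrN; apply: eq_bigr => k _.
  by rewrite centre_mx0 mulNr mulrC.
apply/eqP; rewrite addrC subr_eq0; apply/eqP/eq_bigr => j _; congr (_ * _).
rewrite mxE (bigD1 j)//= centre_mxS eqxx mul1r big1 ?addr0// => k kj.
by rewrite centre_mxS eq_sym (negbTE kj) mul0r.
Qed.

Lemma H0_lincomb h : H0 w h -> exists b, h = lincomb w b.
Proof.
move=> [_ [b _ <-]] <-; set c := \int[mu]_q _.
exists (b - c *: delta_mx ord0 0); apply/funext => p.
rewrite !lincombE dotvDl -scaleNr dotvZl; congr (_ + _).
rewrite dotvE (bigD1 ord0)//= mxE !eqxx mul1r feat0 big1 ?addr0 ?mulr1// => i i0.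
by rewrite mxE (negbTE i0) mul0r.
Qed.

(** Centring is injective on coefficients, so that the form inherits its
    definiteness from G, the Gram matrix of the agents and of the constant. *)
Lemma posdef_centred_gram : posdef (centre_mx^T *m G *m centre_mx).
Proof.
split=> [|a a0]; first by rewrite !trmx_mul trmxK pG.1 mulmxA.
have -> : qform (centre_mx^T *m G *m centre_mx) a = qform G (centre_mx *m a).
  by rewrite -[X in _ *m X]trmxK qform_mul trmxK.
apply: pG.2; apply: contra a0 => /eqP Ea; apply/eqP/matrixP => j i.
rewrite ord1 mxE; have /matrixP/(_ (lift ord0 j) 0) := Ea.
rewrite !mxE (bigD1 j)//= centre_mxS eqxx mul1r big1 ?addr0// => k kj.
by rewrite centre_mxS eq_sym (negbTE kj) mul0r.
Qed.

(** The set whose infimum defines the constant B is not empty. *)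
Lemma onb_H0_exists : exists psi, onb_H0 w psi.
Proof.
have [A uA CE] := cholesky posdef_centred_gram.
pose r k : 'cV[R]_J := (row k (invmx A))^T.
exists (fun k => lincomb w (centre_mx *m r k)); split.
- move=> k; exists (lincomb w (centre_mx *m r k)); first by eexists.
  by apply/funext => p; rewrite integral_lincomb_centre subr0.
- move=> k l; apply: EFin_inj; rewrite -ess_bounded_fin_num; last first.
    by apply: ess_boundedM; exact: ess_bounded_lincomb.
  rewrite (gram_bilin w_graphon); congr EFin.
  rewrite /dotv trmx_mul !mulmxA -(mulmxA _ _ centre_mx) mulmxA.
  rewrite -!(mulmxA (r k)^T) CE /r trmxK tr_row -row_mul colE mxE !mulmxA -colE mxE.
  by rewrite mulVmx// mul1mx -trmx_mul mulVmx// trmx1 mxE.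
- move=> _ [_ [b _ <-]] <-.
  pose b' : 'cV[R]_J := \col_j b (lift ord0 j) 0.
  exists (fun k => (A^T *m b') k 0); apply/nearW => p.
  have -> : lincomb w b p - \int[mu]_q lincomb w b q =
      lincomb w (centre_mx *m b') p.
    rewrite integral_lincomb lincomb_centre lincombE dotvE big_ord_recl feat0 mulr1.
    rewrite opprD addrACA subrr add0r -sumrB; apply: eq_bigr => j _.
    by rewrite featS mxE mulrBr.
  have b'E : b' = \sum_k (A^T *m b') k 0 *: r k.
    have {1}-> : b' = (invmx A)^T *m (A^T *m b').
      by rewrite mulmxA -trmx_mul mulmxV// trmx1 mul1mx.
    apply/matrixP => i j; rewrite ord1 summxE mxE; apply: eq_bigr => k _.
    by rewrite !mxE mulrC.
  rewrite [in LHS]b'E mulmx_sumr lincombE /dotv linear_sum mulmx_suml summxE.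
  apply: eq_bigr => k _; rewrite -scalemxAr linearZ /= -scalemxAl mxE.
  by [].
Qed.

Lemma onb_ess_bounded psi : onb_H0 w psi -> forall k, ess_bounded mu (psi k).
Proof.
move=> [Hpsi _ _] k; have [b ->] := H0_lincomb (Hpsi k).
exact: ess_bounded_lincomb.
Qed.

Lemma Bconst_ge0 : 0 <= Bconst w.
Proof.
have [psi onb] := onb_H0_exists; apply: lb_le_inf; first by eexists; exists psi.
move=> _ [phi /onb_ess_bounded bphi <-]; apply: sumr_ge0 => k _.
exact: (ess_bounded_normLoo (bphi k)).1.
Qed.

Lemma onb_near_Bconst e : 0 < e -> exists2 psi, onb_H0 w psi &
  \sum_(k < J) normLoo (psi k) < Bconst w + e.
Proof.
move=> e0; have [psi0 onb0] := onb_H0_exists.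
have hinf : has_inf [set \sum_(k < J) normLoo (psi k) | psi in onb_H0 w].
  split; first by eexists; exists psi0.
  exists 0 => _ [phi /onb_ess_bounded bphi <-]; apply: sumr_ge0 => k _.
  exact: (ess_bounded_normLoo (bphi k)).1.
by have [_ [psi onb <-] lt] := inf_adherent e0 hinf; exists psi.
Qed.

End centred_basis.

(** * Two-point bound and projection on an orthonormal system *)

Section two_points.
Variable R : realType.

(** Two weighted quadratic losses at distance y - x. The harmonic mean of the
    weights is bounded below by its tangent in the likelihood ratio, which
    makes the bound polynomial in the ratio. *)
Lemma two_point_bound (f g x y t : R) : 0 < f -> 0 < g ->
  (y - x) ^+ 2 * (2 * t * g - t ^+ 2 * (g + g ^+ 2 / f)) <=
  f * x ^+ 2 + g * y ^+ 2.
Proof.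
move=> f0 g0; have fg : 0 < f + g by rewrite addr_gt0.
have tangent : 2 * t * g - t ^+ 2 * (g + g ^+ 2 / f) <= f * g / (f + g).
  rewrite -subr_ge0.
  have -> : f * g / (f + g) - (2 * t * g - t ^+ 2 * (g + g ^+ 2 / f)) =
      g / (f * (f + g)) * (f - t * (f + g)) ^+ 2.
    by field; rewrite !gt_eqF.
  by rewrite mulr_ge0 ?sqr_ge0// divr_ge0 ?(ltW g0)// mulr_ge0 ?(ltW f0) ?(ltW fg).
apply: le_trans (_ : (y - x) ^+ 2 * (f * g / (f + g)) <= _).
  by rewrite ler_wpM2l ?sqr_ge0.
rewrite -subr_ge0.
have -> : f * x ^+ 2 + g * y ^+ 2 - (y - x) ^+ 2 * (f * g / (f + g)) =
    (f * x + g * y) ^+ 2 / (f + g) by field; rewrite gt_eqF.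
by rewrite divr_ge0 ?sqr_ge0// ltW.
Qed.

Lemma compound_le7 m : (0 < m)%N -> (1 + 6 / (7 * m%:R)) ^+ m <= 7 :> R.
Proof.
move=> m0; have mR : 0 < m%:R :> R by rewrite ltr0n.
apply: le_trans (_ : expR (6 / 7) <= _).
  have -> : 6 / 7 = m%:R * (6 / (7 * m%:R)) :> R by field; rewrite gt_eqF.
  rewrite expRM_natl; apply: lerXn2r; rewrite ?nnegrE ?expR_ge0 ?expR_ge1Dx//.
have h : 1 / 7 <= expR (- (6 / 7)) :> R.
  by apply: le_trans (expR_ge1Dx _); lra.
rewrite -[leLHS]invrK -expRN -[leRHS]invrK lef_pV2 ?posrE ?expR_gt0 ?invr_gt0//.
by move: h; rewrite div1r.
Qed.

End two_points.

Section projection.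
Context d (T : measurableType d) (R : realType) (mu : probability T R).
Variables (J : nat) (psi : 'I_J -> T -> R).
Hypothesis bpsi : forall k, ess_bounded mu (psi k).
Hypothesis opsi : forall k l, \int[mu]_p (psi k p * psi l p) = (k == l)%:R.

Let comb (c : 'I_J -> R) p := \sum_k c k * psi k p.

Let bcomb c : ess_bounded mu (comb c).
Proof.
by apply: ess_bounded_sum => k; apply: ess_boundedM => //; exact: ess_bounded_cst.
Qed.

Lemma onb_coef c k : (\int[mu]_p (psi k p * comb c p)%:E = (c k)%:E)%E.
Proof.
have bkl l : ess_bounded mu (fun p => psi k p * psi l p) by exact: ess_boundedM.
have [_ e] := integral_lin c (fun l => ess_bounded_integrable (bkl l))
  (fun l => ess_bounded_fin_num (bkl l)).
transitivity ((\sum_l c l * \int[mu]_p (psi k p * psi l p))%:E : \bar R).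
  rewrite -e; apply: eq_integral => p _; rewrite /comb mulr_sumr; congr EFin.
  by apply: eq_bigr => l _; rewrite mulrCA.
congr EFin; rewrite (bigD1 k)//= opsi eqxx mulr1 big1 ?addr0// => l lk.
by rewrite opsi eq_sym (negbTE lk) mulr0.
Qed.

Lemma onb_normE c : (\int[mu]_p (comb c p ^+ 2)%:E = (\sum_k c k ^+ 2)%:E)%E.
Proof.
have bk k : ess_bounded mu (fun p => psi k p * comb c p) by exact: ess_boundedM.
have [_ e] := integral_lin c (fun k => ess_bounded_integrable (bk k)) (onb_coef c).
under [in RHS]eq_bigr do rewrite expr2.
rewrite -e; apply: eq_integral => p _; rewrite expr2 {1}/comb mulr_suml.
by congr EFin; apply: eq_bigr => k _; rewrite mulrA.
Qed.

Section square_integrable.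
Variable h : T -> R.
Hypotheses (ih : mu.-integrable setT (EFin \o h))
  (ih2 : mu.-integrable setT (EFin \o (fun p => h p ^+ 2))).

Let a k := \int[mu]_p (h p * psi k p).

Lemma projection_expand c : (\int[mu]_p ((h p - comb c p) ^+ 2)%:E =
  (\int[mu]_p (h p ^+ 2) - 2 * \sum_k c k * a k + \sum_k c k ^+ 2)%:E)%E.
Proof.
have ihk k : mu.-integrable setT (EFin \o (fun p => h p * psi k p)).
  exact: integrable_ess_boundedM.
have ak k : (\int[mu]_p (h p * psi k p)%:E = (a k)%:E)%E.
  by rewrite /a /Rintegral fineK//; apply: integrable_fin_num => //; exact: ihk.
have [ihc ehc] := integral_lin c ihk ak.
have sqE p : ((h p - comb c p) ^+ 2)%:E =
   ((h p ^+ 2)%:E + (-2)%:E * (\sum_k c k * (h p * psi k p))%:E +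
    (comb c p ^+ 2)%:E)%E.
  have -> : \sum_k c k * (h p * psi k p) = h p * comb c p.
    by rewrite mulr_sumr; apply: eq_bigr => k _; rewrite mulrCA.
  by rewrite -EFinM -!EFinD; congr EFin; ring.
under eq_integral do rewrite sqE.
have i2 : mu.-integrable setT (fun p => ((-2)%:E *
    (\sum_k c k * (h p * psi k p))%:E)%E).
  by apply: integrableZl => //; exact: ihc.
rewrite integralD//=; last 2 first.
- by apply: integrableD => //; exact: ih2.
- by apply: ess_bounded_integrable; exact: ess_boundedX.
rewrite integralD//=.
rewrite integralZl// ehc onb_normE /Rintegral -[in LHS](fineK (integrable_fin_num _ ih2))//.
by rewrite -EFinM -!EFinD mulNr.
Qed.

(** Pythagoras for the projection on the span of the system. *)
Lemma bessel c : ((\sum_k (a k - c k) ^+ 2)%:E <=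
  \int[mu]_p ((h p - comb c p) ^+ 2)%:E)%E.
Proof.
have : (0 <= \int[mu]_p ((h p - comb a p) ^+ 2)%:E)%E.
  by apply: integral_ge0 => p _; rewrite lee_fin sqr_ge0.
rewrite !projection_expand !lee_fin.
have -> : \sum_k (a k - c k) ^+ 2 =
    \sum_k a k ^+ 2 - 2 * \sum_k c k * a k + \sum_k c k ^+ 2.
  rewrite mulr_sumr -sumrB -big_split /=; apply: eq_bigr => k _; ring.
under [X in _ - 2 * X + _]eq_bigr do rewrite -expr2.
lra.
Qed.

End square_integrable.

(** A function at finite distance of one member of the family is square
    integrable, and its coefficients serve all members at once. Otherwise all
    distances are infinite. *)
Lemma projection_coef (e : T -> R) (I : Type) (c : I -> 'I_J -> R) (b : R) :
  measurable_fun setT e -> exists a : 'I_J -> R, forall i,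
  ((\sum_k (a k - c i k) ^+ 2)%:E <=
   \int[mu]_p ((e p - (b + \sum_k c i k * psi k p)) ^+ 2)%:E)%E.
Proof.
move=> me; pose D i := (\int[mu]_p ((e p - (b + comb (c i) p)) ^+ 2)%:E)%E.
have [[i0 fin]|inf] := pselect (exists i, (D i < +oo)%E); last first.
  exists (fun=> 0) => i; have [Dy|Dy] := leP +oo%E (D i).
    by apply: le_trans Dy; rewrite leey.
  by exfalso; apply: inf; exists i.
pose g p := e p - (b + comb (c i0) p).
have bg : ess_bounded mu (fun p => b + comb (c i0) p).
  by apply: ess_boundedD => //; exact: ess_bounded_cst.
have mg : measurable_fun setT g by apply: measurable_funB => //; exact: bg.1.
have ig2 : mu.-integrable setT (EFin \o (fun p => g p ^+ 2)).
  apply/integrableP; split; first by apply/measurable_EFinP; exact: measurable_funX.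
  by under eq_integral do rewrite /= ger0_norm ?sqr_ge0//.
have ig : mu.-integrable setT (EFin \o g).
  apply: (@le_integrable _ _ _ mu setT measurableT _
    (fun p => ((1 : R)%:E + (g p ^+ 2)%:E)%E)).
  - exact/measurable_EFinP.
  - move=> p _; rewrite /= lee_fin [leRHS]ger0_norm ?addr_ge0 ?sqr_ge0//.
    by rewrite ler_norml; apply/andP; split; nra.
  - by apply: integrableD => //; exact: finite_measure_integrable_cst.
pose h p := e p - b.
have hE p : h p = g p + comb (c i0) p by rewrite /h /g; ring.
have ih : mu.-integrable setT (EFin \o h).
  have -> : EFin \o h = (fun p => (g p)%:E + (comb (c i0) p)%:E)%E.
    by apply/funext => p; rewrite /= hE EFinD.
  by apply: integrableD => //; exact: ess_bounded_integrable.
have ih2 : mu.-integrable setT (EFin \o (fun p => h p ^+ 2)).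
  have -> : EFin \o (fun p => h p ^+ 2) = (fun p => (g p ^+ 2)%:E +
      (2%:E * (g p * comb (c i0) p)%:E + (comb (c i0) p ^+ 2)%:E))%E.
    apply/funext => p /=; rewrite hE.
    rewrite (_ : (g p + comb (c i0) p) ^+ 2 = g p ^+ 2 +
      (2 * (g p * comb (c i0) p) + comb (c i0) p ^+ 2)); last by ring.
    by rewrite !EFinD EFinM.
  apply: integrableD => //; apply: integrableD => //.
    by apply: integrableZl => //; exact: integrable_ess_boundedM.
  by apply: ess_bounded_integrable; exact: ess_boundedX.
exists (fun k => \int[mu]_p (h p * psi k p)) => i.
apply: le_trans (bessel ih ih2 (c i)) _; rewrite le_eqVlt; apply/orP; left.
by apply/eqP; apply: eq_integral => p _; rewrite /h /comb opprD addrA.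
Qed.

End projection.

(** * Minimax lower bound over a hypercube *)

Section hypercube.
Variables (R : realType) (J m : nat).
Local Notation mu := (usquare R).
Local Notation cube := {ffun 'I_J -> bool}.
Local Notation data := (m.-tuple (plane R * bool)).
Variables (psi : 'I_J -> plane R -> R) (delta : R).
Hypothesis m_gt0 : (0 < m)%N.
Hypothesis bpsi : forall k, ess_bounded mu (psi k).
Hypothesis opsi : forall k l, \int[mu]_p (psi k p * psi l p) = (k == l)%:R.
Hypothesis delta2 : delta ^+ 2 = 3 / (128 * m%:R).
Hypothesis psi_small : `|delta| * (\sum_(k < J) normLoo (psi k)) <= 3 / 8.
Implicit Types (v : cube) (D : data).

Let mR : 0 < m%:R :> R. Proof. by rewrite ltr0n. Qed.

Definition sgnb (b : bool) : R := if b then 1 else -1.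

Definition flip k v : cube := [ffun i => if i == k then ~~ v i else v i].

Lemma flipK k : involutive (flip k).
Proof.
by move=> v; apply/ffunP => i; rewrite !ffunE; case: eqP => // _; rewrite negbK.
Qed.

Definition vertex_coef v k : R := delta * sgnb (v k).

(** The hypotheses of the hypercube, placed around the constant graphon 1/2. *)
Definition vertex v p : R := 1 / 2 + \sum_k vertex_coef v k * psi k p.

Lemma vertex_ess_bounded v : ess_bounded mu (vertex v).
Proof.
apply: ess_boundedD; first exact: ess_bounded_cst.
by apply: ess_bounded_sum => k; apply: ess_boundedM => //; exact: ess_bounded_cst.
Qed.

Definition vertex_mfun v : {mfun plane R >-> R} :=
  HB.pack (vertex v) (isMeasurableFun.Build _ _ _ _ _ (vertex_ess_bounded v).1).

Lemma vertex_ae v : {ae mu, forall p, 1 / 8 <= vertex v p <= 7 / 8}.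
Proof.
have h : {ae mu, forall p, forall k, `|psi k p| <= normLoo (psi k)}.
  have hk k : {ae mu, forall p, `|psi k p| <= normLoo (psi k)}.
    exact: (ess_bounded_normLoo (bpsi k)).2.
  by move: hk => /filter_forall.
move: h; apply: ae_imply => p h.
have : `|vertex v p - 1 / 2| <= 3 / 8.
  rewrite /vertex addrC addKr; apply: le_trans (ler_norm_sum _ _ _) _.
  apply: le_trans psi_small; rewrite mulr_sumr; apply: ler_sum => k _.
  rewrite normrM /vertex_coef normrM (_ : `|sgnb _| = 1) ?mulr1 ?ler_wpM2l//.
  by rewrite /sgnb; case: (v k); rewrite ?normrN normr1.
by rewrite ler_norml => /andP[h1 h2]; apply/andP; split; lra.
Qed.

(** A version of the vertex with values in [1/8, 7/8] everywhere, so that all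
    densities are positive. *)
Definition vertex_clip v p : R := Num.min (Num.max (vertex v p) (1 / 8)) (7 / 8).
Local Notation rho := vertex_clip.

Lemma vertex_clip_bounds v p : 1 / 8 <= rho v p <= 7 / 8.
Proof.
rewrite /rho le_min le_max ge_min !lexx !orbT /= andbT; lra.
Qed.

Let rho01 v p : 0 <= rho v p <= 1.
Proof. by have /andP[h1 h2] := vertex_clip_bounds v p; apply/andP; split; lra. Qed.

Let mrho v : measurable_fun setT (rho v).
Proof.
apply: measurable_minr => //; apply: measurable_maxr => //.
exact: (vertex_ess_bounded v).1.
Qed.

Let rho_ae v : {ae mu, forall p, vertex_mfun v p = rho v p}.
Proof.
have := vertex_ae v; apply: ae_imply => p /andP[h1 h2].
by rewrite /rho (max_idPl h1) (min_idPl h2).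
Qed.

Definition half : {mfun plane R >-> R} := cst (1 / 2).

Let half01 (p : plane R) : 0 <= cst (1 / 2 : R) p <= 1.
Proof. by apply/andP; split; rewrite /=; lra. Qed.

Let half_ae : {ae mu, forall p, half p = cst (1 / 2 : R) p}.
Proof. exact: nearW. Qed.

Let ge0_integral_half := @ge0_integral_dyad R half (cst (1 / 2 : R))
  (measurable_cst _) half01 half_ae.

(** Density of the law of a dyad at a vertex with respect to fair coins. *)
Definition density v (z : plane R * bool) : R :=
  2 * (if z.2 then rho v z.1 else 1 - rho v z.1).

Let density_bounds v z : 1 / 4 <= density v z <= 7 / 4.
Proof.
have /andP[h1 h2] := vertex_clip_bounds v z.1.
by rewrite /density; case: z.2; apply/andP; split; lra.
Qed.

Let density_gt0 v z : 0 < density v z.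
Proof. by have /andP[h _] := density_bounds v z; lra. Qed.

Let measurable_density v : measurable_fun setT (density v).
Proof.
have m1 : measurable_fun setT (fun z : plane R * bool => rho v z.1).
  exact: (measurableT_comp (mrho v) (@measurable_fst _ _ _ _)).
have m2 : measurable_fun setT (fun z : plane R * bool => 1 - rho v z.1).
  exact: measurable_funB.
apply: measurable_funM => //; apply: measurable_fun_if => //.
- exact: (measurable_funTS m1).
- exact: (measurable_funTS m2).
Qed.

Lemma density_change v (g : plane R * bool -> \bar R) :
  measurable_fun setT g -> (forall z, 0 <= g z)%E ->
  (\int[dyad_law (vertex_mfun v)]_z g z =
   \int[dyad_law half]_z ((density v z)%:E * g z))%E.
Proof.
move=> mg g0.
rewrite (ge0_integral_dyad (mrho v) (rho01 v) (rho_ae v))//.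
rewrite ge0_integral_half//; last 2 first.
- by apply: emeasurable_funM => //; exact/measurable_EFinP.
- by move=> z; rewrite mule_ge0// lee_fin ltW.
apply: eq_integral => p _; rewrite !muleA -!EFinM /density /=.
by congr (_%:E * _ + _%:E * _)%E; field.
Qed.

Lemma density_total v : (\int[dyad_law half]_z (density v z)%:E = 1)%E.
Proof.
have := @density_change v (cst 1%E) (measurable_cst _) (fun=> lee01).
under [in RHS]eq_integral do rewrite mule1.
by move=> <-; exact: integral_prob_cst.
Qed.

Definition ratio v v' z : R := density v' z ^+ 2 / density v z.

Let ratio_ge0 v v' z : 0 <= ratio v v' z.
Proof. by rewrite divr_ge0 ?sqr_ge0// ltW. Qed.

Let measurable_ratio v v' : measurable_fun setT (ratio v v').
Proof.
apply: measurable_funM; first exact: measurable_funX.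
exact: measurable_invr.
Qed.

(** Neighbours differ by 2 delta in one coefficient. *)
Lemma vertex_flip_dist v k :
  (\int[mu]_p ((rho (flip k v) p - rho v p) ^+ 2)%:E = (4 * delta ^+ 2)%:E)%E.
Proof.
pose c l := vertex_coef (flip k v) l - vertex_coef v l.
transitivity (\int[mu]_p ((\sum_l c l * psi l p) ^+ 2)%:E)%E.
  apply: ae_eq_integral => //.
  - by apply/measurable_EFinP; apply: measurable_funX; exact: measurable_funB.
  - apply/measurable_EFinP; apply: measurable_funX; apply: measurable_sum => l.
    by apply: measurable_funM => //; exact: (bpsi l).1.
  - have h1 := rho_ae v; have h2 := rho_ae (flip k v).
    move: h1 h2; apply: ae_imply2 => p <- <- _; congr ((_ ^+ 2)%:E).
    rewrite /= /vertex opprD addrACA subrr add0r -sumrB.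
    by apply: eq_bigr => l _; rewrite mulrBl.
rewrite (onb_normE bpsi opsi); congr EFin.
rewrite (bigD1 k)//= big1 ?addr0 => [|l lk].
  rewrite /c /vertex_coef ffunE eqxx /sgnb; case: (v k) => /=; ring.
by rewrite /c /vertex_coef ffunE (negbTE lk) subrr expr0n.
Qed.

Lemma ratio_flip v k : (\int[dyad_law half]_z (ratio v (flip k v) z)%:E <=
  (1 + 6 / (7 * m%:R))%:E)%E.
Proof.
rewrite ge0_integral_half; last 2 first.
- exact/measurable_EFinP.
- by move=> z; rewrite lee_fin.
apply: (@le_trans _ _ (\int[mu]_p (1 +
    (64 / 7)%:E * ((rho (flip k v) p - rho v p) ^+ 2)%:E))%E).
  apply: ge0_le_integralT => p.
    by rewrite -!EFinM -EFinD lee_fin addr_ge0// mulr_ge0//=; lra.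
  rewrite -!EFinM -!EFinD lee_fin /ratio /density /=.
  have /andP[a1 a2] := vertex_clip_bounds v p.
  set x := rho v p in a1 a2 *; set y := rho (flip k v) p.
  have -> : 1 / 2 * ((2 * y) ^+ 2 / (2 * x)) +
      (1 - 1 / 2) * ((2 * (1 - y)) ^+ 2 / (2 * (1 - x))) =
      1 + (x * (1 - x))^-1 * (y - x) ^+ 2.
    field; apply/andP; split; apply/eqP; lra.
  rewrite lerD2l ler_wpM2r ?sqr_ge0//.
  rewrite (_ : 64 / 7 = (7 / 64)^-1); last by rewrite invf_div.
  rewrite lef_pV2 ?posrE; nra.
rewrite ge0_integralD//; last 2 first.
- by move=> p _; rewrite -EFinM lee_fin mulr_ge0// sqr_ge0.
- apply: emeasurable_funM => //; apply/measurable_EFinP; apply: measurable_funX.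
  exact: measurable_funB.
rewrite integral_prob_cst ge0_integralZl//; last 2 first.
- by apply/measurable_EFinP; apply: measurable_funX; exact: measurable_funB.
- by move=> p _; rewrite lee_fin sqr_ge0.
rewrite vertex_flip_dist -EFinM -EFinD lee_fin lerD2l delta2.
by rewrite le_eqVlt; apply/orP; left; apply/eqP; field; rewrite gt_eqF.
Qed.

Local Notation P0 := (iid_law (dyad_law half) m).

Definition likelihood v D : R := \prod_(s < m) density v (tnth D s).

Let likelihood_gt0 v D : 0 < likelihood v D.
Proof. by apply: prodr_gt0 => s _. Qed.

Let measurable_likelihood v : measurable_fun setT (likelihood v).
Proof. exact: measurable_prod_tnth. Qed.

Lemma likelihood_change v (g : data -> \bar R) :
  measurable_fun setT g -> (forall D, 0 <= g D)%E ->
  (\int[data_law m (vertex_mfun v)]_D g D =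
   \int[P0]_D ((likelihood v D)%:E * g D))%E.
Proof.
move=> mg g0; apply: ge0_integral_iid_density => //.
- by move=> z; exact: ltW.
- by move=> h mh h0; exact: density_change.
Qed.

Lemma likelihood_total v : (\int[P0]_D (likelihood v D)%:E = 1%:E)%E.
Proof.
rewrite (@ge0_integral_iid_prod _ _ _ _ m (density v) 1) ?expr1n//.
- by move=> z; exact: ltW.
- exact: density_total.
Qed.

Definition likelihood_ratio v v' D : R := likelihood v' D ^+ 2 / likelihood v D.

Lemma likelihood_ratio_prod v v' D :
  likelihood_ratio v v' D = \prod_(s < m) ratio v v' (tnth D s).
Proof. by rewrite /likelihood_ratio /ratio prodf_div prodrXl. Qed.

(** The chi-square divergence is multiplicative over the draws. *)
Lemma likelihood_ratio_flip v k : exists2 a, a <= 7 &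
  (\int[P0]_D (likelihood_ratio v (flip k v) D)%:E = a%:E)%E.
Proof.
have := ratio_flip v k; set I := (\int[_]_z _)%E => I_le.
have I0 : (0 <= I)%E by apply: integral_ge0 => z _; rewrite lee_fin.
have If : I = (fine I)%:E.
  by rewrite fineK// ge0_fin_numE//; exact: le_lt_trans I_le (ltry _).
exists (fine I ^+ m).
  apply: le_trans (compound_le7 R m_gt0); apply: lerXn2r.
  - by rewrite nnegrE fine_ge0.
  - by rewrite nnegrE addr_ge0// divr_ge0// mulr_ge0// ltW.
  - by rewrite -lee_fin -If.
under eq_integral do rewrite likelihood_ratio_prod.
exact: ge0_integral_iid_prod.
Qed.

Section estimator.
Variable est : {mfun (data * plane R)%type >-> R}.

Let loss v D : \bar R := (\int[mu]_p ((est (D, p) - vertex v p) ^+ 2)%:E)%E.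

Let loss_ge0 v D : (0 <= loss v D)%E.
Proof. by apply: integral_ge0 => p _; rewrite lee_fin sqr_ge0. Qed.

Let measurable_loss v : measurable_fun setT (loss v).
Proof.
apply: (measurable_fun_fubini_tonelli_F
  (fun z : data * plane R => ((est z - vertex v z.2) ^+ 2)%:E)) => /=.
- apply/measurable_EFinP; apply: measurable_funX; apply: measurable_funB => //.
  exact: (measurableT_comp (vertex_ess_bounded v).1 (@measurable_snd _ _ _ _)).
- by move=> z; rewrite lee_fin sqr_ge0.
Qed.

Lemma vertex_risk v : (risk (fun D p => est (D, p)) (vertex_mfun v) =
  \int[P0]_D ((likelihood v D)%:E * loss v D))%E.
Proof.
rewrite /risk -likelihood_change//.
by apply: eq_integral => D _; rewrite sqr_normL2.
Qed.

(** Averaging over the edges of the hypercube in one direction pairs each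
    vertex with its neighbour, and each pair is a two-point problem. *)
Lemma cube_loss_ge D (t : R) :
  ((2 * delta ^+ 2 * (2 * t) * \sum_(e : cube * 'I_J) likelihood (flip e.2 e.1) D)%:E
   <= \sum_v (likelihood v D)%:E * loss v D +
   (2 * delta ^+ 2 * t ^+ 2 * \sum_(e : cube * 'I_J)
      (likelihood (flip e.2 e.1) D + likelihood_ratio e.1 (flip e.2 e.1) D))%:E)%E.
Proof.
have mest : measurable_fun setT (fun p : plane R => est (D, p)).
  by apply: measurableT_comp => //; exact: pair1_measurable.
have [a ha] := projection_coef bpsi opsi vertex_coef (1 / 2) mest.
pose x (e : cube * 'I_J) := a e.2 - vertex_coef e.1 e.2.
apply: (@le_trans _ _ ((\sum_(e : cube * 'I_J) likelihood e.1 D * x e ^+ 2)%:E +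
   (2 * delta ^+ 2 * t ^+ 2 * \sum_(e : cube * 'I_J)
      (likelihood (flip e.2 e.1) D + likelihood_ratio e.1 (flip e.2 e.1) D))%:E)%E);
    last first.
  apply: leeD2r; rewrite -(pair_big xpredT xpredT
    (fun v k => likelihood v D * x (v, k) ^+ 2))/= -sumEFin.
  apply: lee_sum => v _; rewrite -mulr_sumr EFinM.
  by apply: lee_wpmul2l; [rewrite lee_fin ltW|exact: ha].
pose sw (e : cube * 'I_J) : cube * 'I_J := (flip e.2 e.1, e.2).
have swK : involutive sw by move=> -[v k]; rewrite /sw /= flipK.
have swE : \sum_e likelihood e.1 D * x e ^+ 2 =
    \sum_e likelihood (flip e.2 e.1) D * x (sw e) ^+ 2.
  by rewrite (reindex_inj (inv_inj swK)).
have edge e : 4 * delta ^+ 2 * (2 * t * likelihood (flip e.2 e.1) D -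
      t ^+ 2 * (likelihood (flip e.2 e.1) D +
                likelihood_ratio e.1 (flip e.2 e.1) D)) <=
    likelihood e.1 D * x e ^+ 2 + likelihood (flip e.2 e.1) D * x (sw e) ^+ 2.
  have := two_point_bound (x e) (x (sw e)) t (likelihood_gt0 e.1 D)
    (likelihood_gt0 (flip e.2 e.1) D).
  have -> : (x (sw e) - x e) ^+ 2 = 4 * delta ^+ 2.
    rewrite /x /sw /= /vertex_coef ffunE eqxx /sgnb.
    by case: (e.1 e.2) => /=; ring.
  by [].
rewrite -EFinD lee_fin -subr_ge0.
have : \sum_(e : cube * 'I_J) (4 * delta ^+ 2 *
     (2 * t * likelihood (flip e.2 e.1) D -
      t ^+ 2 * (likelihood (flip e.2 e.1) D +
                likelihood_ratio e.1 (flip e.2 e.1) D))) <=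
   2 * \sum_(e : cube * 'I_J) likelihood e.1 D * x e ^+ 2.
  rewrite [leRHS](_ : _ = \sum_e likelihood e.1 D * x e ^+ 2 +
    \sum_e likelihood (flip e.2 e.1) D * x (sw e) ^+ 2); last first.
    by rewrite -swE; ring.
  rewrite -big_split /=; by apply: ler_sum => e _; exact: edge.
rewrite -mulr_sumr sumrB -!mulr_sumr.
set S := \sum_e _ * x e ^+ 2; set U := \sum_e _; set V := \sum_e _.
nra.
Qed.

Lemma cube_risk_ge :
  ((#|{: cube}|%:R * (J%:R * delta ^+ 2 / 4))%:E <=
   \sum_v risk (fun D p => est (D, p)) (vertex_mfun v))%E.
Proof.
(* the optimal tangent point 1 / (1 + K) for chi-square divergences K <= 7 *)
pose t : R := 1 / 8.
have d0 : 0 <= delta ^+ 2 := sqr_ge0 _.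
have c0 : 0 <= 2 * delta ^+ 2 * (2 * t) by rewrite /t; lra.
pose card : R := #|{: cube * 'I_J}|%:R.
have cardE : card = #|{: cube}|%:R * J%:R.
  by rewrite /card card_prod card_ord natrM.
have fin_int (g : data -> R) (c : R) : measurable_fun setT g ->
    (forall D, 0 <= g D) -> (\int[P0]_D (g D)%:E = c%:E)%E ->
    P0.-integrable setT (EFin \o g).
  move=> mg g0 gc; apply/integrableP; split; first exact/measurable_EFinP.
  by under eq_integral do rewrite gee0_abs ?lee_fin//; rewrite gc ltry.
have mratio v v' : measurable_fun setT (likelihood_ratio v v').
  apply: measurable_funM; first exact: measurable_funX.
  exact: measurable_invr.
have ratio0 v v' D : 0 <= likelihood_ratio v v' D.
  by rewrite divr_ge0 ?sqr_ge0// ltW.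
have [a a7 ha] : exists2 a : cube * 'I_J -> R, (forall e, a e <= 7) &
    forall e, (\int[P0]_D (likelihood_ratio e.1 (flip e.2 e.1) D)%:E = (a e)%:E)%E.
  have [f hf] := choice (fun e : cube * 'I_J =>
    let: ex_intro2 a h1 h2 := likelihood_ratio_flip e.1 e.2 in
    ex_intro (fun a => a <= 7 /\ (\int[P0]_D (likelihood_ratio e.1 (flip e.2 e.1) D)%:E = a%:E)%E) a (conj h1 h2)).
  by exists f => e; have [] := hf e.
have [_ e1] := integral_lin (fun=> 2 * delta ^+ 2 * (2 * t))
  (fun e : cube * 'I_J => fin_int _ _ (measurable_likelihood (flip e.2 e.1))
     (fun D => ltW (likelihood_gt0 (flip e.2 e.1) D))
     (likelihood_total (flip e.2 e.1)))
  (fun e => likelihood_total (flip e.2 e.1)).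
have mlr e : measurable_fun setT (fun D => likelihood (flip e.2 e.1) D +
    likelihood_ratio e.1 (flip e.2 e.1) D) by exact: measurable_funD.
have lr0 (e : cube * 'I_J) D : 0 <= likelihood (flip e.2 e.1) D +
    likelihood_ratio e.1 (flip e.2 e.1) D by rewrite addr_ge0// ltW.
have ilr e : (\int[P0]_D (likelihood (flip e.2 e.1) D +
    likelihood_ratio e.1 (flip e.2 e.1) D)%:E = (1 + a e)%:E)%E.
  under eq_integral do rewrite EFinD.
  rewrite ge0_integralD//; last 4 first.
  - by move=> D _; rewrite lee_fin ltW.
  - exact/measurable_EFinP.
  - by move=> D _; rewrite lee_fin.
  - exact/measurable_EFinP.
  by rewrite likelihood_total ha.
have [_ e2] := integral_lin (fun=> 2 * delta ^+ 2 * t ^+ 2)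
  (fun e : cube * 'I_J => fin_int _ _ (mlr e) (lr0 e) (ilr e)) ilr.
have mrhs : measurable_fun setT
    (fun D => \sum_v (likelihood v D)%:E * loss v D)%E.
  apply: emeasurable_sum => v; apply: emeasurable_funM => //.
  exact/measurable_EFinP.
have main : ((2 * delta ^+ 2 * (2 * t) * card)%:E <=
    \sum_v risk (fun D p => est (D, p)) (vertex_mfun v) +
    (2 * delta ^+ 2 * t ^+ 2 * \sum_e (1 + a e))%:E)%E.
  have -> : 2 * delta ^+ 2 * (2 * t) * card =
      \sum_(e : cube * 'I_J) 2 * delta ^+ 2 * (2 * t) * 1.
    by rewrite sumr_const mulr1 /card [LHS]mulr_natr.
  rewrite -e1 mulr_sumr -e2.
  under eq_bigr do rewrite vertex_risk.
  rewrite -ge0_integral_sum//; last 2 first.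
  - by move=> v; apply: emeasurable_funM => //; exact/measurable_EFinP.
  - by move=> v D _; rewrite mule_ge0// lee_fin ltW.
  rewrite -ge0_integralD//; last 3 first.
  - by move=> D _; apply: sume_ge0 => v _; rewrite mule_ge0// lee_fin ltW.
  - move=> D _; rewrite lee_fin; apply: sumr_ge0 => e _.
    by rewrite mulr_ge0// mulr_ge0 ?sqr_ge0// mulr_ge0.
  - apply/measurable_EFinP; apply: measurable_sum => e.
    exact: measurable_funM.
  apply: ge0_le_integralT => D.
    rewrite lee_fin; apply: sumr_ge0 => e _.
    by apply: mulr_ge0 => //; exact: ltW.
  by rewrite -!mulr_sumr; exact: cube_loss_ge.
have a_le : \sum_(e : cube * 'I_J) (1 + a e) <= card * 8.
  apply: le_trans (_ : \sum_(e : cube * 'I_J) 8 <= _).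
    by apply: ler_sum => e _; have := a7 e; lra.
  by rewrite sumr_const -[X in X <= _]mulr_natl.
move: main; rewrite addeC -leeBlDl// -EFinB; apply: le_trans.
rewrite lee_fin mulrA mulrA -cardE /t.
have := ler_wpM2l d0 a_le; lra.
Qed.

End estimator.

End hypercube.

(** * Truths in the span of the agents, and the minimax bounds *)

Section minimax.
Variables (R : realType) (J : nat) (w : 'I_J -> {mfun plane R >-> R}).
Hypotheses (w_graphon : forall j, graphon (w j)) (w_indep : lin_indep_L2 w).
Variable m : nat.
Hypothesis m_ge1 : (1 <= m)%N.
Local Notation mu := (usquare R).
Local Notation G := (gram w).
Local Notation data := (m.-tuple (plane R * bool)).

Let pG : posdef G := posdef_gram w_graphon w_indep.
Let mR : 0 < m%:R :> R. Proof. by rewrite ltr0n. Qed.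

Section upper.
Variables nu tau : R.
Hypotheses (nu_gt0 : 0 < nu) (tau_gt0 : 0 < tau).
Local Notation lambda := (lambda_min G).
Local Notation tail := (J.+1%:R * expR (- (m%:R / (7 * Lconst w)))).

Lemma beta_circ_lincomb (u : {mfun plane R >-> R}) b :
  u = lincomb w b :> (plane R -> R) -> beta_circ w u = b.
Proof.
move=> ub; rewrite /beta_circ (_ : \col_i _ = G *m b) ?mulKmx ?posdef_unit//.
apply/matrixP => i j; rewrite ord1 mxE -(gram_mul w_graphon).
by apply: eq_Rintegral => p _; rewrite ub.
Qed.

(** The residual vanishes for a truth in the span, a Bernoulli variance is at
    most 1/4, and the leverage integrates to d. *)
Lemma cconst_lincomb (u : {mfun plane R >-> R}) b :
  u = lincomb w b :> (plane R -> R) -> {ae mu, forall p, 0 <= u p <= 1} ->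
  cconst w u <= J.+1%:R / 4.
Proof.
move=> ub u01; have [B uB GE] := cholesky pG.
have bl := ess_bounded_leverage w_graphon w_indep.
have bu := mfun_ess_bounded u01.
have bwo : ess_bounded mu (w_circ w u) := ess_bounded_lincomb w_graphon _.
have bs : ess_bounded mu (fun p => sigma2 w u p * leverage w p).
  apply: ess_boundedM => //; apply: ess_boundedD.
    apply: ess_boundedM => //; apply: ess_boundedB => //; exact: ess_bounded_cst.
  by apply: ess_boundedX; exact: ess_boundedB.
have s_le : {ae mu, forall p, 0 <= sigma2 w u p <= 1 / 4}.
  move: u01; apply: ae_imply => p /andP[u0 u1].
  rewrite /sigma2 /w_circ (beta_circ_lincomb ub) -ub subrr expr0n /= addr0.
  rewrite mulr_ge0 ?subr_ge0//=; have := sqr_ge0 (u p - 1 / 2).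
  by rewrite -subr_ge0 => h; rewrite -subr_ge0; move: h; nra.
rewrite -lee_fin /cconst -ess_bounded_fin_num//.
have -> : (J.+1%:R / 4)%:E = ((1 / 4 : R)%:E * \int[mu]_p (leverage w p)%:E)%E.
  by rewrite (integral_leverage w_graphon uB GE) -EFinM; congr EFin; ring.
rewrite -integralZl//; last exact: ess_bounded_integrable.
have b4 : ess_bounded mu (fun p => 1 / 4 * leverage w p).
  by apply: ess_boundedM => //; exact: ess_bounded_cst.
rewrite (ess_bounded_fin_num bs); under eq_integral do rewrite -EFinM.
rewrite (ess_bounded_fin_num b4) lee_fin -subr_ge0 -RintegralB//; last 2 first.
- exact: ess_bounded_integrable.
- exact: ess_bounded_integrable.
have bd := ess_boundedB b4 bs.
rewrite -lee_fin -(ess_bounded_fin_num bd).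
rewrite (_ : (\int[mu]_p _)%E = (\int[mu]_p `|(1 / 4 * leverage w p -
   sigma2 w u p * leverage w p)%:E|)%E); first exact: integral_ge0.
apply: ae_eq_integral => //.
- by apply/measurable_EFinP; exact: bd.1.
- by apply: measurableT_comp => //; apply/measurable_EFinP; exact: bd.1.
- move: s_le; apply: ae_imply => p /andP[_ s4] _.
  by rewrite gee0_abs// lee_fin -mulrBl mulr_ge0 ?subr_ge0 ?leverage_ge0.
Qed.

(** The coefficients of a graphon in the span satisfy |b|^2 <= 1 / lambda. *)
Lemma max_risk_upper_bound :
  (max_risk w (fun D : data => w_hat_plus w nu tau D) <=
   (2 * J.+1%:R / m%:R +
    8 * nu ^+ 2 / (m%:R ^+ 2 * tau ^+ 4 * lambda ^+ 2) + tail)%:E)%E.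
Proof.
apply: ge_ereal_sup => _ [u [[b _ ub] u01] <-].
have {}ub : u = lincomb w b :> (plane R -> R) by [].
apply: le_trans (risk_upper_bound w_graphon w_indep u01 m_ge1 nu_gt0 tau_gt0) _.
have [lam0 lamG] := lambda_minP pG.
have bE := beta_circ_lincomb ub.
rewrite sqr_normL2 integral0_eq => [|p _]; last first.
  by rewrite /w_circ bE -ub subrr expr0n.
rewrite add0e lee_fin lerD2r; apply: lerD.
  have := cconst_lincomb ub u01.
  by move=> c4; rewrite ler_pM2r ?invr_gt0//; lra.
have norm_b : \sum_i b i 0 ^+ 2 <= lambda^-1.
  rewrite -[leRHS]mul1r ler_pdivlMr// mulrC -dotvv; apply: le_trans (lamG b) _.
  rewrite -lee_fin -(gram_qform w_graphon) -[leRHS](integral_prob_cst mu).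
  have bb := ess_bounded_lincomb w_graphon b.
  apply: ae_ge0_le_integral => //.
  - by move=> p _; rewrite lee_fin sqr_ge0.
  - by apply/measurable_EFinP; apply: measurable_funX; exact: bb.1.
  - move: u01; rewrite ub; apply: ae_imply => p /andP[u0 u1] _.
    by rewrite lee_fin expr_le1.
rewrite bE ler_pdivrMr//.
have -> : 8 * nu ^+ 2 / (m%:R ^+ 2 * tau ^+ 4 * lambda ^+ 2) * lambda =
    8 * kappa m nu tau ^+ 2 * lambda^-1.
  by rewrite /kappa; field; rewrite !gt_eqF.
by rewrite ler_wpM2l// mulr_ge0 ?sqr_ge0.
Qed.

Lemma measurable_beta_hat :
  measurable_mx (fun D : data => beta_hat w nu tau D).
Proof.
have mF s : measurable_mx (fun D : data => feat w (tnth D s).1).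
  apply: (measurable_mx_comp (measurable_feat w_graphon)).
  apply: (measurableT_comp (@measurable_fst _ _ _ _)); exact: measurable_tnth.
apply: measurable_mxM.
  apply: measurable_invmx.
    by move=> D; exact: posdef_unit (posdef_ridge w m_ge1 nu_gt0 tau_gt0 D).
  apply: measurable_mxD; last exact: measurable_mx_cst.
  apply: measurable_mxZ => //; apply: measurable_mx_sum => s.
  by apply: measurable_mxM => //; exact: measurable_mxT.
apply: measurable_mxZ => //; apply: measurable_mx_sum => s.
apply: measurable_mxZ => //.
have mY : measurable_fun setT (fun z : plane R * bool => (z.2%:R : R)).
  have -> : (fun z : plane R * bool => (z.2%:R : R)) =
      (fun z => if z.2 then 1 else 0) by apply/funext => -[p []].
  by apply: measurable_fun_if.
exact: (measurableT_comp mY (@measurable_tnth _ _ _ _)).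
Qed.

Lemma minimax_le_ridge :
  (minimax_risk w m <= max_risk w (fun D : data => w_hat_plus w nu tau D))%E.
Proof.
pose f (z : data * plane R) := w_hat_plus w nu tau z.1 z.2.
have mf : measurable_fun setT f.
  apply: measurable_minr => //; apply: measurable_maxr => //.
  have mb : measurable_mx (fun z : data * plane R => beta_hat w nu tau z.1).
    exact: (measurable_mx_comp measurable_beta_hat (@measurable_fst _ _ _ _)).
  have mF : measurable_mx (fun z : data * plane R => feat w z.2).
    exact: (measurable_mx_comp (measurable_feat w_graphon) (@measurable_snd _ _ _ _)).
  exact: (measurable_mxM (measurable_mxT mb) mF 0 0).
pose est : {mfun (data * plane R)%type >-> R} :=
  HB.pack f (isMeasurableFun.Build _ _ _ _ f mf).
by apply: ereal_inf_lbound; exists est.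
Qed.

End upper.

Lemma minimax_lower_bound : 3 * Bconst w ^+ 2 / 8 <= m%:R ->
  ((3 * J%:R / (512 * m%:R))%:E <= minimax_risk w m)%E.
Proof.
move=> mB; pose delta : R := Num.sqrt (3 / (128 * m%:R)).
have q0 : 0 < 3 / (128 * m%:R) :> R by rewrite divr_gt0// mulr_gt0.
have d0 : 0 < delta by rewrite sqrtr_gt0.
have d2 : delta ^+ 2 = 3 / (128 * m%:R) by rewrite sqr_sqrtr// ltW.
have e0 : 0 < (8 * delta)^-1 by rewrite invr_gt0 mulr_gt0.
have [psi onb small] := onb_near_Bconst w_graphon w_indep e0.
have bpsi := onb_ess_bounded w_graphon onb.
have [Hpsi opsi _] := onb.
have B0 := Bconst_ge0 w_graphon w_indep.
(* the condition on m leaves 3/8 - 1/4 for the basis not to attain B *)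
have dB : delta * Bconst w <= 1 / 4.
  have : (delta * Bconst w) ^+ 2 <= (1 / 4) ^+ 2.
    rewrite exprMn d2 mulrAC ler_pdivrMr ?mulr_gt0//; lra.
  by rewrite ler_pXn2r// nnegrE ?mulr_ge0// ltW.
have psi_small : `|delta| * (\sum_(k < J) normLoo (psi k)) <= 3 / 8.
  rewrite gtr0_norm//; apply: le_trans (_ : delta * (Bconst w + (8 * delta)^-1) <= _).
    by rewrite ler_pM2l// ltW.
  rewrite mulrDr (_ : delta * (8 * delta)^-1 = 1 / 8); first lra.
  by field; rewrite gt_eqF.
apply: le_ereal_inf_tmp => _ [est _ <-].
set M := max_risk _ _.
have risk_le v : (risk (fun D p => est (D, p)) (vertex_mfun delta bpsi v) <= M)%E.
  apply: ereal_sup_ubound; exists (vertex_mfun delta bpsi v) => //; split.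
    have [b hb] := choice (fun k => H0_lincomb (Hpsi k)).
    exists ((1 / 2) *: delta_mx ord0 0 +
      \sum_k vertex_coef delta v k *: b k) => //.
    apply/funext => p; rewrite lincombE dotvDl dotvZl /=.
    rewrite /vertex; congr (_ + _).
      rewrite dotvE (bigD1 ord0)//= mxE !eqxx mul1r feat0 big1 ?addr0 ?mulr1// => i i0.
      by rewrite mxE (negbTE i0) mul0r.
    rewrite /dotv linear_sum mulmx_suml summxE; apply: eq_bigr => k _.
    by rewrite hb linearZ /= -scalemxAl mxE.
  have := vertex_ae bpsi psi_small v; apply: ae_imply => p /andP[h1 h2].
  by apply/andP; split; rewrite /=; lra.
have := cube_risk_ge m_ge1 bpsi opsi d2 psi_small est.
move=> /le_trans/(_ (lee_sum _ (fun v _ => risk_le v))).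
have N0 : 0 < #|{: {ffun 'I_J -> bool}}|%:R :> R.
  by rewrite ltr0n; apply/card_gt0P; exists [ffun=> true].
have M0 : (0 <= M)%E.
  apply: le_trans (risk_le [ffun=> true]).
  by apply: integral_ge0 => D _; rewrite expe_ge0// Lnorm_ge0.
clearbody M; case: M risk_le M0 => [r _ _|_ _ _|//]; last by rewrite leey.
rewrite sumEFin !lee_fin sumr_const -[X in _ <= X -> _]mulr_natl ler_pM2l//.
rewrite d2; apply: le_trans; rewrite le_eqVlt; apply/orP; left; apply/eqP.
by field; rewrite gt_eqF.
Qed.

End minimax.

Theorem theoremS1 (R : realType) (J : nat) (w : 'I_J -> {mfun plane R >-> R})
    (w_graphon : forall j, graphon (w j)) (w_indep : lin_indep_L2 w)
    (m : nat) (m_ge1 : (1 <= m)%N) (nu tau : R) (nu_gt0 : 0 < nu)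
    (tau_gt0 : 0 < tau) :
  let d : R := J.+1%:R in
  let lambda := lambda_min (gram w) in
  let L := Lconst w in
  let kap := kappa m nu tau in
  let what := fun D : m.-tuple (plane R * bool) => w_hat_plus w nu tau D in
  let tail := d * expR (- (m%:R / (7 * L))) in
  (forall wstar : {mfun plane R >-> R}, graphon wstar ->
    let wo := w_circ w wstar in
    let bias := 8 * kap ^+ 2 * (\sum_i beta_circ w wstar i 0 ^+ 2) / lambda in
    let c := cconst w wstar in
    (risk what wstar
      <= normL2 (fun p => wstar p - wo p)%R ^+ 2
         + (8 * c / m%:R + bias + tail)%:E)%E
    /\
    (forall r : R, 0 < r ->
      (\int[data_law m wstar]_D
          posterior w nu tau D
            [set u : plane R -> R | r%:E < normL2 (fun p => u p - wo p)%R ^+ 2]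
       <= (r^-1 * ((8 * c + 2 * nu * d) / m%:R + bias) + tail)%:E)%E))
  /\
  (3 * Bconst w ^+ 2 / 8 <= m%:R ->
    [/\ ((3 * (d - 1) / (512 * m%:R))%:E <= minimax_risk w m)%E,
        (minimax_risk w m <= max_risk w what)%E &
        (max_risk w what
          <= (2 * d / m%:R + 8 * nu ^+ 2 / (m%:R ^+ 2 * tau ^+ 4 * lambda ^+ 2)
              + tail)%:E)%E]).
Proof.
move=> d lambda L kap what tail; split=> [wstar wstar_graphon|mB].
  have u01 := graphon_ae wstar_graphon.
  move=> wo bias c; split=> [|r r0].
    exact: risk_upper_bound.
  exact: posterior_upper_bound.
split.
- have -> : d - 1 = J%:R by rewrite /d -natr1 addrK.
  exact: minimax_lower_bound.
- exact: minimax_le_ridge.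
- exact: max_risk_upper_bound.
Qed.
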